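(* Let the discrete pressure space $\mathbb P^h(t)$ be allowed to depend on time. For $t\in(0,T]$, let $\mathbf u^h(t)\in\mathbb U^h$, $p^h(t)\in\mathbb P^h(t)$, $\mathbb B^h(t)\in\mathbb S^h$ with $\mathbb B^h(t)$ positive definite, $\mathbf X^h(t)\in\mathbf V(\Gamma^h(t))$ and $\kappa^h(t)\in V(\Gamma^h(t))$ form a solution of the semi-discrete system of the context. If the characteristic function $\chi_{|\Omega^h_-(t)}$ of $\Omega^h_-(t)$ belongs to $\mathbb P^h(t)$, then the volume of $\Omega^h_-(t)$ is conserved, i.e. $$\frac{d}{dt}\mathcal L^d(\Omega^h_-(t))=0,$$ where $\mathcal L^d$ denotes the $d$-dimensional Lebesgue measure.
   Context: **Domain, parameters, notation.** $d\in\{2,3\}$, $T>0$; $\Omega\subset\mathbb R^d$ is a bounded Lipschitz domain with polygonal (polyhedral) boundary and outer unit normal $\mathbf n$; $\partial_D\Omega\subset\partial\Omega$ is closed with positive surface measure, $\partial_N\Omega=\partial\Omega\setminus\partial_D\Omega$; $H^1_D(\Omega;\mathbb R^d)=\{\mathbf z\in H^1(\Omega;\mathbb R^d):\mathbf z=\mathbf 0\text{ on }\partial_D\Omega,\ \mathbf z\cdot\mathbf n=0\text{ on }\partial_N\Omega\}$. Constants $\rho_\pm,\mu_\pm,\lambda_\pm,G,\gamma>0$, $\alpha\ge0$; $\mathbf f_1,\mathbf f_2\in C([0,T];C(\overline\Omega;\mathbb R^d))$. $\mathbb R^{d\times d}_S$: symmetric matrices; $\mathbb I$: identity matrix; $:$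 Frobenius product; $(\nabla\mathbf u)_{ij}=\partial_{x_j}u_i$; $\mathbb D(\mathbf u)=\frac12(\nabla\mathbf u+(\nabla\mathbf u)^\top)$. Scalar functions act on symmetric matrices through the spectrum. $(\cdot,\cdot)$: $L^2(\Omega)$ inner product. **Bulk mesh and spaces.** $\mathcal T^h$ is a fixed regular partitioning of $\Omega$ into disjoint open simplices, matching $\partial_D\Omega$ exactly by its sides. $\mathcal S^h_k$ ($k\ge1$): continuous piecewise polynomials of degree $\le k$ on $\mathcal T^h$; $\mathcal S^h_0$: piecewise constants; $I^h_k$ ($k\ge1$): nodal interpolation into $\mathcal S^h_k$ (entrywise). $\mathbb S^h=[\mathcal S^h_1]^{d\times d}_S$; $\mathbb U^h\subset H^1_D(\Omega;\mathbb R^d)$ a fixed finite-dimensional space of continuous piecewise polynomials on $\mathcal T^h$; $\mathbb P^h(t)\subset L^2(\Omega)$ a finite-dimensional pressure space. $\mathbf f^h_i(t)=I^h_2\mathbf f_i(t)$. Mass lumping: $(a,b)^h_{\mathcal T^h}=\frac1{d+1}\sum_{K\in\mathcal T^h}|K|\sum_{k=0}^d\lim_{K\ni\mathbf p\to\mathbf p^K_k}a(\mathbf p)b(\mathbf p)$, $\mathbf p^K_k$ the vertices of $K$ (with $:$ for matrices). **Interface.** For each $t$, $\Gamma^h(t)\subset\overline\Omega$ is a closed polyhedral hypersurface without self-intersections, a union of closures of non-degenerate $(d-1)$-simplices $\sigma\in\mathcal T(\Gamma^h(t))$ without hanging vertices; $\Omega^h_-(t)$, $\Omega^h_+(t)$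 are its interior and exterior in $\Omega$, $\Gamma^h(t)=\partial\Omega^h_-(t)$; $\pmb\nu^h(t)$ is the piecewise constant unit normal pointing into $\Omega^h_+(t)$; $\nabla_s$ the surface gradient. $V(\Gamma^h(t))$: continuous functions on $\Gamma^h(t)$ affine on each $\sigma$; $\mathbf V(\Gamma^h(t))=[V(\Gamma^h(t))]^d$. $\mathbf X^h(t)=\mathbf{id}|_{\Gamma^h(t)}\in\mathbf V(\Gamma^h(t))$ describes the interface, and $\partial_t\mathbf X^h\in\mathbf V(\Gamma^h(t))$ is the piecewise linear function whose value at each vertex is the velocity of that vertex. $\langle\cdot,\cdot\rangle_{\Gamma^h(t)}$: $L^2(\Gamma^h(t))$ inner product; $\langle a,b\rangle^h_{\Gamma^h(t)}=\frac1d\sum_\sigma|\sigma|\sum_{k=0}^{d-1}\lim_{\sigma\ni\mathbf q\to\mathbf q^\sigma_k}a(\mathbf q)b(\mathbf q)$, $\mathbf q^\sigma_k$ the vertices of $\sigma$. $\rho^h(t)\in\mathcal S^h_0$ equals $\rho_-$ on $K\subset\Omega^h_-(t)$, $\rho_+$ on $K\subset\Omega^h_+(t)$, $\frac12(\rho_-+\rho_+)$ on $K$ with $K\cap\Gamma^h(t)\neq\emptyset$; $\mu^h,\lambda^h$ analogously. **The tensor $\mathbf\Lambda_{i,j}$.** For $K\in\mathcal T^h$ with vertices $\mathbf p^K_0,\dots,\mathbf p^K_d$ let $\mathcal A_K$ be the matrix such that $\hat{\mathbf x}\mapsto\mathbf p^K_0+\mathcal A_K\hat{\mathbf x}$ maps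 the reference simplex (vertices: origin and standard basis vectors) to $K$, $i$-th vertex to $\mathbf p^K_i$. For $\mathbb B\in\mathbb S^h$ positive definite let $\mathbb B^K_i=\mathbb B(\mathbf p^K_i)$ and, for $i=1,\dots,d$, $\hat{\mathbf\Lambda}_i=\mathbb B^K_i$ if $\mathbb B^K_i=\mathbb B^K_0$, and otherwise $\hat{\mathbf\Lambda}_i=\mathbb B^K_i+\lambda_i(\mathbb B^K_0-\mathbb B^K_i)$ with $$\lambda_i=\frac{\operatorname{Tr}\ln(\mathbb B^K_i)^{-1}-\operatorname{Tr}\ln(\mathbb B^K_0)^{-1}+\mathbb B^K_i:(-(\mathbb B^K_i)^{-1}+(\mathbb B^K_0)^{-1})}{(\mathbb B^K_i-\mathbb B^K_0):(-(\mathbb B^K_i)^{-1}+(\mathbb B^K_0)^{-1})}.$$ Then $\mathbf\Lambda_{i,j}(\mathbb B)|_K=\sum_{m=1}^d[(\mathcal A_K^\top)^{-1}]_{i,m}\hat{\mathbf\Lambda}_m[\mathcal A_K^\top]_{m,j}$. **Semi-discrete system.** Given $\Gamma^h(0)$, $\mathbf u^h(0)\in\mathbb U^h$, $\mathbb B^h(0)\in\mathbb S^h$ positive definite, find for all $t\in(0,T]$ $\mathbf u^h(t)\in\mathbb U^h$, $p^h(t)\in\mathbb P^h(t)$, $\mathbb B^h(t)\in\mathbb S^h$ positive definite, $\mathbf X^h(t)\in\mathbf V(\Gamma^h(t))$, $\kappa^h(t)\in V(\Gamma^h(t))$ such that, for all $t$ and all (time-dependent) test functions $(\mathbf w,q,\mathbb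 G,\pmb\zeta,\chi)\in\mathbb U^h\times\mathbb P^h(t)\times\mathbb S^h\times\mathbf V(\Gamma^h(t))\times V(\Gamma^h(t))$ (all occurring time derivatives being assumed to exist), $$\begin{aligned}0={}&\tfrac{d}{dt}\tfrac12(\rho^h\mathbf u^h,\mathbf w)+\tfrac12(\rho^h\partial_t\mathbf u^h,\mathbf w)-\tfrac12(\rho^h\mathbf u^h,\partial_t\mathbf w)+\tfrac12(\rho^h,[(\mathbf u^h\cdot\nabla)\mathbf u^h]\cdot\mathbf w)-\tfrac12(\rho^h,\mathbf u^h\cdot[(\mathbf u^h\cdot\nabla)\mathbf w])\\&+(2\mu^h\mathbb D(\mathbf u^h),\mathbb D(\mathbf w))-(p^h,\operatorname{div}\mathbf w)+G(\mathbb B^h-\mathbb I,\nabla\mathbf w)-\gamma\langle\kappa^h\pmb\nu^h,\mathbf w\rangle_{\Gamma^h(t)}-(\rho^h\mathbf f^h_1+\mathbf f^h_2,\mathbf w),\\ 0={}&(\operatorname{div}\mathbf u^h,q),\\ 0={}&\tfrac{d}{dt}(\mathbb B^h,\mathbb G)^h_{\mathcal T^h}-(\mathbb B^h,\partial_t\mathbb G)^h_{\mathcal T^h}-\sum_{i,j=1}^d([\mathbf u^h]_i\mathbf\Lambda_{i,j}(\mathbb B^h),\partial_{x_j}\mathbb G)+(\tfrac1{\lambda^h}(\mathbb B^h-\mathbb I),\mathbb G)^h_{\mathcal T^h}\\&-2(\nabla\mathbf u^h,I^h_1[\mathbb G\mathbb B^h])+\alpha(\nabla\mathbb B^h,\nabla\mathbb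 G),\\ 0={}&\langle\kappa^h\pmb\nu^h,\pmb\zeta\rangle^h_{\Gamma^h(t)}+\langle\nabla_s\mathbf X^h,\nabla_s\pmb\zeta\rangle_{\Gamma^h(t)},\\ 0={}&\langle\partial_t\mathbf X^h\cdot\pmb\nu^h,\chi\rangle^h_{\Gamma^h(t)}-\langle\mathbf u^h\cdot\pmb\nu^h,\chi\rangle_{\Gamma^h(t)}.\end{aligned}$$ *)

(* Defs.v *)
From HB Require Import structures.
From mathcomp Require Import all_boot all_order all_algebra.
From mathcomp Require Import all_classical all_reals all_analysis.
Set Implicit Arguments.
Unset Strict Implicit.
Unset Printing Implicit Defensive.
Import Order.TTheory GRing.Theory Num.Theory.
Import numFieldNormedType.Exports.
Local Open Scope classical_set_scope.
Local Open Scope ring_scope.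

Definition row_display : measure_display.
Proof. exact: default_measure_display. Qed.

Section row_measurable.
Context (R : realType) (k : nat).

Let coord : 'I_k -> 'rV[R]_k -> R := fun i x => x ord0 i.

Let row_set0 : g_sigma_preimage coord set0.
Proof. exact: sigma_algebra0. Qed.

Let row_setC A : g_sigma_preimage coord A -> g_sigma_preimage coord (~` A).
Proof. exact: sigma_algebraC. Qed.

Let row_bigcup (F : _^nat) : (forall i, g_sigma_preimage coord (F i)) ->
  g_sigma_preimage coord (\bigcup_i (F i)).
Proof. exact: sigma_algebra_bigcup. Qed.

HB.instance Definition _ := @isMeasurable.Build row_display
  'rV[R]_k (g_sigma_preimage coord) row_set0 row_setC row_bigcup.

Lemma measurable_coord (i : 'I_k) :
  measurable_fun [set: 'rV[R]_k] (fun x : 'rV[R]_k => x ord0 i).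
Proof.
move=> _ Y mY; rewrite setTI; apply: sub_sigma_algebra => /=.
rewrite -bigcup_seq/=; exists i => /=; first by rewrite mem_index_enum.
by exists Y => //; rewrite setTI.
Qed.

Lemma measurable_fun_rowP d (S : measurableType d) (f : S -> 'rV[R]_k) :
  (forall i, measurable_fun [set: S] (fun x => f x ord0 i)) ->
  measurable_fun [set: S] f.
Proof.
move=> mf _ A mA; rewrite setTI.
suff sub : g_sigma_preimage coord `<=` [set B | measurable (f @^-1` B)].
  exact: (sub A mA).
apply: smallest_sub.
  split => [|B mB|F mF] /=.
  - by rewrite preimage_set0; exact: measurable0.
  - by rewrite setTD preimage_setC; exact: measurableC.
  - by rewrite preimage_bigcup; apply: bigcup_measurable => i _; exact: mF.
move=> B /=; rewrite -bigcup_seq/= => -[i _ [C mC <-]].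
rewrite setTI -comp_preimage.
have := mf i measurableT C mC.
by rewrite setTI.
Qed.

End row_measurable.

Section leb_row.
Context (R : realType).

Definition row_cons k (xy : measurableTypeR R * 'rV[R]_k) : 'rV[R]_k.+1 :=
  @row_mx R 1 1 k xy.1%:M xy.2.

Lemma measurable_row_cons k : measurable_fun [set: measurableTypeR R * 'rV[R]_k] (@row_cons k).
Proof.
apply: measurable_fun_rowP => i.
case: (@splitP 1 k i) => j ij.
  rewrite (_ : (fun _ => _) = fst).
    exact: measurable_fst.
  apply/funext => -[x y]; rewrite /row_cons /=.
  have -> : i = lshift k j by apply/val_inj.
  by rewrite (row_mxEl (x%:M) y) (ord1 j) mxE eqxx mulr1n.
rewrite (_ : (fun _ => _) = (fun y : 'rV[R]_k => y ord0 j) \o snd).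
  apply: measurableT_comp; first exact: measurable_coord.
  exact: measurable_snd.
apply/funext => -[x y]; rewrite /row_cons /=.
have -> : i = rshift 1 j by apply/val_inj.
by rewrite (row_mxEr (x%:M) y).
Qed.

Definition row_uncons k (x : 'rV[R]_k.+1) : measurableTypeR R * 'rV[R]_k :=
  (x ord0 ord0, \row_j x ord0 (lift ord0 j)).

Lemma measurable_row_uncons k : measurable_fun [set: 'rV[R]_k.+1] (@row_uncons k).
Proof.
apply: measurable_fun_pair; first exact: measurable_coord.
apply: measurable_fun_rowP => i.
under eq_fun do rewrite mxE.
exact: measurable_coord.
Qed.

Lemma row_consK k : cancel (@row_cons k) (@row_uncons k).
Proof.
move=> [x y]; congr pair; rewrite /row_cons /=.
  have -> : (ord0 : 'I_k.+1) = lshift k (ord0 : 'I_1) by apply/val_inj.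
  by rewrite (row_mxEl (x%:M) y) mxE eqxx mulr1n.
apply/rowP => j; rewrite mxE.
have -> : lift ord0 j = rshift 1 j by apply/val_inj.
by rewrite (row_mxEr (x%:M) y).
Qed.


Definition lebesgue_ind k (m : {sigma_finite_measure set 'rV[R]_k -> \bar R}) :
    set 'rV[R]_k.+1 -> \bar R :=
  pushforward (@lebesgue_measure R \x m)%E (@row_cons k).

Section lebesgue_ind_measure.
Context (k : nat) (m : {sigma_finite_measure set 'rV[R]_k -> \bar R}).

Let prod : {measure set (measurableTypeR R * 'rV[R]_k)%type -> \bar R} := (@lebesgue_measure R \x m)%E.

Let push : {measure set 'rV[R]_k.+1 -> \bar R} :=
  measure_function_pushforward__canonical__measure_function_Measure
    prod (@measurable_row_cons k).

Let lebesgue_ind0 : lebesgue_ind m set0 = 0%E.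
Proof. exact: (measure0 push). Qed.

Let lebesgue_ind_ge0 A : (0 <= lebesgue_ind m A)%E.
Proof. exact: (measure_ge0 push). Qed.

Let lebesgue_ind_sigma_additive : semi_sigma_additive (lebesgue_ind m).
Proof. exact: (@measure_semi_sigma_additive _ _ _ push). Qed.

HB.instance Definition _ := isMeasure.Build _ _ _ (lebesgue_ind m)
  lebesgue_ind0 lebesgue_ind_ge0 lebesgue_ind_sigma_additive.

Let lebesgue_ind_sigma_finite : sigma_finite setT (lebesgue_ind m).
Proof.
have /sigma_finiteP[F [FT ndF Foo]] := sigma_finiteT (@lebesgue_measure R).
have /sigma_finiteP[G [GT ndG Goo]] := sigma_finiteT m.
exists (fun i => @row_uncons k @^-1` (F i `*` G i)).
  rewrite -preimage_bigcup (_ : \bigcup_i _ = setT) ?preimage_setT//.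
  apply/seteqP; split => // -[x y] _.
  have [i _ Fx] : (\bigcup_i F i) x by rewrite -FT.
  have [j _ Gy] : (\bigcup_i G i) y by rewrite -GT.
  exists (maxn i j) => //; split => /=.
    by move: x Fx; exact/subsetPset/ndF/leq_maxl.
  by move: y Gy; exact/subsetPset/ndG/leq_maxr.
move=> i; have [mF Fi] := Foo i; have [mG Gi] := Goo i; split.
  rewrite -[X in measurable X]setTI; apply: measurable_row_uncons => //.
  exact: measurableX.
rewrite /lebesgue_ind /pushforward -comp_preimage.
rewrite (_ : _ \o _ = id) ?preimage_id; last first.
  by apply/funext => x; exact: row_consK.
rewrite (product_measure1E (@lebesgue_measure R) m)//.
by rewrite lte_mul_pinfty// ge0_fin_numE.
Qed.

HB.instance Definition _ := Measure_isSigmaFinite.Build _ _ _ (lebesgue_ind m)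
  lebesgue_ind_sigma_finite.

End lebesgue_ind_measure.

Fixpoint leb k : {sigma_finite_measure set 'rV[R]_k -> \bar R} :=
  if k is k'.+1 then lebesgue_ind (leb k') else dirac (0 : 'rV[R]_0).

End leb_row.

Arguments leb {R} k.

Section time_derivative.
Context (R : realType) (W : normedModType R) (T : R).

Definition tquot (f : R -> W) (t h : R) : W := h^-1 *: (f (t + h) - f t).

(* Times stay in ]0, T], so the derivative is one-sided at T. *)
Definition tfilter (t : R) : set_system R :=
  within [set h | 0 < t + h <= T] (0 : R)^'.

Definition is_tder (f : R -> W) (t : R) (l : W) : Prop :=
  tquot f t @ tfilter t --> l.

Definition tderivable (f : R -> W) (t : R) : Prop :=
  cvg (tquot f t @ tfilter t).

Definition tder (f : R -> W) (t : R) : W := lim (tquot f t @ tfilter t).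

End time_derivative.

Section vectors.
Context (R : realType).

Definition frob m k (A B : 'M[R]_(m, k)) : R := \sum_i \sum_j A i j * B i j.

Definition dot k (x y : 'rV[R]_k) : R := \sum_i x ord0 i * y ord0 i.

Definition enorm k (x : 'rV[R]_k) : R := Num.sqrt (dot x x).

Definition symmx k (A : 'M[R]_k) : Prop := A^T = A.

Definition posdef k (A : 'M[R]_k) : Prop :=
  symmx A /\ forall x : 'rV[R]_k, x != 0 -> 0 < dot (x *m A) x.

(* g(A) = Q^T diag(g(d)) Q for any spectral decomposition A = Q^T diag(d) Q,
   which exists for symmetric A; the value does not depend on the choice. *)
Definition mxfun k (g : R -> R) (A : 'M[R]_k) : 'M[R]_k :=
  xget 0 [set C | exists (Q : 'M[R]_k) (d : 'rV[R]_k),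
    [/\ Q *m Q^T = 1%:M, A = Q^T *m diag_mx d *m Q
      & C = Q^T *m diag_mx (map_mx g d) *m Q]].

Definition finite_span (E : lmodType R) (U : set E) : Prop :=
  exists (m : nat) (b : 'I_m -> E),
    U = [set v | exists c : 'I_m -> R, v = \sum_i c i *: b i].

End vectors.

Section calculus.
Context (R : realType) (n : nat).
Notation d := n.+1.
Notation pt := 'rV[R]_d.

Definition partial (j : 'I_d) (f : pt -> R) (x : pt) : R :=
  'D_(delta_mx ord0 j : pt) f x.

Definition jac (u : pt -> pt) (x : pt) : 'M[R]_d :=
  \matrix_(i, j) partial j (fun y => u y ord0 i) x.

Definition symjac (u : pt -> pt) (x : pt) : 'M[R]_d :=
  2^-1 *: (jac u x + (jac u x)^T).

Definition divergence (u : pt -> pt) (x : pt) : R := \tr (jac u x).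

(* (v . grad) w *)
Definition convect (v w : pt -> pt) (x : pt) : pt := v x *m (jac w x)^T.

Definition partialM (j : 'I_d) (B : pt -> 'M[R]_d) (x : pt) : 'M[R]_d :=
  \matrix_(k, l) partial j (fun y => B y k l) x.

Definition boundary (A : set pt) : set pt := closure A `\` interior A.

Definition L2 (Om : set pt) (f : pt -> R) : Prop :=
  measurable_fun Om f /\
  (leb d).-integrable Om (fun x => ((f x) ^+ 2)%:E).

Definition smooth (phi : pt -> R) : Prop :=
  forall (s : seq 'I_d) (x : pt), differentiable (foldr partial phi s) x.

Definition test_function (Om : set pt) (phi : pt -> R) : Prop :=
  smooth phi /\ exists C : set pt,
    [/\ compact C, C `<=` Om & forall x, ~ C x -> phi x = 0].

Definition weak_partial (Om : set pt) (j : 'I_d) (f g : pt -> R) : Prop :=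
  forall phi, test_function Om phi ->
    \int[leb d]_(x in Om) (f x * partial j phi x) =
    - \int[leb d]_(x in Om) (g x * phi x).

Definition H1 (Om : set pt) (f : pt -> R) : Prop :=
  L2 Om f /\ forall j, exists2 g, L2 Om g & weak_partial Om j f g.

(* Only used at points around which the boundary is flat, i.e. almost
   everywhere on the boundary of a polyhedral domain. *)
Definition outer_normal (Om : set pt) (x nu : pt) : Prop :=
  dot nu nu = 1 /\ \forall y \near x, (Om y <-> dot (y - x) nu < 0).

(* H^1_D(Om; R^d) intersected with C(closure Om; R^d): for such fields the
   boundary traces are the pointwise boundary values. *)
Definition H1D_cont (Om dD : set pt) (z : pt -> pt) : Prop :=
  [/\ forall i, H1 Om (fun x => z x ord0 i),
      {within closure Om, continuous z},
      forall x, dD x -> z x = 0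
    & forall x nu, (boundary Om `\` dD) x -> outer_normal Om x nu ->
        dot (z x) nu = 0].

Definition polynomial_on (k : nat) (A : set pt) (f : pt -> R) : Prop :=
  exists c : {ffun 'I_d -> 'I_k.+1} -> R, forall x, A x ->
    f x = \sum_(m : {ffun 'I_d -> 'I_k.+1} | (\sum_i m i <= k)%N)
            c m * \prod_i x ord0 i ^+ m i.

End calculus.

(* The combinatorics of a k-dimensional simplicial mesh; positions of the nodes
   are given separately, since those of an interface move in time. *)
Record mesh (k : nat) := Mesh {
  node : finType;
  cell : finType;
  vert : cell -> 'I_k.+1 -> node }.

Definition verts k (M : mesh k) (s : cell M) : {set node M} :=
  [set vert s i | i : 'I_k.+1].

Section simplices.
Context (R : realType) (d : nat).
Notation pt := 'rV[R]_d.

Definition hull (V : finType) (q : V -> pt) (W : {set V}) : set pt :=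
  [set x | exists c : V -> R,
    [/\ forall v, 0 <= c v, forall v, v \notin W -> c v = 0,
        \sum_v c v = 1 & x = \sum_v c v *: q v]].

Definition osimplex k (p : 'I_k.+1 -> pt) : set pt :=
  [set x | exists c : 'I_k.+1 -> R,
    [/\ forall i, 0 < c i, \sum_i c i = 1 & x = \sum_i c i *: p i]].

Definition edges k (p : 'I_k.+1 -> pt) : 'M[R]_(k, d) :=
  \matrix_(i < k) (p (lift ord0 i) - p ord0).

Definition refsimplex k : set 'rV[R]_k :=
  [set x | (forall i, 0 < x ord0 i) /\ \sum_i x ord0 i < 1].

(* Integral over the simplex p with respect to its k-dimensional surface
   measure, through the affine parametrization by the reference simplex. *)
Definition int_simplex k (p : 'I_k.+1 -> pt) (f : pt -> R) : R :=
  Num.sqrt (\det (edges p *m (edges p)^T)) *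
  \int[leb k]_(x in @refsimplex k) f (p ord0 + x *m edges p).

Definition vertex_lim k (p : 'I_k.+1 -> pt) (f : pt -> R) (i : 'I_k.+1) : R :=
  lim (f @ within (osimplex p) (nbhs (p i))).

Definition affine_on k (p : 'I_k.+1 -> pt) (f : pt -> R) : Prop :=
  forall c : 'I_k.+1 -> R, (forall i, 0 <= c i) -> \sum_i c i = 1 ->
    f (\sum_i c i *: p i) = \sum_i c i * f (p i).

Context (k : nat) (M : mesh k) (q : node M -> pt).

Definition cpos (s : cell M) : 'I_k.+1 -> pt := fun i => q (vert s i).

Definition carrier : set pt := \bigcup_(s in [set: cell M]) hull q (verts s).

(* Nondegenerate cells without hanging vertices: two closed cells meet exactly
   in their common face (so distinct open cells are disjoint). *)
Definition conforming : Prop :=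
  [/\ forall s, row_free (edges (cpos s)),
      injective (@verts k M),
      forall v, exists s : cell M, v \in verts s
    & forall s s' : cell M, hull q (verts s) `&` hull q (verts s') `<=`
        hull q (verts s :&: verts s')].

End simplices.

Section domain.
Context (R : realType) (n : nat).
Notation d := n.+1.
Notation pt := 'rV[R]_d.

Definition lipschitz_boundary (Om : set pt) : Prop :=
  forall x0, boundary Om x0 ->
    exists (Q : 'M[R]_d) (phi : 'rV[R]_n -> R) (L r h : R),
    [/\ Q *m Q^T = 1%:M, 0 < r, 0 < h,
        forall y z, `|phi y - phi z| <= L * enorm (y - z)
      & forall (y : 'rV[R]_n) (s : R), enorm y < r -> `|s| < h ->
          (Om (x0 + row_cons (s, y) *m Q) <-> s < phi y)].

(* The last field says that the boundary is polyhedral, being triangulated by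
   (d-1)-simplices, and that the surface measure of dD is positive. *)
Record polyhedral_domain (Om dD : set pt) : Prop := {
  domain_open : open Om;
  domain_bounded : bounded_set Om;
  domain_connected : connected Om;
  domain_nonempty : Om !=set0;
  domain_lipschitz : lipschitz_boundary Om;
  dirichlet_closed : closed dD;
  dirichlet_boundary : dD `<=` boundary Om;
  domain_polyhedral : exists (F : mesh n) (b : node F -> pt),
    [/\ conforming b, boundary Om = carrier b
      & 0 < \sum_(s : cell F) int_simplex (cpos b s) \1_dD] }.

(* the last field: dD is a union of closed sides of elements *)
Record triangulation (Om dD : set pt) (Th : mesh d) (z : node Th -> pt)
    : Prop := {
  triangulation_conforming : conforming z;
  triangulation_inside : forall K, osimplex (cpos z K) `<=` Om;
  triangulation_cover : closure Om = carrier z;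
  triangulation_dirichlet : exists F : {set cell Th * 'I_d.+1},
    dD = \bigcup_(e in [set` F]) hull z (verts e.1 :\ vert e.1 e.2) }.

Context (Om : set pt) (Th : mesh d) (z : node Th -> pt).

Notation elt K := (osimplex (cpos z K)).

(* the spaces S^h_k for k >= 1 *)
Definition Sh (k : nat) (f : pt -> R) : Prop :=
  {within closure Om, continuous f} /\
  forall K, polynomial_on k (elt K) f.

Definition ShM (B : pt -> 'M[R]_d) : Prop :=
  (forall x, closure Om x -> symmx (B x)) /\
  forall i j, Sh 1 (fun x => B x i j).

Definition pw_polynomial (w : pt -> pt) : Prop :=
  exists k, forall i, Sh k (fun x => w x ord0 i).

(* Lagrange nodes: barycentric coordinates in (1/k) nat *)
Definition is_interp (k : nat) (f g : pt -> R) : Prop :=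
  Sh k g /\
  forall (K : cell Th) (m : {ffun 'I_d.+1 -> 'I_k.+1}), (\sum_i m i = k)%N ->
    let a := \sum_i ((m i)%:R / k%:R) *: cpos z K i in g a = f a.

(* the values outside of closure Om are irrelevant *)
Definition interp (k : nat) (f : pt -> R) : pt -> R :=
  xget (fun=> 0) [set g | is_interp k f g].

Definition interpM (k : nat) m l (F : pt -> 'M[R]_(m, l)) (x : pt)
    : 'M[R]_(m, l) :=
  \matrix_(i, j) interp k (fun y => F y i j) x.

Definition piecewise (W : lmodType R) (c : cell Th -> W) (x : pt) : W :=
  \sum_K (\1_(elt K) x : R) *: c K.

(* Elements are connected, so one that lies neither in the inner phase nor in
   the outer one meets the interface. *)
Definition phase (inner outer : set pt) (a_in a_out : R) : pt -> R :=
  piecewise (W := R^o) (fun K =>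
    if `[< elt K `<=` inner >] then a_in
    else if `[< elt K `<=` outer >] then a_out
    else 2^-1 * (a_in + a_out)).

Definition intOm (f : pt -> R) : R := \int[leb d]_(x in Om) f x.

Definition lumped (f : pt -> R) : R :=
  d.+1%:R^-1 * \sum_K fine (leb d (elt K)) *
                 \sum_i vertex_lim (cpos z K) f i.

(* the matrix A_K of the affine map from the reference simplex onto K *)
Definition refmx (K : cell Th) : 'M[R]_d :=
  \matrix_(i, j) (cpos z K (lift ord0 j) - cpos z K ord0) ord0 i.

Definition trln (A : 'M[R]_d) : R := \tr (mxfun (@ln R) A).

(* Bi and B0 stand for the values at the i-th and the 0-th vertex *)
Definition lambda_coef (Bi B0 : 'M[R]_d) : R :=
  (trln (invmx Bi) - trln (invmx B0) + frob Bi (- invmx Bi + invmx B0)) /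
  frob (Bi - B0) (- invmx Bi + invmx B0).

Definition Lambda_hat (Bi B0 : 'M[R]_d) : 'M[R]_d :=
  if Bi == B0 then Bi else Bi + lambda_coef Bi B0 *: (B0 - Bi).

Definition Lambda (B : pt -> 'M[R]_d) (i j : 'I_d) : pt -> 'M[R]_d :=
  piecewise (fun K => \sum_m
    (invmx (refmx K)^T i m * (refmx K)^T m j) *:
      Lambda_hat (B (cpos z K (lift ord0 m))) (B (cpos z K ord0))).

End domain.

Section interface.
Context (R : realType) (n : nat).
Notation d := n.+1.
Notation pt := 'rV[R]_d.

(* A closed hypersurface: every (d-2)-face belongs to exactly two simplices,
   and the simplices around a vertex are connected to each other through
   (d-2)-faces containing this vertex. *)
Definition closed_surface (Ga : mesh n) : Prop :=
  (forall (s : cell Ga) (i : 'I_n.+1),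
     #|[set s' : cell Ga | verts s :\ vert s i \subset verts s']| = 2%N) /\
  (forall (v : node Ga) (s s' : cell Ga), v \in verts s -> v \in verts s' ->
     connect [rel a b | [&& v \in verts a, v \in verts b
                          & #|verts a :&: verts b| == n]] s s').

Definition outer_phase (Om inner : set pt) (Ga : mesh n) (q : node Ga -> pt)
    : set pt :=
  Om `\` (inner `|` carrier q).

(* The alternative "outside of Om" in the last field only concerns points of
   the interface that lie on the boundary of Om. *)
Record interface (Om inner : set pt) (Ga : mesh n) (q : node Ga -> pt)
    (nu : cell Ga -> pt) : Prop := {
  interface_closed : closed_surface Ga;
  interface_conforming : conforming q;
  interface_inside : carrier q `<=` closure Om;
  inner_open : open inner;
  inner_inside : inner `<=` Om;
  inner_boundary : boundary inner = carrier q;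
  normal_unit : forall s, dot (nu s) (nu s) = 1;
  normal_orthogonal : forall s, edges (cpos q s) *m (nu s)^T = 0;
  normal_outward : forall s x, osimplex (cpos q s) x ->
    \forall e \near 0^'+,
      (outer_phase Om inner q `|` ~` Om) (x + e *: nu s) }.

Context (Ga : mesh n) (q : node Ga -> pt).

Definition Vh (f : pt -> R) : Prop :=
  {within carrier q, continuous f} /\ forall s, affine_on (cpos q s) f.

Definition VhV (f : pt -> pt) : Prop := forall i, Vh (fun x => f x ord0 i).

(* Integrands on the interface may be discontinuous across simplices, so they
   are given as one function per simplex. *)
Definition intGa (f : cell Ga -> pt -> R) : R :=
  \sum_s int_simplex (cpos q s) (f s).

Definition lumpedGa (f : cell Ga -> pt -> R) : R :=
  d%:R^-1 * \sum_s int_simplex (cpos q s) (fun=> 1) *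
              \sum_i vertex_lim (cpos q s) (f s) i.

(* The tangential vector whose inner product with each edge vector of the
   simplex p is the derivative of f in the direction of that edge. *)
Definition sgrad (p : 'I_n.+1 -> pt) (f : pt -> R) (x : pt) : pt :=
  (\row_k 'D_(row k (edges p)) f x) *m
    invmx (edges p *m (edges p)^T) *m edges p.

Definition sgradV (p : 'I_n.+1 -> pt) (f : pt -> pt) (x : pt) : 'M[R]_d :=
  \matrix_(i, j) sgrad p (fun y => f y ord0 i) x ord0 j.

End interface.

Record physics (R : realType) (n : nat) := Physics {
  rho_in : R; rho_out : R;
  mu_in : R; mu_out : R;
  lam_in : R; lam_out : R;
  elast : R;  (* G *)
  gam : R;
  alpha : R;
  force1 : R -> 'rV[R]_n.+1 -> 'rV[R]_n.+1;
  force2 : R -> 'rV[R]_n.+1 -> 'rV[R]_n.+1 }.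

Section system.
Context (R : realType) (n : nat).
Notation d := n.+1.
Notation pt := 'rV[R]_d.
Context (T : R) (Om : set pt).

(* C([0,T]; C(closure Om; R^d)) *)
Definition CC (f : R -> pt -> pt) : Prop :=
  (forall t, 0 <= t <= T -> {within closure Om, continuous (f t)}) /\
  (forall t, 0 <= t <= T -> forall e : R, 0 < e -> exists2 del : R, 0 < del &
     forall s, 0 <= s <= T -> `|s - t| < del ->
       forall x, closure Om x -> enorm (f s x - f t x) < e).

Record physics_ok (c : physics R n) : Prop := {
  densities : 0 < rho_in c /\ 0 < rho_out c;
  viscosities : 0 < mu_in c /\ 0 < mu_out c;
  relaxation_times : 0 < lam_in c /\ 0 < lam_out c;
  coefficients : [/\ 0 < elast c, 0 < gam c & 0 <= alpha c];
  forces : CC (force1 c) /\ CC (force2 c) }.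

Context (c : physics R n) (Th : mesh d) (z : node Th -> pt).
Context (Uh : set (pt -> pt)) (Ph : R -> set (pt -> R)).
Context (Ga : mesh n) (q : R -> node Ga -> pt).
Context (inner : R -> set pt) (nu : R -> cell Ga -> pt).

Definition tdiff (W : normedModType R) (D : set pt) (w : R -> pt -> W) : Prop :=
  forall t, 0 < t <= T -> forall x, D x -> tderivable T (fun s => w s x) t.

Definition dt (W : normedModType R) (w : R -> pt -> W) (t : R) (x : pt) : W :=
  tder T (fun s => w s x) t.

Definition phase_at (a_in a_out t : R) : pt -> R :=
  phase z (inner t) (outer_phase Om (inner t) (q t)) a_in a_out.

Definition rhoh := phase_at (rho_in c) (rho_out c).
Definition muh := phase_at (mu_in c) (mu_out c).
Definition lamh := phase_at (lam_in c) (lam_out c).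
Definition fh1 (t : R) := interpM Om z 2 (force1 c t).
Definition fh2 (t : R) := interpM Om z 2 (force2 c t).

Definition momentum_equation (u : R -> pt -> pt) (p : R -> pt -> R)
    (B : R -> pt -> 'M[R]_d) (kappa : R -> pt -> R) (w : R -> pt -> pt)
    (t : R) : Prop :=
  0 = tder T (fun s =>
          2^-1 * intOm Om (fun x => rhoh s x * dot (u s x) (w s x))) t
    + 2^-1 * intOm Om (fun x => rhoh t x * dot (dt u t x) (w t x))
    - 2^-1 * intOm Om (fun x => rhoh t x * dot (u t x) (dt w t x))
    + 2^-1 * intOm Om (fun x => rhoh t x * dot (convect (u t) (u t) x) (w t x))
    - 2^-1 * intOm Om (fun x => rhoh t x * dot (u t x) (convect (u t) (w t) x))
    + intOm Om (fun x => 2 * muh t x * frob (symjac (u t) x) (symjac (w t) x))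
    - intOm Om (fun x => p t x * divergence (w t) x)
    + elast c * intOm Om (fun x => frob (B t x - 1%:M) (jac (w t) x))
    - gam c * intGa (q t) (fun s x => dot (kappa t x *: nu t s) (w t x))
    - intOm Om (fun x => dot (rhoh t x *: fh1 t x + fh2 t x) (w t x)).

Definition incompressibility_equation (u : R -> pt -> pt) (r : R -> pt -> R)
    (t : R) : Prop :=
  0 = intOm Om (fun x => divergence (u t) x * r t x).

Definition stress_equation (u : R -> pt -> pt) (B H : R -> pt -> 'M[R]_d)
    (t : R) : Prop :=
  0 = tder T (fun s => lumped z (fun x => frob (B s x) (H s x))) t
    - lumped z (fun x => frob (B t x) (dt H t x))
    - intOm Om (fun x => \sum_i \sum_j
        frob (u t x ord0 i *: Lambda z (B t) i j x) (partialM j (H t) x))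
    + lumped z (fun x => frob ((lamh t x)^-1 *: (B t x - 1%:M)) (H t x))
    - 2 * intOm Om (fun x =>
        frob (jac (u t) x) (interpM Om z 1 (fun y => H t y *m B t y) x))
    + alpha c * intOm Om (fun x =>
        \sum_j frob (partialM j (B t) x) (partialM j (H t) x)).

Definition curvature_equation (X : R -> pt -> pt) (kappa : R -> pt -> R)
    (zeta : R -> pt -> pt) (t : R) : Prop :=
  0 = lumpedGa (q t) (fun s x => dot (kappa t x *: nu t s) (zeta t x))
    + intGa (q t) (fun s x => frob (sgradV (cpos (q t) s) (X t) x)
                                   (sgradV (cpos (q t) s) (zeta t) x)).

Definition kinematic_equation (u dX : R -> pt -> pt) (chi : R -> pt -> R)
    (t : R) : Prop :=
  0 = lumpedGa (q t) (fun s x => dot (dX t x) (nu t s) * chi t x)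
    - intGa (q t) (fun s x => dot (u t x) (nu t s) * chi t x).

(* dX is the time derivative of X: the field in V(Gamma^h(t)) whose nodal
   values are the velocities of the nodes. *)
Record solution (u : R -> pt -> pt) (p : R -> pt -> R)
    (B : R -> pt -> 'M[R]_d) (X dX : R -> pt -> pt) (kappa : R -> pt -> R)
    : Prop := {
  sol_u : forall t, 0 <= t <= T -> Uh (u t);
  sol_p : forall t, 0 < t <= T -> Ph t (p t);
  sol_B : forall t, 0 <= t <= T -> ShM Om z (B t) /\
            forall x, closure Om x -> posdef (B t x);
  sol_X : forall t, 0 < t <= T -> VhV (q t) (X t) /\
            forall x, carrier (q t) x -> X t x = x;
  sol_kappa : forall t, 0 < t <= T -> Vh (q t) (kappa t);
  sol_nodes : forall t, 0 < t <= T ->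
    forall v, tderivable T (fun s => q s v) t;
  sol_dX : forall t, 0 < t <= T -> VhV (q t) (dX t) /\
    forall v, dX t (q t v) = tder T (fun s => q s v) t;
  sol_dtu : tdiff (closure Om) u;
  sol_system : forall (w : R -> pt -> pt) (r : R -> pt -> R)
      (H : R -> pt -> 'M[R]_d) (zeta : R -> pt -> pt) (chi : R -> pt -> R),
    (forall t, 0 < t <= T -> Uh (w t)) -> tdiff (closure Om) w ->
    (forall t, 0 < t <= T -> Ph t (r t)) ->
    (forall t, 0 < t <= T -> ShM Om z (H t)) -> tdiff (closure Om) H ->
    (forall t, 0 < t <= T -> VhV (q t) (zeta t)) ->
    (forall t, 0 < t <= T -> Vh (q t) (chi t)) ->
    forall t, 0 < t <= T ->
      [/\ tderivable T
            (fun s => 2^-1 * intOm Om (fun x => rhoh s x * dot (u s x) (w s x))) t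
          /\ momentum_equation u p B kappa w t,
          incompressibility_equation u r t,
          tderivable T (fun s => lumped z (fun x => frob (B s x) (H s x))) t
          /\ stress_equation u B H t,
          curvature_equation X kappa zeta t
        & kinematic_equation u dX chi t] }.

End system.

(* Main.v *)
Require Import Defs.
From mathcomp Require Import all_boot all_order all_algebra.
From mathcomp Require Import all_classical all_reals all_analysis.
From mathcomp Require Import perm measurable_realfun ring lra.
Import Order.TTheory GRing.Theory Num.Theory.
Import numFieldNormedType.Exports.
Local Open Scope classical_set_scope.
Local Open Scope ring_scope.
Set Implicit Arguments.
Unset Strict Implicit.
Unset Printing Implicit Defensive.

(** Integrating along parallel lines (Fubini and the fundamental theorem of
calculus on each line) gives the divergence theorem on the inner phase for
continuous piecewise C^1 functions. Applied to the coordinate functions, it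
writes the volume as a sum over the simplices s of the interface of
orientation(s) * det(nodes of s), up to a positive constant.

The orientation of s (the sign of its outward normal against its numbering) is
locally constant in time: along a generic line through s, the sign of each
crossing is determined by the signs of the earlier ones, since the crossings
alternately enter and leave the inner phase, and neither the order nor the
location of these crossings changes for small displacements of the nodes.
Differentiating the determinants row by row, the terms attached to the common
face of two neighbours cancel, because the two induced orientations of this
face are opposite. What remains is the mass-lumped flux of the nodal velocities
through the interface.

By the kinematic equation with chi = 1, that flux equals the flux of u, which by
the divergence theorem is the integral of div u over the inner phase; this is 0
by the incompressibility equation tested with the characteristic function. *)

(** * Linear change of variables for [leb] *)

(** Nothing is assumed about how [inner] and [nu] vary with time: only the nodes move
    differentiably, and at each time separately the phase and the normals satisfy [interface]. No
    transport theorem is at hand, and the constancy of the orientations has to be extracted from the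
    static axioms at nearby times. Determinants of nodes serve this purpose: once the signs are
    frozen, the volume is a polynomial in the coordinates of the nodes.

    The bulk mesh is not fitted to the interface. The lines of the divergence theorem therefore
    cross both the skeleton of the bulk mesh and the interface, and the exceptional lines are those
    over finitely many hyperplanes. Crossings are never sorted along a line: a function that is
    constant on a punctured neighbourhood of every point and zero far below is zero on all these
    neighbourhoods.

    The constant [ref_volume / d] is the integral of one barycentric coordinate over the reference
    simplex and, up to the size of the simplex, the weight of a vertex in mass lumping. The
    derivative of the exact volume therefore matches the lumped pairing without quadrature error. *)

Section leb_linear.
Context {R : realType}.
Notation mu := (@lebesgue_measure R).

(** The scaled pushforward of the Lebesgue measure is a measure, so uniqueness reduces the claim to
    half-open intervals; for negative [a] the preimage is closed at the other end, which does not
    change its length. *)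
Lemma lebesgue_affine (a b : R) (B : set R) : a != 0 -> measurable B ->
  (`|a|%:E * mu [set x | B (a * x + b)%R] = mu B)%E.
Proof.
move=> a0 mB.
pose f (x : measurableTypeR R) : measurableTypeR R := a * x + b.
have mf : measurable_fun setT f.
  apply: measurable_funD => //; exact: measurable_funM.
pose m : {measure set (measurableTypeR R) -> \bar R} :=
  mscale (NngNum (normr_ge0 a)) (measure_function_pushforward__canonical__measure_function_Measure mu mf).
rewrite -[LHS]/(m B); apply/esym/lebesgue_measure_unique => // X.
move=> [[x y] _ <-] /=; rewrite /m /= /mscale /= /pushforward.
rewrite lebesgue_measure_itv /= lte_fin.
have [a1|a1|/eqP] := ltrgt0P a; last by rewrite (negbTE a0).
- have -> : f @^-1` `]x, y] = `](x - b) / a, (y - b) / a]%classic.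
    apply/seteqP; split => z /=; rewrite !in_itv /= /f.
      by rewrite ltr_pdivrMr// ler_pdivlMr// mulrC ltrBlDr lerBrDr.
    by rewrite ltr_pdivrMr// ler_pdivlMr// mulrC ltrBlDr lerBrDr.
  rewrite lebesgue_measure_itv /= lte_fin ltr_pM2r ?invr_gt0// ltrD2r.
  case: ifP => _; last by rewrite mule0.
  by rewrite -!EFinD -EFinM; congr EFin; field.
- have -> : f @^-1` `]x, y] = `[(y - b) / a, (x - b) / a[%classic.
    apply/seteqP; split => z /=; rewrite !in_itv /= /f andbC.
      by rewrite ltr_ndivlMr// ler_ndivrMr// mulrC ltrBlDr lerBrDr.
    by rewrite ltr_ndivlMr// ler_ndivrMr// mulrC ltrBlDr lerBrDr.
  rewrite lebesgue_measure_itv /= lte_fin ltr_nM2r ?invr_lt0// ltrD2r.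
  case: ifP => _; last by rewrite mule0.
  by rewrite -!EFinD -EFinM; congr EFin; field.
Qed.

Lemma leb_slice1 k (B : set 'rV[R]_k.+1) : measurable B ->
  leb k.+1 B = (\int[mu]_x leb k [set y | B (row_cons (x, y))])%E.
Proof.
move=> mB; rewrite /= /lebesgue_ind /pushforward /product_measure1.
by apply: eq_integral => x _ /=; congr (leb k _); apply/seteqP; split => y /=;
  rewrite /xsection /= inE.
Qed.

Lemma measurable_row_slice k (B : set 'rV[R]_k.+1) : measurable B ->
  measurable (@row_cons R k @^-1` B).
Proof.
by move=> mB; rewrite -[X in measurable X]setTI; exact: measurable_row_cons.
Qed.

Lemma measurable_row_slice1 k (B : set 'rV[R]_k.+1) (x : R) : measurable B ->
  measurable [set y | B (row_cons (x, y))].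
Proof.
move=> /measurable_row_slice/(measurable_xsection x); congr measurable.
by apply/seteqP; split => y /=; rewrite /xsection /= inE.
Qed.

Lemma measurable_row_slice2 k (B : set 'rV[R]_k.+1) (y : 'rV[R]_k) :
  measurable B -> measurable [set x : R | B (row_cons (x, y))].
Proof.
move=> /measurable_row_slice/(measurable_ysection y); congr measurable.
by apply/seteqP; split => x /=; rewrite /ysection /= inE.
Qed.

(** [leb] is built by slicing off the first coordinate; Tonelli gives the other order, which is
    needed to move along that coordinate. *)
Lemma leb_slice2 k (B : set 'rV[R]_k.+1) : measurable B ->
  leb k.+1 B = (\int[leb k]_y mu [set x | B (row_cons (x, y))])%E.
Proof.
move=> mB; rewrite leb_slice1//.
have mB' := measurable_row_slice mB.
have := indic_fubini_tonelli mu (leb k) mB'.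
rewrite indic_fubini_tonelli_FE// indic_fubini_tonelli_GE//.
rewrite (_ : leb k \o _ = (fun x => leb k [set y | B (row_cons (x, y))])); last first.
  apply/funext => x /=; congr (leb k _); apply/seteqP; split => y /=.
    by rewrite /xsection /= inE.
  by rewrite /xsection /= inE.
move=> ->; apply: eq_integral => y _ /=; congr (lebesgue_measure _).
by apply/seteqP; split => x /=; rewrite /ysection /= inE.
Qed.

Lemma measurable_leb_slice1 k (B : set 'rV[R]_k.+1) : measurable B ->
  measurable_fun setT (fun x : R => leb k [set y | B (row_cons (x, y))]).
Proof.
move=> mB.
have := measurable_fun_xsection (leb k) (measurable_row_slice mB).
apply: eq_measurable_fun => x _ /=; congr (leb k _).
by apply/seteqP; split => y /=; rewrite /xsection /= inE.
Qed.

Lemma measurable_leb_slice2 k (B : set 'rV[R]_k.+1) : measurable B ->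
  measurable_fun setT (fun y => mu [set x | B (row_cons (x, y))]).
Proof.
move=> mB.
have := measurable_fun_ysection mu (measurable_row_slice mB).
apply: eq_measurable_fun => y _ /=; congr (lebesgue_measure _).
by apply/seteqP; split => x /=; rewrite /ysection /= inE.
Qed.

Lemma measurable_affine k l (A : 'M[R]_(k, l)) (b : 'rV[R]_l) :
  measurable_fun setT (fun x : 'rV[R]_k => x *m A + b).
Proof.
apply: measurable_fun_rowP => i.
under eq_fun do rewrite !mxE.
apply: measurable_funD => //; apply: measurable_sum => j.
by apply: measurable_funM => //; exact: measurable_coord.
Qed.

Lemma measurable_affine_preimage k l (A : 'M[R]_(k, l)) (b : 'rV[R]_l) B :
  measurable B -> measurable [set x : 'rV[R]_k | B (x *m A + b)].
Proof.
by move=> mB; rewrite -[X in measurable X]setTI; exact: measurable_affine.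
Qed.

End leb_linear.

Section leb_linear2.
Context {R : realType}.
Notation mu := (@lebesgue_measure R).

Lemma row_consE k (x : R) (y : 'rV[R]_k) : row_cons (x, y) = row_mx x%:M y.
Proof. by []. Qed.

Lemma row_cons0 k (x : R) (y : 'rV[R]_k) : row_cons (x, y) ord0 ord0 = x.
Proof. exact: (congr1 fst (row_consK (x, y))). Qed.

Lemma row_consS k (x : R) (y : 'rV[R]_k) i :
  row_cons (x, y) ord0 (lift ord0 i) = y ord0 i.
Proof.
have /rowP/(_ i) := congr1 snd (row_consK (x, y)).
by rewrite mxE.
Qed.

Lemma row_consD k (x x' : R) (y y' : 'rV[R]_k) :
  row_cons (x, y) + row_cons (x', y') = row_cons (x + x', y + y').
Proof.
by have := @add_row_mx R 1 1 k x%:M y x'%:M y'; rewrite -raddfD.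
Qed.

Lemma row_cons_eta k (x : 'rV[R]_k.+1) : exists a y, x = row_cons (a, y).
Proof.
exists (x ord0 ord0), (@rsubmx _ 1 1 k x); rewrite row_consE.
rewrite -[LHS](@hsubmxK _ 1 1 k x); apply: (congr2 (@row_mx R 1 1 k)) => //.
apply/rowP => i; rewrite !mxE !ord1 eqxx mulr1n; congr (x _ _).
exact/val_inj.
Qed.

Lemma leb_translate k (b : 'rV[R]_k) (B : set 'rV[R]_k) : measurable B ->
  leb k [set x | B (x + b)] = leb k B.
Proof.
elim: k b B => [|k IH] b B mB.
  congr (leb 0 _); apply/seteqP; split => x /=;
    by rewrite [x + b](thinmx0 (x + b)) (thinmx0 x).
have [b0 [b1 bE]] := row_cons_eta b.
have mBt c : measurable [set x | B (x + c)].
  have := measurable_affine_preimage (1%:M) c mB; congr measurable.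
  by apply/seteqP; split => x /=; rewrite mulmx1.
rewrite leb_slice1//.
transitivity (leb k.+1 [set x | B (x + row_cons (b0, 0))]).
  rewrite leb_slice1//; apply: eq_integral => x _.
  have mB1 : measurable [set y | B (row_cons (x + b0, y))].
    exact: measurable_row_slice1.
  transitivity (leb k [set y | B (row_cons (x + b0, y))]).
    rewrite -(IH b1 _ mB1); congr (leb k _).
    by apply/seteqP; split => y /=; rewrite bE row_consD.
  congr (leb k _).
  by apply/seteqP; split => y /=; rewrite row_consD addr0.
rewrite !leb_slice2//; apply: eq_integral => y _.
have mB2 : measurable [set x | B (row_cons (x, y))].
  exact: measurable_row_slice2.
rewrite -[RHS](lebesgue_affine b0 (oner_neq0 R) mB2) normr1 mul1e.
congr (lebesgue_measure _).
by apply/seteqP; split => x /=; rewrite row_consD addr0 mul1r.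
Qed.

(** The change of variables formula for one matrix, as a predicate that passes from two factors to
    their product. *)
Definition lin_ok k (A : 'M[R]_k) := forall B, measurable B ->
  (`|\det A|%:E * leb k [set x | B (x *m A)%R] = leb k B)%E.

Lemma measurable_linear_preimage k l (A : 'M[R]_(k, l)) B :
  measurable B -> measurable [set x : 'rV[R]_k | B (x *m A)].
Proof.
move=> /(measurable_affine_preimage A 0); congr measurable.
by apply/seteqP; split => x /=; rewrite addr0.
Qed.

Lemma lin_okM k (A A' : 'M[R]_k) : lin_ok A -> lin_ok A' -> lin_ok (A *m A').
Proof.
move=> hA hA' B mB; rewrite det_mulmx normrM EFinM [X in (X * _)%E = _]muleC -muleA.
rewrite -(hA' B mB) -[in RHS](hA [set x | B (x *m A')]); last first.
  exact: measurable_linear_preimage.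
congr (_ * (_ * leb k _))%E.
by apply/seteqP; split => x /=; rewrite mulmxA.
Qed.

Lemma mx0E k l (i : 'I_k) (j : 'I_l) : (0 : 'M[R]_(k, l)) i j = 0.
Proof. by rewrite mxE. Qed.

Lemma row_cons_block k (x : R) (y : 'rV[R]_k) (a : 'M[R]_1) b c D :
  row_cons (x, y) *m (block_mx a b c D : 'M[R]_(1 + k)) =
  row_cons (x * a ord0 ord0 + (y *m c) ord0 ord0, x *: b + y *m D).
Proof.
rewrite !row_consE /=.
have -> := @mul_row_block R 1 1 k 1 k x%:M y a b c D.
apply: (congr2 (@row_mx R 1 1 k)); last by rewrite mul_scalar_mx.
apply/rowP => i; rewrite !ord1 !mxE big_ord1 !mxE eqxx mulr1n; congr (_ + _).
Qed.

Lemma lin_ok_shear1 k (b : 'rV[R]_k) : lin_ok (block_mx 1%:M b 0 1%:M : 'M[R]_(1 + k)).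
Proof.
move=> B mB; rewrite det_ublock !det1 mul1r normr1 mul1e.
have mB' := measurable_linear_preimage (block_mx 1%:M b 0 1%:M : 'M[R]_(1 + k)) mB.
rewrite !leb_slice1//; apply: eq_integral => x _.
rewrite -[RHS](@leb_translate k (x *: b)); last exact: measurable_row_slice1.
congr (leb k _); apply/seteqP; split => y /=;
 by rewrite row_cons_block [_%:M _ _]mxE mulr1 mulmx0 mx0E addr0 mulmx1 addrC.
Qed.

Lemma lin_ok_shear2 k (c : 'cV[R]_k) : lin_ok (block_mx 1%:M 0 c 1%:M : 'M[R]_(1 + k)).
Proof.
move=> B mB; rewrite det_lblock !det1 mul1r normr1 mul1e.
have mB' := measurable_linear_preimage (block_mx 1%:M 0 c 1%:M : 'M[R]_(1 + k)) mB.
rewrite !leb_slice2//; apply: eq_integral => y _.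
rewrite -[RHS](@lebesgue_affine _ 1 ((y *m c) ord0 ord0)) ?oner_eq0//; last first.
  exact: measurable_row_slice2.
rewrite normr1 mul1e; congr (lebesgue_measure _); apply/seteqP; split => x /=;
 by rewrite row_cons_block [_%:M _ _]mxE mulr1 mul1r scaler0 mulmx1 add0r.
Qed.

Lemma lin_ok_diag k (a : 'M[R]_1) (D : 'M[R]_k) : a ord0 ord0 != 0 -> lin_ok D ->
  lin_ok (block_mx a 0 0 D : 'M[R]_(1 + k)).
Proof.
move=> a0 hD B mB; rewrite det_ublock det_mx11 normrM EFinM.
have mB' := measurable_linear_preimage (block_mx a 0 0 D : 'M[R]_(1 + k)) mB.
set B1 := [set x | B (x *m (block_mx 1%:M 0 0 D : 'M[R]_(1 + k)))].
have mB1 : measurable B1.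
  exact: (measurable_linear_preimage (block_mx 1%:M 0 0 D : 'M[R]_(1 + k)) mB).
transitivity (`|\det D|%:E * leb k.+1 B1)%E.
  rewrite [X in (X * _)%E = _]muleC -muleA; congr (_ * _)%E.
  rewrite !leb_slice2//.
  rewrite -ge0_integralZl//; first last.
  - exact: measurable_leb_slice2.
  apply: eq_integral => y _.
  rewrite -[RHS](@lebesgue_affine _ (a ord0 ord0) 0) //; last exact: measurable_row_slice2.
  congr (_ * lebesgue_measure _)%E; apply/seteqP; split => x; rewrite /B1 /= !row_cons_block;
   by rewrite [_%:M _ _]mxE mulr1 !mulmx0 !scaler0 !add0r mx0E !addr0 mulrC.
rewrite !leb_slice1//.
rewrite -ge0_integralZl//; first last.
- exact: measurable_leb_slice1.
apply: eq_integral => x _; rewrite -[RHS]hD; last exact: measurable_row_slice1.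
congr (_ * leb k _)%E; apply/seteqP; split => y; rewrite /B1 /= !row_cons_block;
 by rewrite [_%:M _ _]mxE mulr1 mulmx0 scaler0 add0r mx0E addr0.
Qed.

(** Induction by block elimination: with a nonzero pivot the matrix is a lower shear times a block
    diagonal matrix times an upper shear. Shears translate slices, hence preserve the measure, and
    the induction hypothesis applies to the Schur complement [D]. *)
Lemma unitmx_lin_ok k (A : 'M[R]_k) : A \in unitmx -> lin_ok A.
Proof.
elim: k A => [|k IH] A uA.
  move=> B mB; rewrite det_mx00 normr1 mul1e; congr (leb 0 _).
  by apply/seteqP; split => x /=; rewrite (thinmx0 (x *m A)) (thinmx0 x).
have key (A' : 'M[R]_(1 + k)) : A' \in unitmx -> A' ord0 ord0 != 0 -> lin_ok A'.
  move=> {A uA} uA a0; set a := A' ord0 ord0 in a0.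
  pose b := ursubmx A'; pose c := dlsubmx A'.
  pose D := drsubmx A' - a^-1 *: (c *m b).
  have aE : ulsubmx A' = a%:M.
    by apply/matrixP => i j; rewrite !mxE !ord1 /= mulr1n; congr (A' _ _); apply/val_inj.
  have AE : A' = (block_mx 1%:M 0 (a^-1 *: c) 1%:M : 'M[R]_(1 + k)) *m
       ((block_mx a%:M 0 0 D : 'M[R]_(1 + k)) *m (block_mx 1%:M (a^-1 *: b) 0 1%:M : 'M[R]_(1 + k))).
    rewrite !mulmx_block !mulmx0 !mul0mx !mul1mx !mulmx1 !addr0 !add0r.
    rewrite mul_scalar_mx scalerA mulfV// scale1r -scalemxAl mul_mx_scalar scalerA mulVf// scale1r.
    by rewrite -scalemxAl /D addrC subrK -{1}(submxK A') aE.
  rewrite AE; apply: lin_okM; first exact: lin_ok_shear2.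
  apply: lin_okM; last exact: lin_ok_shear1.
  apply: lin_ok_diag; first by rewrite mxE eqxx.
  apply: IH.
  move: uA; rewrite AE !unitmx_mul => /andP[_ /andP[+ _]].
  by rewrite !unitmxE det_ublock unitrM => /andP[].
pose A' : 'M[R]_(1 + k) := A; rewrite -[A]/A' in uA *; clearbody A'.
have [a0|] := eqVneq (A' ord0 ord0) 0; last exact: key.
pose c := dlsubmx A'.
have aE : ulsubmx A' = 0.
  by apply/matrixP => i j; rewrite !mxE !ord1 -[RHS]a0; congr (A' _ _); apply/val_inj.
have c0 : c != 0.
  apply/eqP => c0; move: uA; rewrite unitmxE (_ : \det A' = 0) ?unitr0//.
  by rewrite -(submxK A') -/c c0 aE det_ublock det_mx11 mxE mul0r.
(* Adding c^T times the lower rows turns the vanishing pivot into the squared norm of c. *)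
pose U : 'M[R]_(1 + k) := block_mx 1%:M c^T 0 1%:M.
have -> : A' = (block_mx 1%:M (- c^T) 0 1%:M : 'M[R]_(1 + k)) *m (U *m A').
  rewrite mulmxA mulmx_block !mulmx0 !mul0mx !mul1mx !mulmx1 !addr0 !add0r subrr.
  by rewrite -scalar_mx_block mul1mx.
apply: lin_okM; first exact: lin_ok_shear1.
apply: key.
  by rewrite unitmx_mul uA unitmxE det_ublock !det1 mul1r unitr1.
have [i ci] : exists i, c i ord0 != 0.
  by apply/cV0Pn.
rewrite -(submxK A') /U mulmx_block !mul1mx -/c aE add0r.
have -> : (ord0 : 'I_(1 + k)) = lshift k ord0 by apply/val_inj.
rewrite block_mxEul mxE gt_eqF// (bigD1 i)//= ltr_pwDl//.
  by rewrite mxE -expr2 exprn_even_gt0.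
by apply: sumr_ge0 => l _; rewrite mxE -expr2 sqr_ge0.
Qed.

Lemma leb_affine k (A : 'M[R]_k) (b : 'rV[R]_k) B : A \in unitmx -> measurable B ->
  (`|\det A|%:E * leb k [set x | B (x *m A + b)%R] = leb k B)%E.
Proof.
move=> uA mB.
have mBt : measurable [set x | B (x + b)].
  have := measurable_affine_preimage (1%:M) b mB; congr measurable.
  by apply/seteqP; split => x /=; rewrite mulmx1.
by rewrite -[RHS](leb_translate b mB) -(unitmx_lin_ok uA mBt).
Qed.

(** Induction on the dimension: if the first entry of [w] vanishes, every slice is a hyperplane one
    dimension lower; otherwise every line in the first direction meets the set in one point. *)
Lemma leb_hyperplane k (w : 'rV[R]_k) c : w != 0 ->
  leb k [set x | dot x w = c] = 0%E.
Proof.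
have mD j (v : 'rV[R]_j) : measurable_fun setT (fun x : 'rV[R]_j => dot x v).
  apply: measurable_sum => i; apply: measurable_funM => //; exact: measurable_coord.
have mH j (v : 'rV[R]_j) e : measurable [set x | dot x v = e].
  by rewrite -[X in measurable X]setTI; apply: (mD j v _ [set e]).
elim: k w c => [w c|k IH w c w0]; first by rewrite thinmx0 eqxx.
have [a [v wE]] := row_cons_eta w.
have dotE x y : dot (row_cons (x, y)) w = x * a + dot y v.
  rewrite wE /dot big_ord_recl !row_cons0; congr (_ + _).
  by apply: eq_bigr => i _; rewrite !row_consS.
have [a0|a0] := eqVneq a 0.
  have v0 : v != 0.
    by apply: contraNneq w0 => v0; rewrite wE a0 v0 row_consE raddf0 row_mx0.
  rewrite leb_slice1//; apply: integral0_eq => x _ /=.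
  rewrite -[RHS](IH v c v0); congr (leb k _).
  by apply/seteqP; split => y /=; rewrite dotE a0 mulr0 add0r.
rewrite leb_slice2//; apply: integral0_eq => y _ /=.
rewrite -[RHS](lebesgue_measure_set1 ((c - dot y v) / a)); congr (lebesgue_measure _).
apply/seteqP; split => x /=; rewrite dotE.
  by move=> <-; rewrite addrK mulfK.
by move=> ->; rewrite divfK// subrK.
Qed.
End leb_linear2.

(** * Integrals and null sets, without measurability of the integrands *)

Section null_integral.
Context {d} {T : measurableType d} {R : realType} (mu : {measure set T -> \bar R}).
Import HBNNSimple.

(** Neither function need be measurable, so the integral is handled as a supremum over simple
    functions: one below [f], cut off on [N], lies below [g] and has the same integral. This is for
    the divergence of a piecewise field, whose values on the skeleton of the mesh are arbitrary. *)
Lemma ge0_integral_null_sub (N : set T) (f g : T -> \bar R) :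
  measurable N -> mu N = 0%E -> (forall x, 0 <= f x)%E -> (forall x, 0 <= g x)%E ->
  (forall x, ~ N x -> f x = g x) -> (\int[mu]_x f x <= \int[mu]_x g x)%E.
Proof.
move=> mN N0 f0 g0 fg; rewrite !ge0_integralTE//.
apply: ge_ereal_sup => _ [h /= hf <-].
apply: le_ereal_sup_tmp.
have mNC : measurable (~` N) by exact: measurableC.
exists (sintegral mu (proj_nnsfun h mNC)).
  exists (proj_nnsfun h mNC) => // x /=; rewrite mindicE.
  case: (boolP (x \in ~` N)) => xN; last by rewrite mulr0.
  by rewrite mulr1 -fg//; move: xN; rewrite inE.
rewrite -!integralT_nnsfun.
rewrite (@ae_eq_integral _ _ _ mu setT (fun x => (h x)%:E) (fun x => (proj_nnsfun h mNC x)%:E))//.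
- exact/measurable_EFinP.
- exact/measurable_EFinP.
- exists N; split => // x /= hx; apply: contrapT => xN; apply: hx => _.
  by rewrite mindicE mem_set// mulr1.
Qed.

Lemma integral_null (N : set T) (f g : T -> \bar R) :
  measurable N -> mu N = 0%E ->
  (forall x, ~ N x -> f x = g x) -> (\int[mu]_x f x = \int[mu]_x g x)%E.
Proof.
move=> mN N0 fg; rewrite integralE [RHS]integralE.
by congr (_ - _)%E; apply/eqP; rewrite eq_le; apply/andP; split;
  apply: (ge0_integral_null_sub mN N0) => // x xN; rewrite ?funeposE ?funenegE fg.
Qed.

End null_integral.

(** * Affine change of variables in integrals *)

Section int_affine.
Context {R : realType}.
Variables (k : nat) (A : 'M[R]_k) (b : 'rV[R]_k).
Hypothesis uA : A \in unitmx.

Let phi (x : 'rV[R]_k) := x *m A + b.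
Let mphi : measurable_fun setT phi.
Proof. exact: measurable_affine. Qed.

Lemma ge0_int_affine (f : 'rV[R]_k -> \bar R) : measurable_fun setT f ->
  (forall x, 0 <= f x)%E ->
  (`|\det A|%:E * \int[leb k]_x f (x *m A + b)%R = \int[leb k]_x f x)%E.
Proof.
move=> mf f0.
pose push : {measure set 'rV[R]_k -> \bar R} :=
  measure_function_pushforward__canonical__measure_function_Measure (leb k) mphi.
pose m : {measure set 'rV[R]_k -> \bar R} := mscale (NngNum (normr_ge0 (\det A))) push.
transitivity (\int[m]_x f x)%E.
  rewrite /m ge0_integral_mscale//; congr (_ * _)%E.
  by rewrite /push /= ge0_integral_pushforward.
apply: eq_measure_integral => B mB _; rewrite /m /push /= /mscale /=.
exact: leb_affine.
Qed.

Lemma integrable_affine (f : 'rV[R]_k -> \bar R) :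
  (leb k).-integrable setT f -> (leb k).-integrable setT (f \o phi).
Proof.
move=> /integrableP[mf fi]; apply/integrableP; split.
  exact: measurableT_comp.
have detA : 0 < `|\det A| by rewrite normr_gt0 -unitfE -unitmxE.
have mfa : measurable_fun setT (abse \o f) by exact: measurableT_comp.
have := ge0_int_affine mfa (fun x => abse_ge0 (f x)) => /= e.
rewrite -e in fi; rewrite ltNge leye_eq; apply/negP => /eqP h.
by move: fi; rewrite /phi h mulry gtr0_sg// mul1e ltxx.
Qed.

Lemma int_affine (f : 'rV[R]_k -> \bar R) : (leb k).-integrable setT f ->
  (`|\det A|%:E * \int[leb k]_x f (x *m A + b)%R = \int[leb k]_x f x)%E.
Proof.
move=> fi; have /integrableP[mf _] := fi.
have fii := integrable_affine fi.
rewrite integralE [RHS]integralE muleBr//; last first.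
  apply: fin_num_adde_defl; rewrite fin_numN.
  by have := integrable_neg_fin_num measurableT fii.
have mp : measurable_fun setT f^\+%E by exact: measurable_funepos.
have mn : measurable_fun setT f^\-%E by exact: measurable_funeneg.
rewrite -(ge0_int_affine mp (funepos_ge0 f)) -(ge0_int_affine mn (funeneg_ge0 f)).
congr (_ * _ - _ * _)%E; apply: eq_integral => x _.
  by rewrite !funeposE.
by rewrite !funenegE.
Qed.
End int_affine.

(** * Fubini along lines, and Borel sets of row vectors *)

Section fubini_row.
Context {R : realType}.
Notation mu := (@lebesgue_measure R).

(** The line variable is integrated first, so that the inner integral can be computed by the
    fundamental theorem of calculus. *)
Lemma int_row_cons k (f : 'rV[R]_k.+1 -> \bar R) :
  (leb k.+1).-integrable setT f ->
  measurable_fun setT (fun y => \int[mu]_r f (row_cons (r, y)))%E /\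
  (\int[leb k.+1]_x f x = \int[leb k]_y \int[mu]_r f (row_cons (r, y)))%E.
Proof.
move=> fi; have mf : measurable_fun setT f by case/integrableP : fi.
have ii : (mu \x leb k)%E.-integrable setT (f \o @row_cons R k).
  have /integrableP[_ fi'] := fi.
  apply/integrableP; split.
    by apply: measurableT_comp => //; exact: measurable_row_cons.
  move: fi'; rewrite [X in (X < _)%E -> _](_ : _ = \int[pushforward (mu \x leb k) (@row_cons R k)]_x `|f x|)%E //.
  rewrite ge0_integral_pushforward//.
  - exact: measurable_row_cons.
  - exact: measurableT_comp.
split.
  exact: (measurable_fubini_G ii).
rewrite (integral21_prod_meas1 ii).
rewrite [LHS](_ : _ = \int[pushforward (mu \x leb k) (@row_cons R k)]_x f x)%E //.
rewrite integral_pushforward//.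
exact: measurable_row_cons.
Qed.

(** The sigma-algebra on rows is generated by the coordinates; an open set is the union of the
    countably many rational boxes that it contains. *)
Lemma open_measurable_row k (U : set 'rV[R]_k) : open U -> measurable U.
Proof.
move=> oU.
pose box (c : 'rV[rat]_k * nat) : set 'rV[R]_k :=
  \bigcap_(i in [set: 'I_k]) [set x | `|x ord0 i - ratr (c.1 ord0 i)| < c.2.+1%:R^-1].
have mbox c : measurable (box c).
  apply: fin_bigcap_measurable => // i _.
  have := @measurable_coord R k i measurableT
    `]ratr (c.1 ord0 i) - c.2.+1%:R^-1, ratr (c.1 ord0 i) + c.2.+1%:R^-1[%classic (measurable_itv _).
  rewrite setTI; congr measurable; apply/seteqP; split => x /=;
    by rewrite in_itv /= ltr_distl.
pose F m : set 'rV[R]_k := if unpickle m is Some c then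
  (if `[< box c `<=` U >] then box c else set0) else set0.
have -> : U = \bigcup_m F m.
  apply/seteqP; split => [x Ux|x [m _]]; last first.
    by rewrite /F; case: unpickle => // c; case: asboolP => // cU /cU.
  have [e e0 eU] : exists2 e : R, 0 < e & ball x e `<=` U.
    by have /nbhs_ballP[e /= e0 eU] := open_nbhs_nbhs (conj oU Ux); exists e.
  (* Two points of a box differ in each coordinate by at most twice the half-width [m.+1%:R^-1], so
     a box around [x] stays in the ball. *)
  have [m me] : exists m, 2 * m.+1%:R^-1 < e.
    have := near_infty_natSinv_lt (PosNum (divr_gt0 e0 (ltr0n R 2))).
    move=> [m _ /(_ m (leqnn m))] /= h; exists m.
    by rewrite mulrC -ltr_pdivlMr.
  have /choice[q qx] i : exists q : rat, `|x ord0 i - ratr q| < m.+1%:R^-1.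
    have [q] : exists q, ratr q \in `]x ord0 i - m.+1%:R^-1, x ord0 i + m.+1%:R^-1[.
      by apply: rat_in_itvoo; rewrite ltrD2l gt0_cp// invr_gt0.
    by rewrite in_itv /= => h; exists q; rewrite distrC ltr_distl.
  exists (pickle (\row_i q i, m)) => //; rewrite /F pickleK.
  have xb : box (\row_i q i, m) x by move=> i _ /=; rewrite mxE.
  rewrite asboolT// => y yb; apply: eU; split => // i j; rewrite ord1 /ball /=.
  have := yb j I; have := xb j I; rewrite /= => h1 h2.
  apply: le_lt_trans me; rewrite (le_trans (ler_distD (ratr ((\row_i0 q i0) ord0 j)) _ _))//.
  rewrite mulr_natl mulr2n; apply: lerD; first exact: ltW.
  by rewrite distrC; exact: ltW.
apply: bigcupT_measurable => m; rewrite /F; case: unpickle => // c.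
by case: asboolP.
Qed.

Lemma open_measurable_subspace_row k (D : set 'rV[R]_k) (U : set (subspace D)) :
  measurable D -> open U -> measurable (D `&` U).
Proof.
move=> mD /open_subspaceP [V oV VD]; rewrite setIC -VD.
by apply: measurableI => //; exact: open_measurable_row.
Qed.

Lemma continuous_measurable_row k (D : set 'rV[R]_k) (f : 'rV[R]_k -> R) :
  measurable D -> {within D, continuous f} -> measurable_fun D f.
Proof.
move=> mD /continuousP cf; apply: (measurability _ (RGenOpens.measurableE R)).
move=> _ [_ [a [b ->] <-]].
by apply: open_measurable_subspace_row => //; exact/cf/interval_open.
Qed.
End fubini_row.

(** * Simplices and conforming meshes *)

Section bary.
Context {R : realType}.

(** Barycentric coordinates of [p ord0 + c *m edges p]: the entries of [c] belong to the vertices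
    other than [ord0], which takes the remainder. *)
Definition bary k (c : 'rV[R]_k) (i : 'I_k.+1) : R :=
  if unlift ord0 i is Some j then c ord0 j else 1 - \sum_j c ord0 j.

Lemma bary0 k (c : 'rV[R]_k) : bary c ord0 = 1 - \sum_j c ord0 j.
Proof. by rewrite /bary unlift_none. Qed.

Lemma baryS k (c : 'rV[R]_k) j : bary c (lift ord0 j) = c ord0 j.
Proof. by rewrite /bary liftK. Qed.

Lemma sum_bary k (c : 'rV[R]_k) : \sum_i bary c i = 1.
Proof.
by rewrite big_ord_recl bary0; under [X in _ + X]eq_bigr do rewrite baryS; rewrite subrK.
Qed.

Lemma bary_surj k (a : 'I_k.+1 -> R) : \sum_i a i = 1 ->
  exists c : 'rV[R]_k, bary c = a.
Proof.
move=> a1; exists (\row_j a (lift ord0 j)); apply/funext => i.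
case: (unliftP ord0 i) => [j|] ->; first by rewrite baryS mxE.
rewrite bary0 -a1 big_ord_recl; under [X in _ - X]eq_bigr do rewrite mxE.
by rewrite addrK.
Qed.

Lemma mulmx_edges d k (p : 'I_k.+1 -> 'rV[R]_d) (c : 'rV[R]_k) :
  c *m edges p = \sum_j c ord0 j *: (p (lift ord0 j) - p ord0).
Proof. by rewrite mulmx_sum_row; apply: eq_bigr => j _; rewrite rowK. Qed.

Lemma bary_comb d k (p : 'I_k.+1 -> 'rV[R]_d) (c : 'rV[R]_k) :
  p ord0 + c *m edges p = \sum_i bary c i *: p i.
Proof.
rewrite big_ord_recl bary0 mulmx_edges.
under [X in _ = _ + X]eq_bigr do rewrite baryS.
under [X in _ + X = _]eq_bigr do rewrite scalerBr.
by rewrite sumrB -scaler_suml scalerBl scale1r addrAC addrA.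
Qed.

Lemma osimplexP d k (p : 'I_k.+1 -> 'rV[R]_d) x :
  osimplex p x <-> exists2 c : 'rV[R]_k, forall i, 0 < bary c i & x = p ord0 + c *m edges p.
Proof.
split => [[a [a0 a1 ->]]|[c c0 ->]].
  have [c ca] := bary_surj a1; exists c; first by rewrite ca.
  by rewrite bary_comb ca.
by exists (bary c); split => //; [exact: sum_bary|rewrite bary_comb].
Qed.

Lemma refsimplexE k (c : 'rV[R]_k) : refsimplex c <-> forall i, 0 < bary c i.
Proof.
split => [[c0 c1] i|c0].
  case: (unliftP ord0 i) => [j|] ->; first by rewrite baryS.
  by rewrite bary0 subr_gt0.
split => [i|]; first by rewrite -baryS.
by have := c0 ord0; rewrite bary0 subr_gt0.
Qed.

Lemma affine_free d k (p : 'I_k.+1 -> 'rV[R]_d) (a : 'I_k.+1 -> R) :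
  row_free (edges p) -> \sum_i a i = 0 -> \sum_i a i *: p i = 0 -> forall i, a i = 0.
Proof.
move=> fp a0 ap0.
pose c : 'rV[R]_k := \row_j a (lift ord0 j).
have aS : a ord0 = - \sum_j a (lift ord0 j).
  by move: a0; rewrite big_ord_recl => /eqP; rewrite addr_eq0 => /eqP.
have c0 : c = 0.
  apply/(row_free_inj fp); rewrite mul0mx -ap0 mulmx_edges big_ord_recl aS.
  under eq_bigr do rewrite mxE scalerBr.
  by rewrite sumrB -scaler_suml scaleNr addrC.
have cE j : a (lift ord0 j) = 0 by have /rowP/(_ j) := c0; rewrite !mxE.
move=> i; case: (unliftP ord0 i) => [j|] ->; first exact: cE.
by rewrite aS big1 ?oppr0// => j _; exact: cE.
Qed.

Lemma affine_inj d k (p : 'I_k.+1 -> 'rV[R]_d) (a b : 'I_k.+1 -> R) :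
  row_free (edges p) -> \sum_i a i = \sum_i b i ->
  \sum_i a i *: p i = \sum_i b i *: p i -> a = b.
Proof.
move=> fp ab pab; apply/funext => i; apply/eqP; rewrite -subr_eq0; apply/eqP.
apply: (affine_free (a := fun i => a i - b i) fp).
  by rewrite sumrB ab subrr.
under eq_bigr do rewrite scalerBl.
by rewrite sumrB pab subrr.
Qed.

End bary.

Section cells.
Context {R : realType} {d k : nat} {M : mesh k} (q : node M -> 'rV[R]_d).

Lemma vert_inj (s : cell M) : row_free (edges (cpos q s)) -> injective (vert s).
Proof.
move=> fp i j ij; apply/eqP; apply: contrapT => /negP nij.
have sE l : \sum_(m < k.+1) (m == l)%:R = 1 :> R.
  by rewrite (bigD1 l)//= eqxx big1 ?addr0// => m /negbTE ->.
have pE l : \sum_(m < k.+1) (m == l)%:R *: cpos q s m = cpos q s l.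
  rewrite (bigD1 l)//= eqxx scale1r big1 ?addr0// => m /negbTE ->.
  by rewrite scale0r.
have : (i == i)%:R - (i == j)%:R = 0 :> R.
  apply: (affine_free (a := fun l => (l == i)%:R - (l == j)%:R) fp).
    by rewrite sumrB !sE subrr.
  under eq_bigr do rewrite scalerBl.
  by rewrite sumrB !pE /cpos ij subrr.
by rewrite eqxx (negbTE nij) subr0 => /eqP; rewrite oner_eq0.
Qed.

Lemma mem_verts (s : cell M) i : vert s i \in verts s.
Proof. exact: imset_f. Qed.

(** [hull] puts weights on all nodes of the mesh; here they become weights on the vertices of one
    cell, to which affine independence applies. *)
Lemma hullP (s : cell M) (W : {set node M}) x : injective (vert s) -> W \subset verts s ->
  hull q W x <-> exists a : 'I_k.+1 -> R,
    [/\ forall i, 0 <= a i, forall i, vert s i \notin W -> a i = 0, \sum_i a i = 1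
     & x = \sum_i a i *: cpos q s i].
Proof.
move=> vi Ws.
have reindex (E : lmodType R) (f : node M -> E) : (forall v, v \notin W -> f v = 0) ->
    \sum_v f v = \sum_i f (vert s i).
  move=> f0; rewrite (bigID (fun v => v \in verts s))/= [X in _ + X]big1 ?addr0.
    by rewrite big_imset//= => i j _ _; exact: vi.
  by move=> v vs; apply: f0; apply: contra vs; exact: (fintype.subsetP Ws).
split => [[c [c0 cW c1 ->]]|[a [a0 aW a1 ->]]].
  exists (fun i => c (vert s i)); split => //.
  - by move=> i; exact: cW.
  - by rewrite -(reindex R^o c).
  - by rewrite (reindex _ (fun v => c v *: q v))// => v vW; rewrite cW// scale0r.
pose c v := \sum_(i | vert s i == v) a i.
have cE i : c (vert s i) = a i.
  by rewrite /c (big_pred1 i)// => j; rewrite /= (inj_eq vi).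
have cW v : v \notin W -> c v = 0.
  by move=> vW; rewrite /c big1// => i /eqP iv; apply: aW; rewrite iv.
exists c; split => //.
- by move=> v; apply: sumr_ge0 => i _.
- by rewrite (reindex R^o c)//; under eq_bigr do rewrite cE.
- rewrite (reindex _ (fun v => c v *: q v)).
    by apply: eq_bigr => i _; rewrite cE.
  by move=> v vW; rewrite cW// scale0r.
Qed.

End cells.

Lemma cvg_sumr (R : realType) (V : normedModType R) (T : Type) (F : set_system T)
    {FF : Filter F} (I : Type) (r : seq I) (P : pred I) (f : I -> T -> V) (l : I -> V) :
  (forall i, P i -> f i x @[x --> F] --> l i) ->
  (\sum_(i <- r | P i) f i x) @[x --> F] --> \sum_(i <- r | P i) l i.
Proof.
move=> fl; elim: r => [|i r IH].
  by rewrite big_nil; under eq_fun do rewrite big_nil; exact: cvg_cst.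
rewrite big_cons; under eq_fun do rewrite big_cons.
by case: ifPn => // Pi; apply: cvgD => //; exact: fl.
Qed.

Lemma cvg_prodr (R : realType) (T : Type) (F : set_system T)
    {FF : Filter F} (I : Type) (r : seq I) (P : pred I) (f : I -> T -> R) (l : I -> R) :
  (forall i, P i -> f i x @[x --> F] --> l i) ->
  (\prod_(i <- r | P i) f i x) @[x --> F] --> \prod_(i <- r | P i) l i.
Proof.
move=> fl; elim: r => [|i r IH].
  by rewrite big_nil; under eq_fun do rewrite big_nil; exact: cvg_cst.
rewrite big_cons; under eq_fun do rewrite big_cons.
by case: ifPn => // Pi; apply: cvgM => //; exact: fl.
Qed.

Section dot.
Context {R : realType} {k : nat}.
Implicit Types x y z : 'rV[R]_k.

Lemma dotE x y : dot x y = (x *m y^T) ord0 ord0.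
Proof. by rewrite mxE; apply: eq_bigr => i _; rewrite mxE. Qed.

Lemma dotC x y : dot x y = dot y x.
Proof. by apply: eq_bigr => i _; rewrite mulrC. Qed.

Lemma dotDl x y z : dot (x + y) z = dot x z + dot y z.
Proof. by rewrite !dotE mulmxDl mxE. Qed.

Lemma dotBl x y z : dot (x - y) z = dot x z - dot y z.
Proof. by rewrite !dotE mulmxBl !mxE. Qed.

Lemma dotZl (a : R) x z : dot (a *: x) z = a * dot x z.
Proof. by rewrite !dotE -scalemxAl mxE. Qed.

Lemma dot0l z : dot 0 z = 0.
Proof. by rewrite dotE mul0mx mxE. Qed.

Lemma dotNl x z : dot (- x) z = - dot x z.
Proof. by rewrite -scaleN1r dotZl mulN1r. Qed.

Lemma dot_suml (I : Type) (r : seq I) (P : pred I) (F : I -> 'rV[R]_k) z :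
  dot (\sum_(i <- r | P i) F i) z = \sum_(i <- r | P i) dot (F i) z.
Proof.
by rewrite dotE mulmx_suml summxE; apply: eq_bigr => i _; rewrite dotE.
Qed.

Lemma continuous_dot z : continuous (fun x => dot x z).
Proof.
move=> x; rewrite /dot.
apply: (@cvg_sumr R R^o _ _ (nbhs_filter x)) => i _.
by apply: cvgM; [exact: coord_continuous|exact: cvg_cst].
Qed.

End dot.

Lemma continuous_mulmx (R : realType) k l (A : 'M[R]_(k, l)) :
  continuous (fun x : 'rV[R]_k => x *m A).
Proof.
rewrite (_ : (fun x => _) = fun x : 'rV[R]_k => \sum_i x ord0 i *: row i A); last first.
  by apply/funext => x; rewrite mulmx_sum_row.
move=> x; apply: (@cvg_sumr R 'rV[R]_l _ _ (nbhs_filter x)) => i _.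
by apply: cvgZ; [exact: coord_continuous|exact: cvg_cst].
Qed.

Section connected_inner.
Context {R : realType} {k : nat}.
Notation pt := 'rV[R]_k.
Variables (inner Ga : set pt).
Hypotheses (oi : open inner) (bi : closure inner `\` interior inner = Ga).

(** Within [C] the phase is open, and also closed because [C] misses its boundary [Ga]. *)
Lemma inner_connected (C : set pt) x y : connected C -> C `&` Ga = set0 ->
  C x -> C y -> inner x -> inner y.
Proof.
move=> cC CG Cx Cy ix.
suff e : C `&` inner = C by move: Cy; rewrite -e => -[].
apply: cC.
- by exists x.
- by exists inner.
- exists (closure inner); first exact: closed_closure.
  apply/seteqP; split => z [Cz iz]; split => //; first exact: subset_closure.
  apply: contrapT => niz.
  have : (C `&` Ga) z.
    by split => //; rewrite -bi; split => //; move: oi => /interior_id ->.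
  by rewrite CG.
Qed.

Lemma inner_segment (a b : pt) :
  (forall s, 0 <= s <= 1 -> ~ Ga (a + s *: (b - a))) -> inner a <-> inner b.
Proof.
move=> ab.
pose f (s : R) := a + s *: (b - a).
have cf : continuous f.
  move=> s; apply: cvgD; first exact: cvg_cst.
  by apply: cvgZ; [exact: cvg_id|exact: cvg_cst].
pose C := f @` `[0, 1]%classic.
have cC : connected C.
  apply: connected_continuous_connected; first exact: segment_connected.
  exact: continuous_subspaceT.
have CG : C `&` Ga = set0.
  apply/seteqP; split => // _ [[s s01 <-]]; apply: ab.
  by move: s01; rewrite /= in_itv.
have Ca : C a by exists 0; [rewrite /= in_itv/= lexx ler01|rewrite /f scale0r addr0].
have Cb : C b by exists 1; [rewrite /= in_itv/= lexx ler01|rewrite /f scale1r subrKC].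
by split; apply: (inner_connected cC).
Qed.

End connected_inner.

Section hulls.
Context {R : realType} {d k : nat} {M : mesh k} (q : node M -> 'rV[R]_d).

Lemma hull_vertsP (s : cell M) x : injective (vert s) ->
  hull q (verts s) x <-> exists a : 'I_k.+1 -> R,
    [/\ forall i, 0 <= a i, \sum_i a i = 1 & x = \sum_i a i *: cpos q s i].
Proof.
move=> vi; split => [/(hullP _ _ vi)[]// a [a0 _ a1 xa]|[a [a0 a1 xa]]].
  by exists a.
by apply/(hullP _ _ vi) => //; exists a; split => // i; rewrite mem_verts.
Qed.

Lemma vert_hull (s : cell M) (a : 'I_k.+1 -> R) : injective (vert s) ->
  (forall i, 0 <= a i) -> \sum_i a i = 1 ->
  hull q (verts s) (\sum_i a i *: cpos q s i).
Proof.
by move=> vi a0 a1; apply/hull_vertsP => //; exists a; split.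
Qed.

Lemma osimplex_hull (s : cell M) : injective (vert s) ->
  osimplex (cpos q s) `<=` hull q (verts s).
Proof. by move=> vi x [a [a0 a1 ->]]; apply: vert_hull => // i; exact: ltW. Qed.

Lemma closed_hull (s : cell M) : injective (vert s) -> closed (hull q (verts s)).
Proof.
move=> vi.
pose K : set 'rV[R]_k.+1 := [set a | (forall i, 0 <= a ord0 i) /\ \sum_i a ord0 i = 1].
pose f (a : 'rV[R]_k.+1) := \sum_i a ord0 i *: cpos q s i.
have -> : hull q (verts s) = f @` K.
  apply/seteqP; split => [x /(hull_vertsP _ vi)[a [a0 a1 ->]]|_ [a [a0 a1] <-]].
    exists (\row_i a i); last by apply: eq_bigr => i _; rewrite mxE.
    split => [i|]; first by rewrite mxE.
    by under eq_bigr do rewrite mxE.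
  exact: vert_hull.
apply: compact_closed; first exact: norm_hausdorff.
apply: continuous_compact.
  apply: continuous_subspaceT => a; apply: (@cvg_sumr R 'rV[R]_d _ _ (nbhs_filter a)) => i _.
  by apply: cvgZ; [exact: coord_continuous|exact: cvg_cst].
apply: bounded_closed_compact.
  exists 1; split => // B B1 a [a0 a1].
  rewrite /= [leLHS]mx_normrE; apply: bigmax_le => [|[i j] _ /=].
    exact: le_trans (ler01) (ltW B1).
  rewrite (ord1 i) ger0_norm//; apply: le_trans (ltW B1).
  by rewrite -a1 (bigD1 j)//= lerDl sumr_ge0.
have -> : K = (\bigcap_(i in [set: 'I_k.+1]) [set a | 0 <= a ord0 i]) `&`
   [set a | \sum_i a ord0 i = 1].
  by apply/seteqP; split => a [a0 a1]; split => // i; [move=> _; exact: a0|exact: a0 i I].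
apply: closedI.
  apply: closed_bigI => i _.
  have := @closed_comp _ _ (fun a : 'rV[R]_k.+1 => a ord0 i) [set x | 0 <= x].
  apply; last exact: closed_ge.
  by move=> a _; exact: coord_continuous.
have := @closed_comp _ _ (fun a : 'rV[R]_k.+1 => \sum_i a ord0 i) [set x | x = 1].
apply; last exact: closed_eq.
by move=> a _; apply: (@cvg_sumr R R^o _ _ (nbhs_filter a)) => i _; exact: coord_continuous.
Qed.

End hulls.

Lemma ball_segment (R : realType) k (x a b : 'rV[R]_k) (r s : R) :
  ball x r a -> ball x r b -> 0 <= s <= 1 -> ball x r (a + s *: (b - a)).
Proof.
rewrite -!ball_normE /= => xa xb /andP[s0 s1].
have -> : x - (a + s *: (b - a)) = (1 - s) *: (x - a) + s *: (x - b).
  by apply/rowP => i; rewrite !mxE; ring.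
apply: (le_lt_trans (ler_normD _ _)); rewrite !normrZ.
rewrite (ger0_norm s0) ger0_norm ?subr_ge0//.
have [->|sn0] := eqVneq s 0; first by rewrite subr0 mul1r mul0r addr0.
have s0' : 0 < s by rewrite lt_def sn0.
apply: (@lt_le_trans _ _ ((1 - s) * r + s * r)).
  apply: ler_ltD; last by rewrite ltr_pM2l.
  by rewrite ler_wpM2l ?subr_ge0// ltW.
by rewrite -mulrDl subrK mul1r.
Qed.

Section conforming_mesh.
Context {R : realType} {d k : nat} {M : mesh k} {q : node M -> 'rV[R]_d}.
Hypothesis cq : conforming q.

Lemma conforming_free (s : cell M) : row_free (edges (cpos q s)).
Proof. by have [+ _ _ _] := cq; exact. Qed.

Lemma conforming_vert_inj (s : cell M) : injective (vert s).
Proof. exact: vert_inj (conforming_free s). Qed.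

Let fr := conforming_free.
Let vi := conforming_vert_inj.

(** Conformity puts the common point in the hull of the common vertices; uniqueness of barycentric
    coordinates in [s] leaves no weight elsewhere. *)
Lemma hull_support (s s' : cell M) (a : 'I_k.+1 -> R) : (forall i, 0 <= a i) -> \sum_i a i = 1 ->
  hull q (verts s') (\sum_i a i *: cpos q s i) -> forall i, a i != 0 -> vert s i \in verts s'.
Proof.
move=> a0 a1 h' i ai.
have [_ _ _ /(_ s s') hh] := cq.
have : (hull q (verts s) `&` hull q (verts s')) (\sum_i a i *: cpos q s i).
  by split => //; exact: vert_hull.
move=> /hh /(hullP _ _ (@vi s))[]; first exact: subsetIl.
move=> b [b0 bW b1 ab].
have e : a = b by apply: (affine_inj (fr s)); rewrite ?a1 ?b1.
apply: contraNT ai => ni; rewrite e bW//.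
by rewrite !inE (negbTE ni) andbF.
Qed.

Lemma card_verts (s : cell M) : #|verts s| = k.+1.
Proof. by rewrite /verts card_imset ?card_ord//; exact: vi. Qed.

(** All weights of an interior point are nonzero, so every vertex of [s] is one of [s']; the
    cardinals agree and [verts] is injective. *)
Lemma osimplex_unique (s s' : cell M) x : osimplex (cpos q s) x -> hull q (verts s') x -> s' = s.
Proof.
move=> [a [a0 a1 ->]] h.
have [_ verts_inj _ _] := cq.
apply: verts_inj; apply/esym/eqP; rewrite eqEcard !card_verts leqnn andbT.
apply/fintype.subsetP => v /imsetP[i _ ->].
by apply: (hull_support _ a1 h); [move=> j; exact: ltW|rewrite gt_eqF].
Qed.

End conforming_mesh.

Section interface_local.
Context {R : realType} {n : nat}.
Notation d := n.+1.
Notation pt := 'rV[R]_d.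
Context {Om inner : set pt} {Ga : mesh n} {q : node Ga -> pt} {nu : cell Ga -> pt}.
Hypothesis I : interface Om inner q nu.

Let cq := interface_conforming I.
Let vi := conforming_vert_inj cq.

Lemma inner_seg (a b : pt) :
  (forall s, 0 <= s <= 1 -> ~ carrier q (a + s *: (b - a))) -> inner a <-> inner b.
Proof. by apply: inner_segment; [exact: inner_open I|exact: inner_boundary I]. Qed.

Lemma carrierP x : carrier q x <-> exists s, hull q (verts s) x.
Proof. by split => [[s _ h]|[s h]]; exists s. Qed.

(** The hulls are closed and finitely many, so those that miss [x] miss a neighbourhood of it. *)
Lemma near_hull x : \forall z \near x, forall s, hull q (verts s) z -> hull q (verts s) x.
Proof.
apply: (@filter_forall _ _ (fun s z => hull q (verts s) z -> hull q (verts s) x) (nbhs x)) => s.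
have [h|h] := pselect (hull q (verts s) x).
  by apply: nearW => z.
have : open (~` hull q (verts s)) by apply/closed_openC/closed_hull.
rewrite openE => /(_ _ h); apply: filterS => z /= nz hz.
by have := nz hz.
Qed.

Lemma dot_normal s (c : 'rV[R]_n) : dot (c *m edges (cpos q s)) (nu s) = 0.
Proof. by rewrite dotE -mulmxA (normal_orthogonal I) mulmx0 mxE. Qed.

Lemma hull_plane s x z : hull q (verts s) x -> hull q (verts s) z ->
  dot (z - x) (nu s) = 0.
Proof.
move=> /(hull_vertsP _ _ (@vi s))[a [_ a1 ->]] /(hull_vertsP _ _ (@vi s))[b [_ b1 ->]].
have [ca <-] := bary_surj a1; have [cb <-] := bary_surj b1.
by rewrite -!bary_comb opprD addrACA subrr add0r -mulmxBl dot_normal.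
Qed.

(* Near x the plane of s is the only part of the carrier, so each side of it lies
   in a single phase; [normal_outward] and x being a boundary point decide which. *)
Lemma near_normal s x : osimplex (cpos q s) x ->
  \forall z \near x, (0 < dot (z - x) (nu s) -> ~ inner z) /\
                     (dot (z - x) (nu s) < 0 -> inner z).
Proof.
move=> sx; have hx : hull q (verts s) x by exact: osimplex_hull sx.
have /nbhs_ballP[r /= r0 rh] := near_hull x.
have plane z : ball x r z -> carrier q z -> dot (z - x) (nu s) = 0.
  move=> xz /carrierP[s' hs']; have := rh _ xz _ hs' => /(osimplex_unique cq sx) ss'.
  by apply: hull_plane => //; rewrite -ss'.
have dseg a b t : dot (a + t *: (b - a) - x) (nu s) = (1 - t) * dot (a - x) (nu s) + t * dot (b - x) (nu s).
  by rewrite !dotBl dotDl dotZl dotBl; ring.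
(* Two points strictly on the side of the plane selected by [sg] are joined inside the ball by a
   segment that avoids the carrier. *)
have half (sg : R) a b : ball x r a -> ball x r b -> 0 < sg * dot (a - x) (nu s) ->
    0 < sg * dot (b - x) (nu s) -> inner a <-> inner b.
  move=> xa xb a0 b0; apply: inner_seg => t t01 /plane.
  move=> /(_ (ball_segment xa xb t01)) /eqP; apply/negP.
  rewrite dseg; suff : 0 < sg * ((1 - t) * dot (a - x) (nu s) + t * dot (b - x) (nu s)).
    by move=> h; apply/eqP => e; move: h; rewrite e mulr0 ltxx.
  rewrite mulrDr ![sg * (_ * _)]mulrCA; move: t01 => /andP[t0 t1].
  have [->|tn] := eqVneq t 0; first by rewrite subr0 mul1r mul0r addr0.
  by apply: ltr_wpDl; [rewrite mulr_ge0 ?subr_ge0// ltW|rewrite mulr_gt0// lt_def tn].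
have pos z : ball x r z -> 0 < dot (z - x) (nu s) -> ~ inner z.
  move=> xz z0.
  have v0 : nu s != 0.
    apply/eqP => v0; have := normal_unit I s.
    by rewrite v0 dot0l => /eqP; rewrite eq_sym oner_eq0.
  have : \forall e \near (0 : R)^'+, [/\ 0 < e, ~ inner (x + e *: nu s) & ball x r (x + e *: nu s)].
    near=> e; split.
    - by near: e; exact: nbhs_right_gt.
    - have : (outer_phase Om inner q `|` ~` Om) (x + e *: nu s).
        by near: e; exact: (normal_outward I sx).
      move=> [[_ h] hi|h /(inner_inside I)//].
      by apply: h; left.
    - rewrite -ball_normE /= opprD addNKr normrN normrZ gtr0_norm; last by near: e; exact: nbhs_right_gt.
      rewrite -ltr_pdivlMr ?normr_gt0//.
      near: e; apply: nbhs_right_lt; apply: divr_gt0 => //; rewrite normr_gt0//.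
  move=> /filter_ex[e [e0 ni xe]].
  have := half 1 _ _ xz xe; rewrite !mul1r => /(_ z0) -> //.
  by rewrite addrAC subrr add0r dotZl (normal_unit I) mulr1.
have [y [xy yi]] : exists y, ball x r y /\ inner y.
  have : carrier q x by apply/carrierP; exists s.
  rewrite -(inner_boundary I) => -[+ _] => /(_ _ (nbhsx_ballx x r r0))[y [iy xy]].
  by exists y.
(* The inner point [y] cannot lie above the plane, by [pos], nor on it, since a small shift along
   the normal would remain inner. *)
have [w [xw wi w0]] : exists w, [/\ ball x r w, inner w & dot (w - x) (nu s) < 0].
  have [y0|y0|y0] := ltrgtP (dot (y - x) (nu s)) 0; first by exists y.
    by have := pos _ xy y0.
  have : \forall e \near (0 : R)^'+, [/\ 0 < e, inner (y + e *: nu s) & ball x r (y + e *: nu s)].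
    have cv : y + e *: nu s @[e --> (0 : R)^'+] --> y.
      rewrite -[X in _ --> X]addr0 -(scale0r (nu s)).
      apply: cvgD; first exact: cvg_cst.
      by apply: cvgZ; [apply: cvg_at_right_filter; exact: cvg_id|exact: cvg_cst].
    near=> e; split.
    - by near: e; exact: nbhs_right_gt.
    - near: e; exact: (cv _ (open_nbhs_nbhs (conj (inner_open I) yi))).
    - near: e; apply: (cv (ball x r)); apply: open_nbhs_nbhs; split => //.
      exact: ball_open.
  move=> /filter_ex[e [e0 ni xe]].
  exfalso; apply: (pos _ xe) ni.
  by rewrite addrAC dotDl y0 add0r dotZl (normal_unit I) mulr1.
apply/nbhs_ballP; exists r => //= z xz; split; first exact: pos.
move=> z0; apply/(half (-1) _ _ xw xz) => //; by rewrite mulN1r oppr_gt0.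
Unshelve. all: by end_near. Qed.

End interface_local.

(** * Crossings of a line with the interface *)

(** The constants on the punctured neighbourhoods form a locally constant function on the connected
    line, zero far to the left. Applied to a quantity whose jumps compensate, this replaces an
    ordering of the jumps. *)
Lemma punctured_locally_constant (R : realType) (f : R -> R) (B : R) :
  (forall r0, exists c, \forall r \near r0^', f r = c) ->
  (forall r, r < B -> f r = 0) ->
  forall r0, \forall r \near r0^', f r = 0.
Proof.
move=> /choice[g fg] fB.
have lc r0 : \forall r \near r0, g r = g r0.
  have /nbhs_ballP[e /= e0 eh] := fg r0.
  apply/nbhs_ballP; exists e => //= r re.
  have [->//|rr0] := eqVneq r r0.
  have : \forall x \near r^', f x = g r0.
    have : \forall x \near r, ball r0 e x /\ x != r0.
      apply: filterI.
        by apply: open_nbhs_nbhs; split => //; exact: ball_open.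
      move: rr0; rewrite neq_lt => /orP[h|h].
        by apply: filterS (lt_nbhsl h) => x; rewrite neq_lt => ->.
      by apply: filterS (lt_nbhsr h) => x; rewrite neq_lt => ->; rewrite orbT.
    rewrite /dnbhs /=; apply: filterS => x [xe xr0] _; exact: eh.
  move=> h; have : \forall x \near r^', f x = g r /\ f x = g r0 by apply: filterI; [exact: fg|exact: h].
  by move=> H; have [x [<- <-]] := @filter_ex _ _ (Proper_dnbhs_numFieldType r) _ H.
suff g0 r0 : g r0 = 0.
  by move=> r0; have := fg r0; rewrite g0.
have cT : connected [set: R] by apply/connected_intervalP => x y _ _ z _.
pose A := [set r | g r = 0].
suff e : A = setT by have : [set: R] r0 by []; rewrite -e.
have oA : open A.
  rewrite openE => r Ar; have := lc r; apply: filterS => x /=.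
  by rewrite /A /= => ->.
apply: cT.
- exists (B - 1); rewrite /A /=.
  have : \forall x \near (B - 1)^', x < B.
    by apply: nbhs_dnbhs; apply: lt_nbhsl; rewrite ltrBlDr ltrDl.
  move=> h; have : \forall x \near (B - 1)^', f x = g (B - 1) /\ x < B.
    by apply: filterI; [exact: fg|exact: h].
  by move=> H; have [x [<- /fB]] := @filter_ex _ _ (Proper_dnbhs_numFieldType (B - 1)) _ H.
- by exists A => //; rewrite setTI.
- exists A; last by rewrite setTI.
  rewrite -openC openE => r /= Ar; have := lc r; apply: filterS => x /=.
  by rewrite /A /= => ->.
Qed.

Section lines.
Context {R : realType} {n : nat}.
Notation d := n.+1.
Notation pt := 'rV[R]_d.
Context {Om inner : set pt} {Ga : mesh n} {q : node Ga -> pt} {nu : cell Ga -> pt}.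
Hypothesis I : interface Om inner q nu.
Variables (e : pt) (C : 'M[R]_(n, d)).

Let cq := interface_conforming I.
Let fr := conforming_free cq.
Let vi := conforming_vert_inj cq.

Definition line (y : 'rV[R]_n) (r : R) : pt := r *: e + y *m C.

Definition frame (q : node Ga -> pt) (s : cell Ga) : 'M[R]_(1 + n) :=
  col_mx e (edges (cpos q s)).

(** Coordinates of [y *m C], relative to the first vertex of [s], in the basis of [e] and the edges.
    Moving by [r] along [e] adds [r] to the first one, whence the sign in [height]. *)
Definition lcoord (q : node Ga -> pt) (s : cell Ga) (y : 'rV[R]_n) : 'rV[R]_(1 + n) :=
  (y *m C - cpos q s ord0) *m invmx (frame q s).

(* [line y (height q s y)] is the intersection of the line with the plane of s,
   and [foot q s y] are the coordinates of this point in s. *)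
Definition height q s y : R := - lcoord q s y ord0 ord0.

Definition foot q s y : 'rV[R]_n := rsubmx (lcoord q s y).

Definition crosses q s y : bool :=
  (frame q s \in unitmx) && [forall i, 0 < bary (foot q s y) i].

(** A transversal plane is met off the hyperplanes that carry the faces of the simplex, so the
    meeting point is interior or outside; a simplex parallel to [e] is not met at all. *)
Definition generic (y : 'rV[R]_n) := forall s,
  if frame q s \in unitmx then forall i, bary (foot q s y) i != 0
  else forall r, ~ hull q (verts s) (line y r).

Lemma lineB y r r0 : line y r - line y r0 = (r - r0) *: e.
Proof. by rewrite /line opprD addrACA subrr addr0 -scalerBl. Qed.

Lemma line_split q' s y r : frame q' s \in unitmx ->
  line y r = (r - height q' s y) *: e +
     (cpos q' s ord0 + foot q' s y *m edges (cpos q' s)).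
Proof.
move=> uK.
have : lcoord q' s y *m frame q' s = y *m C - cpos q' s ord0 by rewrite mulmxKV.
rewrite -[lcoord q' s y]hsubmxK /frame mul_row_col => yE.
rewrite /line -[y *m C](subrK (cpos q' s ord0)) -yE -/(foot q' s y).
rewrite [lsubmx _]mx11_scalar mul_scalar_mx mxE.
have -> : lshift n (ord0 : 'I_1) = ord0 by exact/val_inj.
rewrite /height opprK scalerDl -!addrA; congr (_ + (_ + _)).
by rewrite addrC.
Qed.

(** Applied to the normal, the frame leaves only the entry [dot e (nu s)], the edges being
    orthogonal to it. *)
Lemma frame_normal s : (frame q s \in unitmx) = (dot e (nu s) != 0).
Proof.
have v0 : nu s != 0.
  apply/eqP => v0; have := normal_unit I s.
  by rewrite v0 dot0l => /eqP; rewrite eq_sym oner_eq0.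
apply/idP/idP => [uK|ev].
  apply: contraNneq v0 => ev.
  have K0 : frame q s *m (nu s)^T = 0.
    rewrite /frame mul_col_mx (normal_orthogonal I) -[0 in RHS]vsubmxK.
    congr col_mx; last by apply/matrixP => i j; rewrite !mxE.
    by apply/matrixP => i j; rewrite !ord1 -dotE ev !mxE.
  by rewrite -trmx_eq0 -(mulKmx uK (nu s)^T) K0 mulmx0.
rewrite -row_free_unit.
apply/inj_row_free => u.
rewrite -[u]hsubmxK /frame mul_row_col [lsubmx u]mx11_scalar mul_scalar_mx.
set a := lsubmx u ord0 ord0; set x := rsubmx u => ux.
have a0 : a = 0.
  have : dot (a *: e + x *m edges (cpos q s)) (nu s) = 0 by rewrite ux dot0l.
  rewrite dotDl dotZl (dot_normal I) addr0 => /eqP; rewrite mulf_eq0 (negbTE ev) orbF.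
  by move/eqP.
move: ux; rewrite a0 scale0r add0r -[RHS](mul0mx _ (edges (cpos q s))).
by move=> /(row_free_inj (fr s)) ->; rewrite raddf0 row_mx0.
Qed.

Lemma crosses_osimplex q' s y : crosses q' s y -> osimplex (cpos q' s) (line y (height q' s y)).
Proof.
move=> /andP[uK /forallP x0]; apply/osimplexP; exists (foot q' s y) => //.
by rewrite (line_split _ _ uK) subrr scale0r add0r.
Qed.

(** Pairing with the normal gives the height; uniqueness identifies the barycentric coordinates with
    those of [foot], and genericity makes them positive. *)
Lemma hull_line y s r : generic y -> hull q (verts s) (line y r) ->
  crosses q s y /\ r = height q s y.
Proof.
move=> /(_ s) gy; case: ifPn gy => uK gy; last by move=> /gy.
move=> /(hull_vertsP _ _ (@vi s))[a [a0 a1 le]].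
have [c ca] := bary_surj a1.
have re : r = height q s y.
  apply/eqP; rewrite -subr_eq0; move: uK; rewrite frame_normal => ev.
  have uK : frame q s \in unitmx by rewrite frame_normal.
  have := congr1 (fun z => dot z (nu s)) le; rewrite -ca -bary_comb (line_split _ _ uK).
  rewrite !dotDl !(dot_normal I) dotZl !addr0 -[RHS]add0r => /addIr/eqP.
  by rewrite mulf_eq0 (negbTE ev) orbF.
split => //; rewrite /crosses uK; apply/forallP => i; rewrite lt_def gy /=.
have : bary (foot q s y) = a.
  apply: (affine_inj (fr s)); first by rewrite sum_bary a1.
  rewrite -bary_comb -le (line_split _ _ uK) {1}re subrr scale0r add0r//.
by move=> ->.
Qed.

Lemma cross_inj y s s' : crosses q s y -> crosses q s' y ->
  height q s y = height q s' y -> s = s'.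
Proof.
move=> /crosses_osimplex cs /crosses_osimplex; rewrite -/(height q s y) => cs' hh.
apply: (osimplex_unique cq (s := s') (x := line y (height q s' y))) => //.
by rewrite -hh; exact: osimplex_hull.
Qed.

Lemma continuous_line y : continuous (line y).
Proof.
move=> r; apply: cvgD; last exact: cvg_cst.
by apply: cvgZ; [exact: cvg_id|exact: cvg_cst].
Qed.

Lemma line_inner_free y r0 : (forall s, ~ hull q (verts s) (line y r0)) ->
  \forall r \near r0, inner (line y r) <-> inner (line y r0).
Proof.
move=> nh.
have /nbhs_ballP[e0 /= e00 he0] : \forall r \near r0, forall s, ~ hull q (verts s) (line y r).
  have : \forall r \near r0, forall s, hull q (verts s) (line y r) -> hull q (verts s) (line y r0).
    exact: (@continuous_line y r0 _ (near_hull I (line y r0))).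
  apply: filterS => r h s hs.
  exact: nh (h s hs).
apply/nbhs_ballP; exists e0 => //= r rr0.
apply: (inner_seg I) => t t01 /(carrierP (q := q))[s].
have -> : line y r + t *: (line y r0 - line y r) = line y (r + t * (r0 - r)).
  by rewrite lineB scalerA /line scalerDl addrAC.
apply: he0; move: rr0 t01; rewrite -ball_normE /= => rr0 /andP[t0 t1].
have -> : r0 - (r + t * (r0 - r)) = (1 - t) * (r0 - r) by ring.
rewrite normrM; apply: le_lt_trans rr0; rewrite ler_piMl// ger0_norm; lra.
Qed.

Lemma line_inner_cross y s : crosses q s y ->
  \forall r \near height q s y,
    (r < height q s y -> (inner (line y r) <-> 0 < dot e (nu s))) /\
    (height q s y < r -> (inner (line y r) <-> dot e (nu s) < 0)).
Proof.
move=> cs; have os := crosses_osimplex cs.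
have /andP[uK _] := cs; rewrite frame_normal in uK.
have : \forall r \near height q s y,
    (0 < dot (line y r - line y (height q s y)) (nu s) -> ~ inner (line y r)) /\
    (dot (line y r - line y (height q s y)) (nu s) < 0 -> inner (line y r)).
  exact: (@continuous_line y (height q s y) _ (near_normal I os)).
apply: filterS => r; rewrite /= lineB dotZl => -[pos neg]; split => rh.
  have [e0|e0|e0] := ltrgtP (dot e (nu s)) 0; last by rewrite e0 eqxx in uK.
    by split => // i; case: pos => //; rewrite nmulr_lgt0// subr_lt0.
  by split => // _; apply: neg; rewrite pmulr_llt0// subr_lt0.
have [e0|e0|e0] := ltrgtP (dot e (nu s)) 0; last by rewrite e0 eqxx in uK.
  by split => // _; apply: neg; rewrite nmulr_llt0// subr_gt0.
by split => // i; case: pos => //; rewrite pmulr_lgt0// subr_gt0.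
Qed.

(** With the signs of [dot e (nu s)] as weights this counts exits minus entries; with these signs
    times values of a function it accumulates the boundary terms of the fundamental theorem of
    calculus. *)
Definition below y (w : cell Ga -> R) r := \sum_(s | crosses q s y && (height q s y < r)) w s.

Lemma below_near y (w : cell Ga -> R) r0 : \forall r \near r0^', below y w r =
  below y w r0 + (if r0 < r then \sum_(s | crosses q s y && (height q s y == r0)) w s else 0).
Proof.
have h s : \forall r \near r0^', (height q s y < r) =
    (height q s y < r0) || ((height q s y == r0) && (r0 < r)).
  have [hr|hr|<-] := ltrgtP (height q s y) r0.
  - by apply: nbhs_dnbhs; apply: filterS (lt_nbhsr hr) => r ->.
  - by apply: nbhs_dnbhs; apply: filterS (lt_nbhsl hr) => r /ltW; rewrite leNgt => /negbTE.
  - by apply: nearW => r.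
have H : \forall r \near r0^', forall s, (height q s y < r) =
    (height q s y < r0) || ((height q s y == r0) && (r0 < r)).
  exact: (@filter_forall _ _ (fun s r => (height q s y < r) =
    (height q s y < r0) || ((height q s y == r0) && (r0 < r))) (r0^') _ h).
apply: filterS H => r hr; rewrite /below.
under eq_bigl do rewrite hr.
case: (r0 < r).
  rewrite (bigID (fun s => height q s y < r0))/=; congr (_ + _); apply: eq_bigl => s.
    by rewrite andbT; case: (crosses q s y) => //=; case: ltgtP.
  by rewrite andbT; case: (crosses q s y) => //=; case: ltgtP.
by rewrite addr0; apply: eq_bigl => s; rewrite andbF orbF.
Qed.

Lemma sum_height y (w : cell Ga -> R) s : crosses q s y ->
  \sum_(s' | crosses q s' y && (height q s' y == height q s y)) w s' = w s.
Proof.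
move=> cs; rewrite (big_pred1 s)// => s' /=; apply/idP/eqP => [/andP[cs' /eqP]|->].
  exact: cross_inj.
by rewrite cs eqxx.
Qed.

Lemma below_eq0 y (w : cell Ga -> R) (B : R) :
  exists2 B', B' <= B & forall r, r < B' -> below y w r = 0.
Proof.
exists (- (`|B| + \sum_s `|height q s y|)).
  rewrite lerNl (le_trans (ler_norm (- B)))// normrN lerDl.
  by apply: sumr_ge0 => s _.
move=> r rB; rewrite /below big_pred0// => s; apply/negbTE/nandP; right.
rewrite -leNgt (le_trans (ltW rB))// lerNl (le_trans (ler_norm _))// normrN.
by rewrite (bigD1 s)//= addrCA lerDl addr_ge0// sumr_ge0.
Qed.

Lemma free_dec y r0 : generic y ->
  (exists2 s, crosses q s y & r0 = height q s y) \/ (forall s, ~ hull q (verts s) (line y r0)).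
Proof.
move=> gy; have [[s hs]|nh] := pselect (exists s, hull q (verts s) (line y r0)).
  by left; have [cs rh] := hull_line gy hs; exists s.
by right => s hs; apply: nh; exists s.
Qed.

(* Both sides jump by the same amount at each crossing and vanish far below. *)
Lemma inner_below y B r : generic y -> (forall r, r < B -> ~ inner (line y r)) ->
  (forall s, ~ hull q (verts s) (line y r)) ->
  \1_inner (line y r) = - below y (fun s => Num.sg (dot e (nu s))) r.
Proof.
move=> gy hB; set w := fun s => _ => nh.
pose f r := \1_inner (line y r) + below y w r.
have [B' B'B hB'] := below_eq0 y w B.
have f0 : \forall x \near r^', f x = 0.
  apply: (@punctured_locally_constant R f B').
  - move=> r0; have [[s cs r0s]|free] := free_dec r0 gy.
      exists ((0 < dot e (nu s))%R%:R + below y w r0)%R.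
      have H1 : \forall r \near r0^', r != r0 by exact: nbhs_dnbhs_neq.
      have H2 := below_near y w r0.
      have H3 := nbhs_dnbhs (line_inner_cross cs); rewrite -r0s in H3.
      apply: filterS (filterI H1 (filterI H2 H3)) => x /= [xr0 [e1 [i1 i2]]].
      rewrite /f e1 indicE.
      move: xr0; rewrite neq_lt => /orP[xr0|xr0].
        rewrite ltNge (ltW xr0) /= addr0.
        suff -> : (line y x \in inner) = (0 < dot e (nu s)) by [].
        by apply/idP/idP; rewrite inE; move: (i1 xr0) => [].
      rewrite xr0 r0s sum_height// addrCA [RHS]addrC; congr (_ + _).
      rewrite /w; case: sgrP => [e0|e0|e0].
      - by move: cs; rewrite /crosses frame_normal e0 eqxx.
      - rewrite memNset; first by rewrite add0r.
        by move=> /(i2 xr0); rewrite ltNge (ltW e0).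
      - by rewrite mem_set ?subrr//; exact/(i2 xr0).
    exists (f r0).
    have H2 := below_near y w r0.
    have H3 := nbhs_dnbhs (line_inner_free free).
    apply: filterS (filterI H2 H3) => x /= [e1 i1].
    rewrite /f e1 big_pred0 ?if_same ?addr0.
      rewrite !indicE; suff -> : (line y x \in inner) = (line y r0 \in inner) by [].
      by apply/idP/idP; rewrite !inE => /i1.
    move=> s; apply/negP => /andP[cs /eqP hs]; apply: (free s).
    by rewrite -hs; apply: osimplex_hull => //; exact: crosses_osimplex.
  - move=> x xB; rewrite /f hB'// addr0 indicE memNset//.
    by apply: hB; exact: lt_le_trans B'B.
have H2 := below_near y w r.
have H3 := nbhs_dnbhs (line_inner_free nh).
have H := filterI f0 (filterI H2 H3).
have [x /= [fx [e1 i1]]] := @filter_ex _ _ (Proper_dnbhs_numFieldType r) _ (H _ _).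
apply/eqP; rewrite -addr_eq0 -fx /f e1 big_pred0 ?if_same ?addr0.
  rewrite !indicE; suff -> : (line y x \in inner) = (line y r \in inner) by [].
  by apply/idP/idP; rewrite !inE => /i1.
move=> s; apply/negP => /andP[cs /eqP hs]; apply: (nh s).
by rewrite -hs; apply: osimplex_hull => //; exact: crosses_osimplex.
Qed.
End lines.

(** * The divergence theorem on the inner phase *)

Section mesh_bary.
Context {R : realType} {n : nat}.
Notation d := n.+1.
Notation pt := 'rV[R]_d.
Context {Th : mesh d} {z : node Th -> pt}.
Hypothesis cz : conforming z.

Let unitK K : edges (cpos z K) \in unitmx.
Proof. by rewrite -row_free_unit; exact: conforming_free. Qed.

Definition mbary (K : cell Th) (x : pt) : 'I_d.+1 -> R :=
  bary ((x - cpos z K ord0) *m invmx (edges (cpos z K))).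

Lemma mbary_comb K x : \sum_i mbary K x i *: cpos z K i = x.
Proof. by rewrite -bary_comb mulmxKV ?unitK// subrKC. Qed.

Lemma mbary_unique K (a : 'I_d.+1 -> R) : \sum_i a i = 1 ->
  mbary K (\sum_i a i *: cpos z K i) = a.
Proof.
move=> a1; apply: (affine_inj (conforming_free cz K)); first by rewrite sum_bary a1.
by rewrite mbary_comb.
Qed.

Lemma mbary_osimplex K x : osimplex (cpos z K) x <-> forall i, 0 < mbary K x i.
Proof.
split => [[a [a0 a1 ->]] i|h]; first by rewrite mbary_unique.
by exists (mbary K x); split => //; [exact: sum_bary|rewrite mbary_comb].
Qed.

Lemma mbary_hull K x : hull z (verts K) x <-> forall i, 0 <= mbary K x i.
Proof.
split => [/(hull_vertsP _ _ (conforming_vert_inj cz (s := K)))[a [a0 a1 ->]] i|h].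
  by rewrite mbary_unique.
rewrite -(mbary_comb K x); apply: vert_hull => //.
  exact: (conforming_vert_inj cz (s := K)).
exact: sum_bary.
Qed.

(** With zero slope the coordinate would be constant, but it is one at its own vertex and zero at
    the others. *)
Lemma mbary_affine K i : exists2 w : pt, w != 0 &
  forall x, mbary K x i = dot (x - cpos z K ord0) w + (i == ord0)%:R.
Proof.
pose N := invmx (edges (cpos z K)).
pose w : pt := if unlift ord0 i is Some j then (col j N)^T else - \sum_j (col j N)^T.
have dot_col (v : pt) j : dot v (col j N)^T = (v *m N) ord0 j.
  by rewrite dotE trmxK !mxE; apply: eq_bigr => l _; rewrite mxE.
have wE x : mbary K x i = dot (x - cpos z K ord0) w + (i == ord0)%:R.
  rewrite /mbary /w; case: (unliftP ord0 i) => [j|] ->.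
    by rewrite baryS dot_col addr0.
  rewrite bary0 eqxx [dot _ _]dotC dotNl dot_suml [RHS]addrC; congr (_ - _).
  by apply: eq_bigr => j _; rewrite dotC dot_col.
exists w => //; apply: contraTneq isT => w0.
have {}wE x : mbary K x i = (i == ord0)%:R by rewrite wE w0 dotC dot0l add0r.
have pE l j : mbary K (cpos z K l) j = (j == l)%:R.
  have -> : cpos z K l = \sum_m (m == l)%:R *: cpos z K m.
    rewrite (bigD1 l)//= eqxx scale1r big1 ?addr0// => m /negbTE ->.
    by rewrite scale0r.
  by rewrite mbary_unique// (bigD1 l)//= eqxx big1 ?addr0// => m /negbTE ->.
have := pE (lift ord0 ord0) i; have := pE ord0 i; have := pE i i; rewrite !wE eqxx.
case: eqP => [->|_]; last by move=> /eqP; rewrite eq_sym oner_eq0.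
by rewrite (negbTE (neq_lift _ _)) => _ _ /eqP; rewrite oner_eq0.
Qed.

Lemma continuous_mbary K i : continuous (fun x => mbary K x i).
Proof.
have [w _ wE] := mbary_affine K i.
rewrite (_ : (fun x => _) = (fun x => dot x w + ((i == ord0)%:R - dot (cpos z K ord0) w))).
  by move=> x; exact: (cvgD (@continuous_dot R d w x) (@cvg_cst _ _ _ _ _)).
by apply/funext => x; rewrite wE dotBl addrAC addrA.
Qed.

Lemma open_osimplex K : open (osimplex (cpos z K)).
Proof.
rewrite openE => x /mbary_osimplex x0.
have H : \forall y \near x, forall i, 0 < mbary K y i.
  apply: (@filter_forall _ _ (fun i y => 0 < mbary K y i) (nbhs x)) => i.
  exact: (continuous_mbary (K := K) (i := i) (lt_nbhsr (x0 i))).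
by apply: filterS H => y y0; apply/mbary_osimplex.
Qed.

End mesh_bary.

Lemma affine_near_neq0 (R : realType) (a b r0 : R) : ~ (a = 0 /\ b = 0) ->
  \forall r \near r0^', a + r * b != 0.
Proof.
move=> ab; have [b0|b0] := eqVneq b 0.
  apply: nearW => r; rewrite b0 mulr0 addr0; apply/eqP => a0; exact: ab.
have key r : (a + r * b == 0) = (r == - a / b).
  apply/eqP/eqP => [h|->]; last by rewrite divfK// subrr.
  by apply: (mulIf b0); rewrite divfK//; lra.
have [->|nr0] := eqVneq r0 (- a / b).
  by apply: filterS (nbhs_dnbhs_neq (- a / b)) => r; rewrite key.
move: nr0; rewrite neq_lt => /orP[h|h]; apply: nbhs_dnbhs.
  by apply: filterS (lt_nbhsl h) => r; rewrite key neq_lt => ->.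
by apply: filterS (lt_nbhsr h) => r; rewrite key neq_lt orbC => ->.
Qed.

(** A change of sign would force the root [- a / b] to lie between [r1] and [r2]. *)
Lemma affine_same_sign (R : realType) (a b r1 r2 : R) :
  (forall r, Num.min r1 r2 <= r <= Num.max r1 r2 -> a + r * b != 0) ->
  0 < a + r1 * b -> 0 < a + r2 * b.
Proof.
move=> h h1; rewrite ltNge; apply/negP => h2.
have b0 : b != 0 by apply: contraTneq h2 => b0; rewrite -ltNge; move: h1; rewrite b0 !mulr0.
have : a + (- a / b) * b != 0.
  apply: h; rewrite ge_min le_max.
  have [b1|b1|b1] := ltrgtP b 0; last by rewrite b1 eqxx in b0.
    rewrite !ler_ndivlMr// !ler_ndivrMr//.
    apply/andP; split; apply/orP; [left|right]; lra.
  rewrite !ler_pdivlMr// !ler_pdivrMr//.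
  apply/andP; split; apply/orP; [right|left]; lra.
by rewrite divfK// subrr eqxx.
Qed.

Lemma compact_closure_bounded (R : realType) k (A : set 'rV[R]_k) :
  bounded_set A -> compact (closure A).
Proof.
move=> bA; apply: bounded_closed_compact; last exact: closed_closure.
move: bA => [M [Mr hM]]; exists M; split => // x Mx y.
have cl : closed [set y : 'rV[R]_k | `|y| <= x].
  apply: (@closed_comp _ _ (fun y : 'rV[R]_k => `|y|) [set r | r <= x]); last exact: closed_le.
  by move=> v _; exact: norm_continuous.
rewrite closure_id in cl; rewrite [X in X _ -> _]/= => cy.
by rewrite cl; apply: (closure_subset (A := A)) cy => v /(hM _ Mx).
Qed.

Section slice_ftc.
Context {R : realType} {n : nat}.
Notation d := n.+1.
Notation pt := 'rV[R]_d.
Notation mu := (@lebesgue_measure R).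
Context {Om inner : set pt} {Ga : mesh n} {q : node Ga -> pt} {nu : cell Ga -> pt}.
Hypothesis I : interface Om inner q nu.
Context {Th : mesh d} {z : node Th -> pt}.
Hypotheses (cz : conforming z) (cov : Om `<=` carrier z) (bOm : bounded_set Om).
Variables (e : pt) (C : 'M[R]_(n, d)).
Hypothesis e0 : e != 0.
Variables (f : pt -> R) (P dP : cell Th -> pt -> R).
Hypotheses (fc : {within closure Om, continuous f})
  (fP : forall K x, osimplex (cpos z K) x -> f x = P K x)
  (Pd : forall K x, is_derive x e (P K) (dP K x))
  (Pc : forall K, continuous (P K)) (dPc : forall K, continuous (dP K)).

(** The derivative of [f] along [e] in the inner phase. The open elements do not cover the skeleton,
    where the value is zero; this makes the function measurable. *)
Definition pw_deriv (x : pt) : R :=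
  \1_inner x * \sum_K \1_(osimplex (cpos z K)) x * dP K x.

(* No barycentric coordinate of an element vanishes identically on the line, which
   therefore meets the skeleton of the bulk mesh in finitely many points. *)
Definition mgeneric (y : 'rV[R]_n) :=
  forall (K : cell Th) i, exists r, mbary (z := z) K (line e C y r) i != 0.

Lemma mbary_line K i : exists b, forall y r,
  mbary (z := z) K (line e C y r) i = mbary (z := z) K (line e C y 0) i + r * b.
Proof.
have [w _ wE] := mbary_affine cz K i; exists (dot e w) => y r; rewrite !wE.
have -> : line e C y r - cpos z K ord0 = r *: e + (line e C y 0 - cpos z K ord0).
  by rewrite addrA -[in RHS](subr0 r) -(lineB e C y) subrK.
by rewrite [dot (_ *: _ + _) w]dotDl dotZl; ring.
Qed.

Lemma near_neq0 y r0 : mgeneric y ->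
  \forall r \near r0^', forall K i, mbary (z := z) K (line e C y r) i != 0.
Proof.
move=> gy.
apply: (@filter_forall _ _ (fun K r => forall i, mbary (z := z) K (line e C y r) i != 0) (r0^')) => K.
apply: (@filter_forall _ _ (fun i r => mbary (z := z) K (line e C y r) i != 0) (r0^')) => i.
have [b bE] := mbary_line K i.
suff H : \forall r \near r0^', mbary (z := z) K (line e C y 0) i + r * b != 0.
  by apply: filterS H => r h; rewrite bE.
apply: affine_near_neq0 => -[a0 b0].
by have [r] := gy K i; rewrite bE a0 b0 mulr0 addr0 eqxx.
Qed.

(** An element whose closure contains one point of the open segment contains all of it: no
    barycentric coordinate vanishes, so none changes sign. *)
Lemma same_elt y a b : (forall r, a < r < b -> forall K i, mbary (z := z) K (line e C y r) i != 0) ->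
  (exists2 r, a < r < b & Om (line e C y r)) ->
  exists K, forall r, a < r < b -> osimplex (cpos z K) (line e C y r).
Proof.
move=> nz [r1 r1ab /cov[K _ hK]]; exists K => r rab.
apply/(mbary_osimplex cz) => i.
have := hK => /(mbary_hull cz)/(_ i); rewrite le_eqVlt eq_sym (negbTE (nz _ r1ab _ _)) /=.
have [c cE] := mbary_line K i; rewrite (cE y r1) (cE y r).
apply: affine_same_sign => r2; rewrite ge_min le_max -cE => h; apply: nz.
move: r1ab rab h => /andP[? ?] /andP[? ?] /andP[/orP[?|?] /orP[?|?]]; lra.
Qed.

(** [f] is continuous only relative to [closure Om] and equals [P K] only in the open element.
    Comparing the two limits along [v] extends the equality to an end point on the skeleton or on
    the interface. *)
Lemma f_limit (F : set_system R) (FF : ProperFilter F) (v : R -> pt) x0 K :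
  v r @[r --> F] --> x0 -> (\forall r \near F, Om (v r) /\ osimplex (cpos z K) (v r)) ->
  f x0 = P K x0.
Proof.
move=> vx vF.
have cx : closure Om x0.
  move=> B Bx0.
  have vB : \forall r \near F, B (v r) by exact: (vx _ Bx0).
  have H : \forall r \near F, B (v r) /\ (Om (v r) /\ osimplex (cpos z K) (v r)).
    by apply: filterI; [exact: vB|exact: vF].
  by have [r [/= Br [Or _]]] := filter_ex H; exists (v r).
have wv : v r @[r --> F] --> within (closure Om) (nbhs x0).
  move=> A /= hA.
  have H : \forall r \near F, closure Om (v r) -> A (v r) by exact: (vx _ hA).
  have H2 : \forall r \near F, (closure Om (v r) -> A (v r)) /\ (Om (v r) /\ osimplex (cpos z K) (v r)).
    by apply: filterI; [exact: H|exact: vF].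
  rewrite /= /fmap /=; apply: filterS H2 => r /= [h [Or _]]; apply: h.
  exact: subset_closure.
have fv : f (v r) @[r --> F] --> f x0.
  have fcx : f @ within (closure Om) (nbhs x0) --> f x0.
    by move/subspace_continuousP : fc; apply.
  exact: (@cvg_comp _ _ _ v f _ _ _ wv fcx).
have Pv : P K (v r) @[r --> F] --> P K x0.
  by apply: (@cvg_comp _ _ _ v (P K) _ _ _ vx); exact: Pc.
have fPv : f (v r) @[r --> F] --> P K x0.
  apply: cvg_trans Pv; apply: near_eq_cvg.
  by apply: filterS vF => r [_ /fP ->].
exact: (cvg_unique (@Rhausdorff R) fv fPv).
Qed.

Lemma derive_line y K r : is_derive r (1 : R) (fun r => P K (line e C y r)) (dP K (line e C y r)).
Proof.
have [dP1 dP2] := Pd K (line e C y r).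
have E : (fun h : R => h^-1 *: (P K (line e C y (h *: 1 + r)) - P K (line e C y r))) =
   (fun h : R => h^-1 *: (P K (h *: e + line e C y r) - P K (line e C y r))).
  apply/funext => h; congr (_ *: (P K _ - _)).
  by rewrite /line scalerDl addrA /GRing.scale /= mulr1.
split.
  by rewrite /derivable /= E; exact: dP1.
by rewrite /derive /= E; exact: dP2.
Qed.

Lemma continuous_dP_line y K : continuous (fun r => dP K (line e C y r)).
Proof.
move=> r; apply: (@continuous_comp _ _ _ (line e C y) (dP K)); last exact: dPc.
exact: continuous_line.
Qed.

Lemma measurable_line y : measurable_fun [set: R] (line e C y).
Proof.
apply: measurable_fun_rowP => i; rewrite /line.
under eq_fun do rewrite !mxE.
by apply: measurable_funD => //; exact: measurable_funM.
Qed.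

Lemma measurable_pw_deriv : measurable_fun setT pw_deriv.
Proof.
apply: measurable_funM.
  apply: measurable_indic; apply: open_measurable_row; exact: inner_open I.
apply: measurable_sum => K; apply: measurable_funM.
  apply: measurable_indic; apply: open_measurable_row; exact: open_osimplex.
apply: continuous_measurable_row => //.
by apply: continuous_subspaceT; exact: dPc.
Qed.

Lemma pw_deriv_bounded : exists M, forall x, `|pw_deriv x| <= M.
Proof.
have cOm : compact (closure Om) by exact: compact_closure_bounded.
have /choice[M hM] K : exists M, forall x, closure Om x -> `|dP K x| <= M.
  have : compact (dP K @` closure Om).
    by apply: continuous_compact => //; apply: continuous_subspaceT; exact: dPc.
  move=> /compact_bounded[M [_ hM]]; exists (M + 1) => x cx.
  by apply: (hM (M + 1)); [rewrite ltrDl|exists x].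
exists (\sum_K `|M K|) => x; rewrite /pw_deriv.
rewrite indicE; case: (boolP (x \in inner)) => [xi|_]; last first.
  by rewrite mul0r normr0 sumr_ge0.
have cx : closure Om x by apply: subset_closure; apply: (inner_inside I); rewrite inE in xi.
rewrite mul1r (le_trans (ler_norm_sum _ _ _))//; apply: ler_sum => K _.
rewrite indicE; case: (x \in _); last by rewrite mul0r normr0.
by rewrite mul1r (le_trans (hM K x cx))// ler_norm.
Qed.

Lemma line_bounded y : exists B : R, forall r, Om (line e C y r) -> `|r| < B.
Proof.
have [M [_ hM]] := bOm.
exists ((M + 1 + `|y *m C|) / `|e| + 1) => r Or.
have lM : `|line e C y r| <= M + 1 by apply: (hM (M + 1)); rewrite ?ltrDl.
rewrite ltr_pwDr// ler_pdivlMr ?normr_gt0// -normrZ.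
rewrite (_ : r *: e = line e C y r - y *m C); last by rewrite /line addrK.
by rewrite (le_trans (ler_normB _ _))// lerD2r.
Qed.

Lemma integrable_line y : mu.-integrable setT (EFin \o (pw_deriv \o line e C y)).
Proof.
have [B hB] := line_bounded y.
have mp : measurable_fun setT (pw_deriv \o line e C y).
  by apply: measurableT_comp; [exact: measurable_pw_deriv|exact: measurable_line].
have i1 : mu.-integrable `[- B, B] (EFin \o (pw_deriv \o line e C y)).
  apply: measurable_bounded_integrable => //.
  - by rewrite /= lebesgue_measure_itv /= lte_fin; case: ifP => _; rewrite ?ltry// -EFinD ltry.
  - exact: measurable_funTS.
  - have [M hM] := pw_deriv_bounded; exists M; split; first exact: num_real.
    by move=> x Mx r _; rewrite /= (le_trans (hM _))// ltW.
have i2 : mu.-integrable setT ((EFin \o (pw_deriv \o line e C y)) \_ `[- B, B]).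
  have H := @integrable_mkcond _ _ R mu `[- B, B]%classic (EFin \o (pw_deriv \o line e C y)) (measurable_itv _).
  exact: (H.1 i1).
move: i2.
apply: eq_integrable => // r _; rewrite patchE; case: ifPn => // rB.
rewrite /= /pw_deriv indicE memNset ?mul0r// => /(inner_inside I)/hB.
rewrite ltr_norml => /andP[? ?]; move: rB; rewrite notin_setE /= in_itv /=.
by apply; apply/andP; split; exact: ltW.
Qed.

Lemma piece y K a b : a < b ->
  (forall r, a < r < b -> osimplex (cpos z K) (line e C y r)) ->
  (forall r, a < r < b -> inner (line e C y r)) ->
  \int[mu]_(r in `]a, b]) pw_deriv (line e C y r) = f (line e C y b) - f (line e C y a).
Proof.
move=> ab oK iK.
have Om_in r : a < r < b -> Om (line e C y r) by move=> /iK /(inner_inside I).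
have fb : f (line e C y b) = P K (line e C y b).
  apply: (@f_limit (b^'-) _ (line e C y)).
    by apply: cvg_at_left_filter; exact: continuous_line.
  near=> r; suff h : a < r < b by split; [exact: Om_in|exact: oK].
  by apply/andP; split; near: r; [exact: nbhs_left_gt|exact: nbhs_left_lt].
have fa : f (line e C y a) = P K (line e C y a).
  apply: (@f_limit (a^'+) _ (line e C y)).
    by apply: cvg_at_right_filter; exact: continuous_line.
  near=> r; suff h : a < r < b by split; [exact: Om_in|exact: oK].
  by apply/andP; split; near: r; [exact: nbhs_right_gt|exact: nbhs_right_lt].
have dPi (i : interval R) : [set` i] `<=` `[a, b]%classic ->
    mu.-integrable [set` i] (EFin \o (fun r => dP K (line e C y r))).
  move=> iab; apply: (@integrableS _ _ _ mu `[a, b]%classic) => //.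
  apply: continuous_compact_integrable; first exact: segment_compact.
  by apply: continuous_subspaceT; exact: continuous_dP_line.
rewrite -Rintegral_itv_bndo_bndc; last first.
  by apply: integrableS (integrable_line y).
transitivity (\int[mu]_(r in `]a, b[) dP K (line e C y r)).
  apply: eq_Rintegral => r; rewrite inE /= in_itv /= => rab.
  rewrite /pw_deriv indicE mem_set ?mul1r; last exact: iK.
  rewrite (bigD1 K)//= big1 ?addr0.
    by rewrite indicE mem_set ?mul1r//; exact: oK.
  move=> K' KK'; rewrite indicE memNset ?mul0r// => oK'.
  move/eqP : KK'; apply; apply: (osimplex_unique cz (oK _ rab)).
  by apply: osimplex_hull => //; exact: (conforming_vert_inj cz (s := K')).
rewrite Rintegral_itv_bndo_bndc; last first.
  by apply: dPi => r /=; rewrite !in_itv /= => /andP[/ltW -> /ltW ->].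
rewrite Rintegral_itv_obnd_cbnd; last first.
  by apply: dPi => r /=; rewrite !in_itv /= => /andP[/ltW -> ->].
rewrite /Rintegral (@continuous_FTC2 _ _ (fun r => P K (line e C y r)))//.
- by rewrite fa fb.
- by apply: continuous_subspaceT; exact: continuous_dP_line.
- have cP : continuous (fun r => P K (line e C y r)).
    by move=> r; apply: (@continuous_comp _ _ _ (line e C y) (P K)); [exact: continuous_line|exact: Pc].
  split.
  + by move=> r _; have [] := derive_line y K r.
  + by apply: cvg_at_right_filter; exact: cP.
  + by apply: cvg_at_left_filter; exact: cP.
- by move=> r _; rewrite derive1E; have [_ ->] := derive_line y K r.
Unshelve. all: by end_near. Qed.

Let G y r := \int[mu]_(x in `]-oo, r]) pw_deriv (line e C y x).
Let F y r := f (line e C y r).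

Lemma pw_deriv_primitiveB y a b : a <= b ->
  G y b - G y a = \int[mu]_(x in `]a, b]) pw_deriv (line e C y x).
Proof.
move=> ab; rewrite /G.
by apply: Rintegral_itvB => //; apply: integrableS (integrable_line y).
Qed.

Lemma primitive_side y a b (bb : bool) : a < b ->
  (forall r, a < r < b -> forall K i, mbary (z := z) K (line e C y r) i != 0) ->
  (forall r, a < r < b -> inner (line e C y r) <-> bb) ->
  G y b - G y a = bb%:R * (F y b - F y a).
Proof.
move=> ab nz; rewrite (pw_deriv_primitiveB _ (ltW ab)).
case: bb => ib; last first.
  rewrite mul0r -Rintegral_itv_bndo_bndc; last first.
    by apply: integrableS (integrable_line y).
  rewrite (@eq_Rintegral _ _ _ mu _ (fun=> 0)); first by rewrite /Rintegral integral0.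
  move=> r; rewrite inE /= in_itv /= => rab.
  by rewrite /pw_deriv indicE memNset ?mul0r// => /(ib r rab).
have h : a < (a + b) / 2 < b by apply/andP; split; lra.
have [|K oK] := same_elt nz; first by exists ((a + b) / 2) => //; apply: (inner_inside I); exact/(ib _ h).
by rewrite mul1r (piece ab oK)// => r /ib ->.
Qed.

Lemma slice_integral y : generic (q := q) e C y -> mgeneric y ->
  \int[mu]_r pw_deriv (line e C y r) =
  \sum_(s | crosses e C q s y) Num.sg (dot e (nu s)) * F y (height e C q s y).
Proof.
move=> gy mgy.
pose w s := Num.sg (dot e (nu s)) * F y (height e C q s y).
(* Between special points the primitive [G] and the indicator term cancel up to a constant; at a
   crossing the last two terms have opposite jumps. *)
pose Phi r := G y r - \1_inner (line e C y r) * F y r - below e C (q := q) y w r.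
have [B hB] := line_bounded y.
have nin r : B <= `|r| -> ~ inner (line e C y r).
  by move=> Br /(inner_inside I)/hB; rewrite ltNge Br.
have [B' B'B hB'] := below_eq0 e C (q := q) y w (- `|B|).
have g0 r : B <= `|r| -> pw_deriv (line e C y r) = 0.
  by move=> Br; rewrite /pw_deriv indicE memNset ?mul0r//; exact: nin.
have lowB r : r < B' -> B <= `|r|.
  move=> rB; rewrite (le_trans (ler_norm B))// -normrN ler_normr; apply/orP; right.
  by rewrite lerNr (le_trans (ltW rB)) // normrN.
have Phi0 r0 : \forall r \near r0^', Phi r = 0.
  apply: (@punctured_locally_constant R Phi B') => {r0} [r0|r rB]; last first.
    rewrite /Phi hB'// subr0 indicE memNset ?mul0r ?subr0; last exact/nin/lowB.
    rewrite /G (@eq_Rintegral _ _ _ mu _ (fun=> 0)); first by rewrite /Rintegral integral0.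
    move=> x; rewrite inE /= in_itv /= => xr; apply/g0/lowB.
    exact: le_lt_trans rB.
  have indicB x (bb : bool) : (inner (line e C y x) <-> bb) -> \1_inner (line e C y x) = bb%:R :> R.
    rewrite indicE => h; suff -> : (line e C y x \in inner) = bb by [].
    by apply/idP/idP; rewrite inE => /h.
  have H1 := near_neq0 r0 mgy.
  have H2 := below_near (q := q) e C y w r0.
  (* [bl] and [br] are the phases just before and just after [r0]; in the jump relation the sum is
     empty when [r0] is not a crossing. *)
  suff [bl [br [Hl Hr jump]]] : exists bl br : bool,
     [/\ \forall r \near r0^', r < r0 -> inner (line e C y r) <-> bl,
         \forall r \near r0^', r0 < r -> inner (line e C y r) <-> br &
         bl%:R * F y r0 = br%:R * F y r0 +
           \sum_(s | crosses e C q s y && (height e C q s y == r0)) w s].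
    exists (G y r0 - bl%:R * F y r0 - below e C (q := q) y w r0).
    have : \forall r \near r0^', [/\ forall K i, mbary (z := z) K (line e C y r) i != 0,
      r < r0 -> inner (line e C y r) <-> bl & r0 < r -> inner (line e C y r) <-> br].
      by apply: filterS3 H1 Hl Hr => r.
    move=> /nbhs_ballP[del /= del0 hdel].
    have H3 : \forall r \near r0^', ball r0 del r.
      by apply: nbhs_dnbhs; exact: nbhsx_ballx.
    have H4 := nbhs_dnbhs_neq r0.
    apply: filterS3 H2 H3 H4 => r e2 rdel rr0.
    have [_ hl hr] := hdel r rdel rr0.
    have inball x : Num.min r r0 < x < Num.max r r0 -> ball r0 del x.
      move: rdel; rewrite -!ball_normE /= !ltr_distl gt_min lt_max => /andP[a1 a2] /andP[b1 b2].
      move: b1 b2 => /orP[?|?] /orP[?|?]; apply/andP; split; lra.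
    move: rr0; rewrite neq_lt => /orP[rr0|rr0].
      rewrite /Phi e2 ltNge (ltW rr0) /= addr0 (indicB _ _ (hl rr0)).
      rewrite min_l ?(ltW rr0)// max_r ?(ltW rr0)// in inball.
      have : G y r0 - G y r = bl%:R * (F y r0 - F y r).
        apply: primitive_side => // x xr.
          have [||//] := hdel x; first exact: inball.
          by move: xr => /andP[_ +]; rewrite neq_lt => ->.
        have [||_ + _] := hdel x; first exact: inball.
          by move: xr => /andP[_ +]; rewrite neq_lt => ->.
        by apply; move: xr => /andP[].
      by rewrite mulrBr => h; lra.
    rewrite /Phi e2 rr0 (indicB _ _ (hr rr0)) jump.
    rewrite min_r ?(ltW rr0)// max_l ?(ltW rr0)// in inball.
    have : G y r - G y r0 = br%:R * (F y r - F y r0).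
      apply: primitive_side => // x xr.
        have [||//] := hdel x; first exact: inball.
        by move: xr => /andP[+ _]; rewrite neq_lt orbC => ->.
      have [||_ _ +] := hdel x; first exact: inball.
        by move: xr => /andP[+ _]; rewrite neq_lt orbC => ->.
      by apply; move: xr => /andP[].
    by rewrite mulrBr => h; lra.
  have [[s cs r0s]|free] := free_dec I r0 gy.
    exists (0 < dot e (nu s)), (dot e (nu s) < 0).
    have := nbhs_dnbhs (line_inner_cross I cs); rewrite -r0s => H.
    split.
    - by apply: filterS H => r [].
    - by apply: filterS H => r [].
    - rewrite r0s (sum_height I w cs) /w -mulrDl; congr (_ * _).
      have [ev|ev|ev] := ltrgtP (dot e (nu s)) 0.
      + by rewrite ltr0_sg// subrr.
      + by rewrite gtr0_sg// add0r.
      + by move: cs; rewrite /crosses (frame_normal I) ev eqxx.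
  exists (line e C y r0 \in inner), (line e C y r0 \in inner).
  have := nbhs_dnbhs (line_inner_free I free) => H.
  split.
  - by apply: filterS H => r h _; rewrite h inE.
  - by apply: filterS H => r h _; rewrite h inE.
  - rewrite big_pred0 ?addr0// => s; apply/negP => /andP[cs /eqP hs]; apply: (free s).
    rewrite -hs; apply: osimplex_hull; last exact: crosses_osimplex.
    exact: conforming_vert_inj (interface_conforming I) _.
(* Near this height the line has left [Om] and passed all crossings, so [Phi] compares the whole
   integral with the whole sum. *)
pose r0 := `|B| + \sum_s `|height e C q s y| + 1.
have H1 := Phi0 r0.
have H2 : \forall r \near r0^', r0 - 1 < r by apply: nbhs_dnbhs; apply: lt_nbhsr; rewrite ltrBlDr ltrDl.
have H : \forall r \near r0^', Phi r = 0 /\ r0 - 1 < r by apply: filterI; [exact: H1|exact: H2].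
have [r [Pr rr]] := @filter_ex _ _ (Proper_dnbhs_numFieldType r0) _ H.
rewrite addrK in rr.
have Br : B < r.
  apply: le_lt_trans rr; rewrite (le_trans (ler_norm B))// lerDl.
  by apply: sumr_ge0.
have r_ge0 : 0 <= r.
  by apply/ltW/(le_lt_trans _ rr); rewrite addr_ge0// sumr_ge0.
have GE : G y r = \int[mu]_r pw_deriv (line e C y r).
  rewrite /G Rintegral_mkcond; apply: eq_Rintegral => x _; rewrite patchE.
  case: ifPn => //; rewrite notin_setE /= in_itv /= => /negP; rewrite -ltNge => rx.
  by rewrite g0// (le_trans (ltW Br))// (le_trans (ltW rx))// ler_norm.
move: Pr; rewrite /Phi GE indicE memNset ?mul0r ?subr0; last first.
  by apply: nin; rewrite (le_trans (ltW Br))// ler_norm.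
move=> /eqP; rewrite subr_eq0 => /eqP ->; rewrite /below; apply: eq_bigl => s.
rewrite (_ : _ < _ = true) ?andbT//; apply: le_lt_trans rr.
rewrite (le_trans (ler_norm _))// (bigD1 s)//= addrCA lerDl addr_ge0//.
by apply: sumr_ge0.
Qed.

End slice_ftc.

(** * Null hyperplanes and sets of finite measure *)

Section leb_extra.
Context {R : realType}.
Notation mu := (@lebesgue_measure R).

Lemma measurable_dot k (v : 'rV[R]_k) : measurable_fun setT (fun x : 'rV[R]_k => dot x v).
Proof.
by apply: measurable_sum => i; apply: measurable_funM => //; exact: measurable_coord.
Qed.

Lemma ae_dot_neq k (w : 'rV[R]_k) c : w != 0 ->
  {ae leb k, forall y, dot y w != c}.
Proof.
move=> w0; exists [set x | dot x w = c]; split.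
- by rewrite -[X in measurable X]setTI; apply: (@measurable_dot k w _ [set c]).
- exact: leb_hyperplane.
- by move=> y /= /negP; rewrite negbK => /eqP.
Qed.

(** The coordinate is a nonconstant affine function of [y], so it vanishes on a hyperplane; in
    dimension zero the only coordinate is one. *)
Lemma ae_bary_neq0 k (A : 'M[R]_k) b i : A \in unitmx ->
  {ae leb k, forall y, bary (y *m A + b) i != 0}.
Proof.
move=> uA; case: (unliftP ord0 i) => [j|] ->.
  pose w := delta_mx ord0 j *m A^T : 'rV[R]_k.
  have w0 : w != 0.
    apply/eqP => w0; have := congr1 (fun v => v *m invmx A^T) w0.
    rewrite /w mulmxK ?unitmx_tr// mul0mx.
    by move=> /rowP/(_ j); rewrite !mxE !eqxx /= => /eqP; rewrite oner_eq0.
  have H := ae_dot_neq (- b ord0 j) w0.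
  apply: filterS H => y; rewrite baryS mxE addr_eq0.
  suff -> : dot y w = (y *m A) ord0 j by [].
  rewrite dotE /w trmx_mul trmxK mulmxA trmx_delta !mxE (bigD1 j)//= big1 ?addr0.
    by rewrite [delta_mx _ _ _ _]mxE !eqxx mulr1 mxE.
  by move=> l lj; rewrite [delta_mx _ _ _ _]mxE (negbTE lj) mulr0.
case: k A b i uA => [|k] A b i uA.
  by apply: aeW => y; rewrite bary0 big_ord0 subr0 oner_eq0.
pose w := const_mx 1 *m A^T : 'rV[R]_k.+1.
have w0 : w != 0.
  apply/eqP => w0; have := congr1 (fun v => v *m invmx A^T) w0.
  rewrite /w mulmxK ?unitmx_tr// mul0mx.
  by move=> /rowP/(_ ord0); rewrite !mxE => /eqP; rewrite oner_eq0.
have H := ae_dot_neq (1 - \sum_j b ord0 j) w0.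
apply: filterS H => y; rewrite bary0; apply: contra => /eqP h; apply/eqP.
have -> : dot y w = \sum_j (y *m A) ord0 j.
  rewrite dotE /w trmx_mul trmxK mulmxA mxE; apply: eq_bigr => j _.
  by rewrite !mxE mulr1.
move: h; under eq_bigr do rewrite mxE; rewrite big_split /=; lra.
Qed.

Definition cbox (k : nat) (M : R) : set 'rV[R]_k := [set x : 'rV[R]_k | forall i, `|x ord0 i| <= M].

Lemma box_finite k (M : R) : measurable (cbox (k := k) M) /\ (leb k (cbox (k := k) M) < +oo)%E.
Proof.
rewrite /cbox; have mb j : measurable [set x : 'rV[R]_j | forall i, `|x ord0 i| <= M].
  have -> : [set x : 'rV[R]_j | forall i, `|x ord0 i| <= M] =
    \bigcap_(i in [set: 'I_j]) [set x | `|x ord0 i| <= M].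
    by apply/seteqP; split => x h i //=; exact: h.
  apply: fin_bigcap_measurable => // i _.
  have := @measurable_coord R j i measurableT `[- M, M]%classic (measurable_itv _).
  rewrite setTI; congr measurable; apply/seteqP; split => x /=;
    by rewrite in_itv /= ler_norml.
split => //; elim: k => [|k IH].
  apply: (@le_lt_trans _ _ (leb 0 [set: 'rV[R]_0])); first by apply: le_measure; rewrite ?inE//; exact: mb.
  by rewrite /= diracE in_setT ltry.
have -> : leb k.+1 [set x : 'rV[R]_k.+1 | forall i, (`|x ord0 i| <= M)%R] =
   ((mu \x leb k) (`[(- M)%R, M]%classic `*` cbox (k := k) M))%E.
  rewrite /= /lebesgue_ind /pushforward; congr ((_ \x _)%E _).
  apply/seteqP; split => [[x y] /= h|[x y] /= [hx hy] i].
    split => [|i]; first by have := h ord0; rewrite /= in_itv/= row_cons0 ler_norml.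
    by have := h (lift ord0 i); rewrite row_consS.
  case: (unliftP ord0 i) => [j|] ->; first by rewrite row_consS.
  by rewrite row_cons0 ler_norml; rewrite in_itv in hx.
rewrite product_measure1E//; last exact: mb.
rewrite lte_mul_pinfty//.
rewrite /= lebesgue_measure_itv /= lte_fin; case: ifP => _ //; rewrite -EFinD.
Qed.

Lemma coord_le_norm k (x : 'rV[R]_k) i : `|x ord0 i| <= `|x|.
Proof.
rewrite [leRHS]mx_normrE.
by apply: (le_bigmax _ (fun ij : 'I_1 * 'I_k => `|x ij.1 ij.2|) (ord0, i)).
Qed.

Lemma leb_bounded k (A : set 'rV[R]_k) : measurable A -> bounded_set A ->
  (leb k A < +oo)%E.
Proof.
move=> mA [M [_ hM]]; have [mB B] := box_finite k (M + 1).
apply: le_lt_trans B; apply: le_measure; rewrite ?inE//.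
move=> x Ax i; rewrite (le_trans (coord_le_norm x i))//.
by apply: (hM (M + 1)); rewrite ?ltrDl.
Qed.

Lemma refsimplex_facts k : [/\ measurable (@refsimplex R k), bounded_set (@refsimplex R k)
  & (leb k (@refsimplex R k) < +oo)%E].
Proof.
have m : measurable (@refsimplex R k).
  have -> : @refsimplex R k = (\bigcap_(i in [set: 'I_k]) [set x | 0 < x ord0 i])
     `&` [set x | \sum_i x ord0 i < 1].
    apply/seteqP; split => x [h1 h2]; split => // i; first by move=> _; exact: h1.
    by have := h1 i I.
  apply: measurableI.
    apply: fin_bigcap_measurable => // i _.
    have := @measurable_coord R k i measurableT `]0, +oo[%classic (measurable_itv _).
    rewrite setTI; congr measurable; apply/seteqP; split => x /=;
      by rewrite in_itv /= andbT.
  have ms : measurable_fun setT (fun x : 'rV[R]_k => \sum_i x ord0 i).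
    by apply: measurable_sum => i; exact: measurable_coord.
  have := ms measurableT `]-oo, 1[%classic (measurable_itv _).
  by rewrite setTI; congr measurable; apply/seteqP; split => x /=; rewrite in_itv.
have b : bounded_set (@refsimplex R k).
  exists 1; split => // M M1 x [x0 x1] /=; rewrite [leLHS]mx_normrE; apply: bigmax_le.
    exact: le_trans (ler01) (ltW M1).
  move=> [i j] _ /=; rewrite (ord1 i) gtr0_norm// (le_trans _ (ltW M1))//.
  rewrite (le_trans _ (ltW x1))// (bigD1 j)//= lerDl sumr_ge0// => l _; exact: ltW.
split => //; exact: leb_bounded.
Qed.

End leb_extra.

(** * Frame determinants and surface measure *)

Section frame_det.
Context {R : realType} {n : nat}.
Notation d := n.+1.
Notation pt := 'rV[R]_d.
Context {Om inner : set pt} {Ga : mesh n} {q : node Ga -> pt} {nu : cell Ga -> pt}.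
Hypothesis I : interface Om inner q nu.

(** Signed size of [s]: its square is the Gram determinant of the edges, and its sign compares the
    numbering of the vertices with the outward normal. *)
Definition nframe s : R := \det (frame (nu s) q s).

Lemma nframe_neq0 s : nframe s != 0.
Proof.
by rewrite /nframe -unitfE -unitmxE (frame_normal I) (normal_unit I) oner_eq0.
Qed.

(** The product of the frame with the transposed normal frame is block triangular, since the normal
    is orthogonal to the edges. *)
Lemma det_frame_gram (v : pt) s : \det (frame v q s) * nframe s =
  dot v (nu s) * \det (edges (cpos q s) *m (edges (cpos q s))^T).
Proof.
rewrite /nframe -[X in _ * X]det_tr -det_mulmx /frame tr_col_mx.
rewrite (mul_col_row v (edges (cpos q s)) (nu s)^T (edges (cpos q s))^T).
by rewrite (normal_orthogonal I) det_ublock det_mx11 -dotE.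
Qed.

Lemma sqr_nframe s : nframe s ^+ 2 = \det (edges (cpos q s) *m (edges (cpos q s))^T).
Proof.
by rewrite expr2 {1}/nframe det_frame_gram (normal_unit I) mul1r.
Qed.

Lemma det_frame (v : pt) s : \det (frame v q s) = dot v (nu s) * nframe s.
Proof.
apply: (mulIf (nframe_neq0 s)).
by rewrite det_frame_gram -sqr_nframe expr2 mulrA.
Qed.

Lemma int_simplexE s f : int_simplex (cpos q s) f =
  `|nframe s| * \int[leb n]_(x in @refsimplex R n) f (cpos q s ord0 + x *m edges (cpos q s)).
Proof. by rewrite /int_simplex -sqr_nframe sqrtr_sqr. Qed.

Variables (e : pt) (C : 'M[R]_(n, d)).

Definition footmx s : 'M[R]_n := rsubmx (C *m invmx (frame e q s)).
Definition footv s : 'rV[R]_n := - rsubmx (cpos q s ord0 *m invmx (frame e q s)).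

Lemma footE s y : foot e C q s y = y *m footmx s + footv s.
Proof.
rewrite /foot /lcoord mulmxBl /footmx /footv -mulmxA; apply/rowP => i.
rewrite !mxE; congr (_ - _).
by apply: eq_bigr => j _; rewrite [in RHS]mxE.
Qed.

(** Written in the frame of [s], the basis made of [e] and [C] is block triangular with diagonal
    blocks 1 and [footmx], the Jacobian of the projection along [e]. *)
Lemma det_footmx s : frame e q s \in unitmx ->
  \det (col_mx e C : 'M[R]_(1 + n)) = \det (footmx s) * \det (frame e q s).
Proof.
move=> uK.
have -> : (col_mx e C : 'M[R]_(1 + n)) =
  block_mx 1%:M 0 (lsubmx (C *m invmx (frame e q s))) (footmx s) *m frame e q s.
  rewrite -[LHS](mulmxKV uK); congr (_ *m _).
  rewrite mul_col_mx -[C *m _ in LHS]hsubmxK -/(footmx s) /block_mx; congr col_mx.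
  have : frame e q s *m invmx (frame e q s) = 1%:M by rewrite mulmxV.
  rewrite {1}/frame mul_col_mx (@scalar_mx_block _ 1 n).
  by move=> /eq_col_mx[].
by rewrite det_mulmx det_lblock det1 mul1r.
Qed.

End frame_det.

Lemma sum_deltaZ (R : pzRingType) (V : lmodType R) k (f : 'I_k -> V) l :
  \sum_m (m == l)%:R *: f m = f l.
Proof.
rewrite (bigD1 l)//= eqxx scale1r big1 ?addr0// => m /negbTE ->.
by rewrite scale0r.
Qed.

Lemma vertex_hull (R : realType) d k (M : mesh k) (q : node M -> 'rV[R]_d) s i :
  injective (vert s) -> hull q (verts s) (cpos q s i).
Proof.
move=> vi; rewrite -(sum_deltaZ (cpos q s) i); apply: vert_hull => //.
by rewrite (bigD1 i)//= eqxx big1 ?addr0// => m /negbTE ->.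
Qed.

(** * From lines to the volume integral *)

Section divergence_theorem.
Context {R : realType} {n : nat}.
Notation d := n.+1.
Notation pt := 'rV[R]_d.
Notation mu := (@lebesgue_measure R).
Context {Om inner : set pt} {Ga : mesh n} {q : node Ga -> pt} {nu : cell Ga -> pt}.
Hypothesis I : interface Om inner q nu.
Context {Th : mesh d} {z : node Th -> pt}.
Hypotheses (cz : conforming z) (cov : Om `<=` carrier z) (bOm : bounded_set Om).
Variables (e : pt) (C : 'M[R]_(n, d)).
Hypothesis uA : (col_mx e C : 'M[R]_(1 + n)) \in unitmx.
Variables (f : pt -> R) (P dP : cell Th -> pt -> R).
Hypotheses (fc : {within closure Om, continuous f})
  (fP : forall K x, osimplex (cpos z K) x -> f x = P K x)
  (Pd : forall K x, is_derive x e (P K) (dP K x))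
  (Pc : forall K, continuous (P K)) (dPc : forall K, continuous (dP K)).

Let A : 'M[R]_(1 + n) := col_mx e C.

Lemma lineE y r : line e C y r = row_cons (r, y) *m A.
Proof. by rewrite row_consE /A (mul_row_col (r%:M : 'M[R]_1) y e C) mul_scalar_mx. Qed.

(** [e] and the rows of [C] form a basis, so only zero is orthogonal to all of them. *)
Let C_inj (w : pt) : w != 0 -> dot e w = 0 -> w *m C^T != 0.
Proof.
move=> w0 ew; apply: contraNneq w0 => wC.
have : A *m w^T = 0.
  rewrite /A mul_col_mx -[C *m _]trmxK trmx_mul trmxK wC trmx0.
  rewrite (_ : e *m w^T = 0) ?col_mx0//.
  by apply/matrixP => i j; rewrite !ord1 -dotE ew mxE.
by move=> h; rewrite -trmx_eq0 -(mulKmx uA w^T) h mulmx0.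
Qed.

Let e_neq0 : e != 0.
Proof.
apply: contraTneq isT => ez.
pose w : pt := (invmx A *m (delta_mx ord0 ord0 : 'cV[R]_(1 + n)))^T.
have : A *m w^T = delta_mx ord0 ord0 by rewrite /w trmxK mulKVmx.
rewrite /A mul_col_mx ez mul0mx => /matrixP/(_ (lshift n ord0) ord0).
rewrite col_mxEu !mxE (_ : lshift n (ord0 : 'I_1) = ord0); last exact/val_inj.
by rewrite eqxx /= => /eqP; rewrite eq_sym oner_eq0.
Qed.

Lemma dot_line y r (w : pt) : dot (line e C y r) w = r * dot e w + dot y (w *m C^T).
Proof. by rewrite /line dotDl dotZl [dot y _]dotE trmx_mul trmxK mulmxA -dotE. Qed.

(** Each failure confines [y] to one of finitely many hyperplanes. Where [e] is parallel to the
    plane concerned, the equation on [y] is nontrivial by [C_inj]. *)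
Lemma ae_line_generic : {ae leb n, forall y, generic (q := q) e C y /\ mgeneric (z := z) e C y}.
Proof.
have H1 : {ae leb n, forall y, generic (q := q) e C y}.
  apply: (@filter_forall _ _ (fun s y => if frame e q s \in unitmx then
    forall i, bary (foot e C q s y) i != 0 else forall r, ~ hull q (verts s) (line e C y r))
    (almost_everywhere (leb n))) => s.
  have [uK|uK] := boolP (frame e q s \in unitmx).
    apply: (@filter_forall _ _ (fun i y => bary (foot e C q s y) i != 0)
      (almost_everywhere (leb n))) => i.
    have uB : footmx (q := q) e C s \in unitmx.
      move: uA; rewrite !unitmxE (det_footmx C uK).
      by rewrite unitrM => /andP[].
    have H := ae_bary_neq0 (footv (q := q) e s) i uB.
    by apply: filterS H => y; rewrite footE.
  move: uK; rewrite (frame_normal I) negbK => /eqP ev.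
  have v0 : nu s != 0.
    apply/eqP => v0; have := normal_unit I s.
    by rewrite v0 dot0l => /eqP; rewrite eq_sym oner_eq0.
  have H := ae_dot_neq (dot (cpos q s ord0) (nu s)) (C_inj v0 ev).
  apply: filterS H => y yn r hr.
  have h0 : hull q (verts s) (cpos q s ord0).
    by apply: vertex_hull; exact: (conforming_vert_inj (interface_conforming I) (s := s)).
  have := hull_plane I h0 hr; rewrite dotBl dot_line ev mulr0 add0r => /eqP.
  by rewrite subr_eq0 (negbTE yn).
have H2 : {ae leb n, forall y, mgeneric (z := z) e C y}.
  apply: (@filter_forall _ _ (fun K y => forall i, exists r, mbary (z := z) K (line e C y r) i != 0)
    (almost_everywhere (leb n))) => K.
  apply: (@filter_forall _ _ (fun i y => exists r, mbary (z := z) K (line e C y r) i != 0)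
    (almost_everywhere (leb n))) => i.
  have [w w0 wE] := mbary_affine cz K i.
  have [ew|ew] := eqVneq (dot e w) 0.
    have H := ae_dot_neq (dot (cpos z K ord0) w - (i == ord0)%:R) (C_inj w0 ew).
    apply: filterS H => y yn; exists 0; rewrite wE dotBl dot_line mul0r add0r.
    apply: contra yn => /eqP h; apply/eqP; lra.
  apply: aeW => y.
  pose c := dot (line e C y 0 - cpos z K ord0) w + (i == ord0)%:R.
  have lE r : mbary (z := z) K (line e C y r) i = r * dot e w + c.
    by rewrite wE /c !dotBl !dot_line; ring.
  have [c0|c0] := eqVneq c 0.
    by exists 1; rewrite lE c0 addr0 mul1r.
  by exists 0; rewrite lE mul0r add0r.
by apply: filterS2 H1 H2.
Qed.

Lemma fcont_bounded : exists M, forall x, closure Om x -> `|f x| <= M.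
Proof.
have cOm : compact (closure Om) by exact: compact_closure_bounded.
have : compact (f @` closure Om) by exact: continuous_compact.
move=> /compact_bounded[M [_ hM]]; exists (M + 1) => x cx.
by apply: (hM (M + 1)); [rewrite ltrDl|exists x].
Qed.

Let psi s (x : 'rV[R]_n) : R := f (cpos q s ord0 + x *m edges (cpos q s)).

Lemma ref_carrier s x : refsimplex x -> closure Om (cpos q s ord0 + x *m edges (cpos q s)).
Proof.
move=> /refsimplexE x0; apply: (interface_inside I); exists s => //.
apply: osimplex_hull; first exact: (conforming_vert_inj (interface_conforming I) (s := s)).
by apply/osimplexP; exists x.
Qed.

Lemma integrable_psi s : (leb n).-integrable (@refsimplex R n) (EFin \o psi s).
Proof.
have [mr br fr] := @refsimplex_facts R n.
apply: measurable_bounded_integrable => //.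
  apply: continuous_measurable_row => //; apply/subspace_continuousP => x rx.
  have wv : cpos q s ord0 + v *m edges (cpos q s) @[v --> within (@refsimplex R n) (nbhs x)] -->
      within (closure Om) (nbhs (cpos q s ord0 + x *m edges (cpos q s))).
    have cv : cpos q s ord0 + v *m edges (cpos q s) @[v --> x] -->
        cpos q s ord0 + x *m edges (cpos q s).
      exact: (cvgD (@cvg_cst _ _ _ _ _) (@continuous_mulmx R n d (edges (cpos q s)) x)).
    move=> B hB; have H : \forall v \near x, closure Om (cpos q s ord0 + v *m edges (cpos q s)) ->
       B (cpos q s ord0 + v *m edges (cpos q s)) by exact: (cv _ hB).
    rewrite /= /fmap /within /=; apply: filterS H => v h rv; apply: h.
    exact: ref_carrier.
  have fcx : f @ within (closure Om) (nbhs (cpos q s ord0 + x *m edges (cpos q s))) -->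
      f (cpos q s ord0 + x *m edges (cpos q s)).
    by move/subspace_continuousP : fc; apply; exact: ref_carrier.
  exact: (@cvg_comp _ _ _ _ f _ _ _ wv fcx).
have [M hM] := fcont_bounded; exists M; split; first exact: num_real.
by move=> B MB x rx /=; rewrite (le_trans (hM _ _)) ?(ltW MB)//; exact: ref_carrier.
Qed.

Let g := pw_deriv (inner := inner) (z := z) dP.

Lemma integrable_pw_deriv : (leb d).-integrable setT (EFin \o g).
Proof.
have mi : measurable inner by apply: open_measurable_row; exact: inner_open I.
have i1 : (leb d).-integrable inner (EFin \o g).
  apply: measurable_bounded_integrable => //.
  - apply: leb_bounded => //; move: bOm => [M [Mr hM]]; exists M; split => // x Mx y iy.
    by apply: (hM x Mx); exact: (inner_inside I).
  - by apply: measurable_funTS; exact: (measurable_pw_deriv I cz dPc).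
  - have [M hM] := @pw_deriv_bounded R n Om inner Ga q nu I Th z bOm dP dPc.
    exists M; split; first exact: num_real.
    by move=> x Mx r _; rewrite /= (le_trans (hM _))// ltW.
have i2 : (leb d).-integrable setT ((EFin \o g) \_ inner).
  exact: ((@integrable_mkcond _ _ R (leb d) inner (EFin \o g) mi).1 i1).
apply: eq_integrable i2 => // x _; rewrite patchE; case: ifPn => // xi.
by rewrite /= /g /pw_deriv indicE (negbTE xi) mul0r.
Qed.

Let phi s : 'rV[R]_n -> R := psi s \_ (@refsimplex R n).

Let iphi s : (leb n).-integrable setT (EFin \o phi s).
Proof.
have [mr _ _] := @refsimplex_facts R n.
have : (leb n).-integrable setT ((EFin \o psi s) \_ (@refsimplex R n)).
  exact: ((@integrable_mkcond _ _ R (leb n) _ (EFin \o psi s) mr).1 (integrable_psi s)).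
by apply: eq_integrable => // x _; rewrite /phi /= !patchE; case: ifP.
Qed.

Let c s : R := if frame e q s \in unitmx then Num.sg (dot e (nu s)) else 0.

Let slice_sum y := \sum_s c s * phi s (y *m footmx (q := q) e C s + footv (q := q) e s).

Let iphi_foot s : frame e q s \in unitmx ->
  (leb n).-integrable setT (fun y => (phi s (y *m footmx (q := q) e C s + footv (q := q) e s))%:E) /\
  (`|\det (footmx (q := q) e C s)|%:E *
   \int[leb n]_y (phi s (y *m footmx (q := q) e C s + footv (q := q) e s)%R)%:E =
   (\int[leb n]_(x in @refsimplex R n) psi s x)%R%:E)%E.
Proof.
move=> uK.
have uB : footmx (q := q) e C s \in unitmx.
  by move: uA; rewrite !unitmxE (det_footmx C uK) unitrM => /andP[].
split.
  exact: (integrable_affine (footv (q := q) e s) uB (iphi s)).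
rewrite (int_affine (footv (q := q) e s) uB (iphi s)) /= /Rintegral.
rewrite fineK; last by exact: (integrable_fin_num (let: And3 mr _ _ := @refsimplex_facts R n in mr) (integrable_psi s)).
rewrite [RHS]integral_mkcond; apply: eq_integral => x _.
by rewrite /phi !patchE; case: ifP.
Qed.

Let slice_sumE y : generic (q := q) e C y -> mgeneric (z := z) e C y ->
  \int[mu]_r g (line e C y r) = slice_sum y.
Proof.
move=> gy mgy; rewrite /g (slice_integral I cz cov bOm e_neq0 fc fP Pd Pc dPc gy mgy).
rewrite /slice_sum big_mkcond; apply: eq_bigr => s _; rewrite -footE /c.
rewrite /crosses; case: ifPn => [/andP[uK /forallP x0]|].
  rewrite uK /phi patchE mem_set; last exact/refsimplexE.
  by rewrite (@line_split R n Ga e C q s y _ uK) subrr scale0r add0r.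
case: (boolP (frame e q s \in unitmx)) => uK /=; last by rewrite mul0r.
move=> /negP nx; rewrite /phi patchE memNset ?mulr0//.
by move=> /refsimplexE h; apply: nx; exact/forallP.
Qed.

Let isum s : (leb n).-integrable setT
  (fun y => (c s * phi s (y *m footmx (q := q) e C s + footv (q := q) e s))%:E).
Proof.
rewrite /c; case: ifPn => uK; last first.
  by under eq_fun do rewrite mul0r; exact: integrable0.
under eq_fun do rewrite EFinM.
by apply: integrableZl => //; have [] := iphi_foot uK.
Qed.

Theorem divergence_direction :
  \int[leb d]_x g x = \sum_s dot e (nu s) * int_simplex (cpos q s) f.
Proof.
have := int_affine (k := d) 0 uA integrable_pw_deriv.
have gA : (leb d).-integrable setT (EFin \o (fun x => g (x *m A))).
  have := integrable_affine (k := d) 0 uA integrable_pw_deriv.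
  by apply: eq_integrable => // x _ /=; rewrite addr0.
have [mG GE] := int_row_cons gA.
under eq_integral do rewrite /= addr0.
rewrite [X in (_ * X)%E = _ -> _]GE.
have -> : (\int[leb n]_y \int[mu]_r (EFin \o (fun x => g (x *m A))) (row_cons (r, y)) =
   \int[leb n]_y (slice_sum y)%:E)%E.
  apply: ae_eq_integral => //.
    apply/measurable_EFinP; apply: measurable_sum => s.
    by have /measurable_int/measurable_EFinP := isum s.
  have H := ae_line_generic; apply: filterS H => y [gy mgy] _.
  rewrite -(slice_sumE gy mgy) /Rintegral fineK.
    by apply: eq_integral => r _; rewrite /= lineE.
  apply: integrable_fin_num => //.
  exact: (integrable_line I cz bOm C e_neq0 dPc).
under [X in (_ * X)%E]eq_integral do rewrite /slice_sum -sumEFin.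
rewrite integral_sum//.
move=> h; rewrite /Rintegral -[X in fine X]h.
(* [\det A] is [\det (footmx s)] times [dot e (nu s)] times [nframe s]. The first factor is the
   Jacobian of [foot], the absolute value of the last is the surface factor of [int_simplex], and
   the crossing sign restores the sign of the middle one. *)
rewrite (eq_bigr (fun s => (dot e (nu s) / `|\det A| * int_simplex (cpos q s) f)%:E)); last first.
  move=> s _; have [uK|uK] := boolP (frame e q s \in unitmx); last first.
    rewrite /c (negbTE uK); move: uK; rewrite (frame_normal I) negbK => /eqP ->.
    under eq_integral do rewrite mul0r.
    by rewrite integral0 !mul0r.
  have [i1 i2] := iphi_foot uK.
  rewrite /c uK; under eq_integral do rewrite EFinM.
  rewrite integralZl//.
  have B0 : `|\det (footmx (q := q) e C s)| != 0.
    rewrite normr_eq0 -unitfE -unitmxE.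
    by move: uA; rewrite !unitmxE (det_footmx C uK) unitrM => /andP[].
  have K0 : `|\det (frame e q s)| != 0 by rewrite normr_eq0 -unitfE -unitmxE.
  rewrite -[X in (_ * X)%E]mul1e -[X in (_ * (X%:E * _))%E](mulVf B0) EFinM -muleA i2.
  rewrite -!EFinM; congr EFin.
  rewrite /A (det_footmx C uK) (int_simplexE I) normrM -/(psi s).
  move: K0; rewrite (det_frame I) normrM mulf_eq0 negb_or => /andP[K1 K2].
  have -> : Num.sg (dot e (nu s)) = dot e (nu s) / `|dot e (nu s)|.
    by apply: (mulIf K1); rewrite divfK// -numEsg.
  by field; rewrite ?K1 ?K2 ?B0.
rewrite sumEFin -EFinM /= mulr_sumr; apply: eq_bigr => s _.
have A0 : `|\det A| != 0 by rewrite normr_eq0 -unitfE -unitmxE.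
by field.
Qed.
End divergence_theorem.

Section coordinate_direction.
Context {R : realType} {n : nat}.

(** The completion is read off a permutation matrix whose first row is the [j]-th unit vector. *)
Lemma complete_delta (j : 'I_n.+1) : exists C : 'M[R]_(n, n.+1),
  (col_mx (delta_mx ord0 j : 'rV[R]_n.+1) C : 'M[R]_(1 + n)) \in unitmx.
Proof.
pose A : 'M[R]_(1 + n) := perm_mx (lift_perm ord0 j 1%g : 'S_(1 + n)).
exists (dsubmx A).
have -> : delta_mx ord0 j = usubmx A :> 'rV[R]_(1 + n).
  apply/rowP => k; rewrite !mxE (_ : lshift n ord0 = ord0); last exact/val_inj.
  by rewrite lift_perm_id eqxx /= eq_sym.
by rewrite vsubmxK unitmx_perm.
Qed.

Lemma dot_delta (j : 'I_n.+1) (x : 'rV[R]_n.+1) : dot (delta_mx ord0 j) x = x ord0 j.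
Proof.
rewrite /dot (bigD1 j)//= mxE !eqxx mul1r big1 ?addr0// => i ij.
by rewrite mxE (negbTE ij) mul0r.
Qed.

End coordinate_direction.

(** * The volume as a sum of determinants *)

Section ref_mean.
Context {R : realType} {n : nat}.
Notation ref := (@refsimplex R n).
Definition ref_volume : R := \int[leb n]_(x in ref) 1.

(** Linear part of [swap j]: entry [j] is replaced by minus the sum of all entries. *)
Let T j : 'M[R]_n := 1%:M - (const_mx 1 + delta_mx j ord0 : 'cV_n) *m delta_mx ord0 j.

Let TE j (x : 'rV[R]_n) : x *m T j = x - (\sum_i x ord0 i + x ord0 j) *: delta_mx ord0 j.
Proof.
rewrite /T mulmxBr mulmx1 mulmxA; congr (_ - _).
rewrite [x *m _]mx11_scalar mul_scalar_mx; congr (_ *: _).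
rewrite mulmxDr mxE; congr (_ + _).
  by rewrite mxE; apply: eq_bigr => i _; rewrite mxE mulr1.
rewrite mxE (bigD1 j)//= mxE !eqxx mulr1 big1 ?addr0// => i ij.
by rewrite mxE (negbTE ij) mulr0.
Qed.

Let T_coord j (x : 'rV[R]_n) i : (x *m T j) ord0 i =
  if i == j then - \sum_(l | l != j) x ord0 l - x ord0 j else x ord0 i.
Proof.
rewrite TE !mxE eqxx /= (eq_sym i); case: eqP => [->|_]; last by rewrite mulr0 subr0.
by rewrite mulr1 (bigD1 i)//=; ring.
Qed.

(* The affine involution of the reference simplex exchanging the vertices ord0 and [lift ord0 j]. *)
Let swap j (x : 'rV[R]_n) := x *m T j + delta_mx ord0 j.

Let swapS j x i : i != j -> swap j x ord0 i = x ord0 i.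
Proof. by move=> ij; rewrite mxE T_coord (negbTE ij) mxE (negbTE ij) andbF addr0. Qed.

Let swapj j x : swap j x ord0 j = bary x ord0.
Proof.
by rewrite mxE T_coord eqxx mxE !eqxx bary0 [in RHS](bigD1 j)//=; ring.
Qed.

Let swap0 j x : bary (swap j x) ord0 = bary x (lift ord0 j).
Proof.
rewrite bary0 baryS (bigD1 j)//= swapj bary0 [in X in 1 - X](bigD1 j)//=.
have -> : \sum_(i | i != j) swap j x ord0 i = \sum_(i | i != j) x ord0 i.
  by apply: eq_bigr => i; exact: swapS.
by ring.
Qed.

Let swap_bary j x i : exists i', bary (swap j x) i = bary x i'.
Proof.
case: (unliftP ord0 i) => [l|] ->; last by rewrite swap0; eexists.
have [->|lj] := eqVneq l j; first by rewrite baryS swapj; eexists.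
by exists (lift ord0 l); rewrite !baryS swapS.
Qed.

Let swapK j : involutive (swap j).
Proof.
move=> x; apply/rowP => i; have [->|ij] := eqVneq i j.
  by rewrite swapj swap0 baryS.
by rewrite !swapS.
Qed.

Let swap_ref j x : ref (swap j x) <-> ref x.
Proof.
split=> /refsimplexE h; apply/refsimplexE => i.
  by have [i' e] := swap_bary j (swap j x) i; rewrite swapK in e; rewrite e.
by have [i' ->] := swap_bary j x i.
Qed.

Let TT j : T j *m T j = 1%:M.
Proof.
apply/row_matrixP => i; rewrite !rowE mulmxA mulmx1.
have := swapK j (delta_mx ord0 i); rewrite /swap mulmxDl -addrA.
have := swapK j 0; rewrite /swap mul0mx add0r => ->.
by rewrite addr0.
Qed.

Lemma integrable_bary i : (leb n).-integrable ref (EFin \o (fun x => bary x i)).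
Proof.
have [mr br fr] := @refsimplex_facts R n.
apply: measurable_bounded_integrable => //.
  apply: measurable_funTS; case: (unliftP ord0 i) => [j|] ->.
    by under eq_fun do rewrite baryS; exact: measurable_coord.
  under eq_fun do rewrite bary0; apply: measurable_funB => //.
  by apply: measurable_sum => j; exact: measurable_coord.
exists 1; split => // M M1 x /refsimplexE x0 /=.
rewrite gtr0_norm// (le_trans _ (ltW M1))// -(sum_bary x) (bigD1 i)//= lerDl.
by apply: sumr_ge0 => l _; exact: ltW.
Qed.

Lemma ref_bary_eq i : \int[leb n]_(x in ref) bary x i = \int[leb n]_(x in ref) bary x ord0.
Proof.
case: (unliftP ord0 i) => [j|] -> //.
have [mr br fr] := @refsimplex_facts R n.
have uT : T j \in unitmx by have [] := mulmx1_unit (TT j).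
have dT : `|\det (T j)| = 1.
  have : \det (T j) ^+ 2 = 1 by rewrite expr2 -det_mulmx TT det1.
  by move=> /eqP; rewrite sqrf_eq1 => /orP[] /eqP ->; rewrite ?normrN normr1.
have i2 : (leb n).-integrable setT ((EFin \o (fun x => bary x ord0)) \_ ref).
  exact: ((@integrable_mkcond _ _ R (leb n) _ (EFin \o (fun x => bary x ord0)) mr).1 (integrable_bary ord0)).
have := int_affine (delta_mx ord0 j) uT i2; rewrite dT mul1e => h.
rewrite /Rintegral; congr fine; rewrite [RHS]integral_mkcond -h integral_mkcond.
apply: eq_integral => x _; rewrite !patchE -/(swap j x).
have -> : (swap j x \in ref) = (x \in ref).
  by apply/idP/idP; rewrite !inE => /swap_ref.
by case: ifP => // _ /=; rewrite swap0.
Qed.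

(** By the exchange of vertices all [n.+1] coordinates have the same integral, and they add up to
    one. *)
Lemma ref_bary i : \int[leb n]_(x in ref) bary x i = ref_volume / n.+1%:R.
Proof.
have [mr br fr] := @refsimplex_facts R n.
apply: (mulIf (x := n.+1%:R)); first by rewrite pnatr_eq0.
rewrite divfK ?pnatr_eq0// mulr_natr.
rewrite -[in LHS](card_ord n.+1) -sumr_const.
rewrite (eq_bigr (fun j => \int[leb n]_(x in ref) bary x j)); last first.
  by move=> l _; rewrite (ref_bary_eq i) [RHS](ref_bary_eq l).
rewrite /ref_volume /Rintegral.
rewrite (eq_integral (fun x => \sum_j (bary x j)%:E)%E); last first.
  by move=> x _; rewrite sumEFin sum_bary.
rewrite integral_sum//; last by move=> j; exact: integrable_bary.
rewrite sum_fine//; last first.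
by move=> j _; exact: (integrable_fin_num mr (integrable_bary j)).
Qed.

End ref_mean.

Lemma is_derive_coord (R : realType) k (x v : 'rV[R]_k) i :
  is_derive x v (fun y : 'rV[R]_k => y ord0 i) (v ord0 i).
Proof.
have H : h^-1 *: ((fun y : 'rV[R]_k => y ord0 i) (h *: v + x) - x ord0 i) @[h --> (0 : R)^'] --> v ord0 i.
  have Hc : (fun _ : R => v ord0 i) h @[h --> (0 : R)^'] --> v ord0 i by exact: cvg_cst.
  apply: cvg_trans Hc; apply: near_eq_cvg; near=> h.
  rewrite !mxE addrK /GRing.scale /= mulrA mulVf ?mul1r//.
  by near: h; exact: nbhs_dnbhs_neq.
split; first by apply/cvg_ex; exists (v ord0 i).
by apply: cvg_lim => //; exact: norm_hausdorff.
Unshelve. all: by end_near. Qed.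

Section volume.
Context {R : realType} {n : nat}.
Notation d := n.+1.
Notation pt := 'rV[R]_d.
Context {Om inner : set pt} {Ga : mesh n} {q : node Ga -> pt} {nu : cell Ga -> pt}.
Hypothesis I : interface Om inner q nu.
Context {Th : mesh d} {z : node Th -> pt}.
Hypotheses (cz : conforming z) (cov : Om `<=` carrier z) (bOm : bounded_set Om).

(** A point of [Om] in no open element has a vanishing barycentric coordinate, hence lies on one of
    finitely many hyperplanes. *)
Lemma ae_elt : {ae leb d, forall x, Om x -> exists K, osimplex (cpos z K) x}.
Proof.
have H : {ae leb d, forall x, forall K i, mbary (z := z) K x i != 0}.
  apply: (@filter_forall _ _ (fun K x => forall i, mbary (z := z) K x i != 0)
    (almost_everywhere (leb d))) => K.
  apply: (@filter_forall _ _ (fun i x => mbary (z := z) K x i != 0)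
    (almost_everywhere (leb d))) => i.
  have [w w0 wE] := mbary_affine cz K i.
  have H := ae_dot_neq (dot (cpos z K ord0) w - (i == ord0)%:R) w0.
  apply: filterS H => x; rewrite wE dotBl; apply: contra => /eqP h; apply/eqP; lra.
apply: filterS H => x x0 Ox; have [K _ hK] := cov Ox; exists K.
apply/(mbary_osimplex cz) => i; rewrite lt_def x0 /=.
by move/(mbary_hull cz) : hK; exact.
Qed.

Lemma sum_elt x K : osimplex (cpos z K) x -> \sum_K' \1_(osimplex (cpos z K')) x = 1 :> R.
Proof.
move=> Kx; rewrite (bigD1 K)//= indicE mem_set// big1 ?addr0// => K' KK'.
rewrite indicE memNset// => K'x; move/eqP : KK'; apply.
apply: (osimplex_unique cz Kx); apply: osimplex_hull => //.
exact: (conforming_vert_inj cz (s := K')).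
Qed.

Lemma int_simplex_coord s j : int_simplex (cpos q s) (fun x => x ord0 j) =
  `|nframe (nu := nu) (q := q) s| * (@ref_volume R n / d%:R) * \sum_i cpos q s i ord0 j.
Proof.
have [mr br fr] := @refsimplex_facts R n.
rewrite (int_simplexE I) -mulrA; congr (_ * _).
have ib i : (leb n).-integrable (@refsimplex R n) (fun x => (cpos q s i ord0 j * bary x i)%:E).
  under eq_fun do rewrite EFinM.
  by apply: integrableZl => //; exact: integrable_bary.
rewrite {1}/Rintegral.
rewrite (eq_integral (fun x => \sum_i (cpos q s i ord0 j * bary x i)%:E)%E); last first.
  move=> x _; rewrite bary_comb summxE sumEFin; congr EFin; apply: eq_bigr => i _.
  by rewrite mxE mulrC.
rewrite integral_sum// -sum_fine; last by move=> i _; exact: (integrable_fin_num mr (ib i)).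
rewrite mulr_sumr; apply: eq_bigr => i _; rewrite -(ref_bary i).
rewrite -[LHS]/(\int[leb n]_(x in @refsimplex R n) (cpos q s i ord0 j * bary x i)).
by rewrite RintegralZl//; [rewrite mulrC|exact: integrable_bary].
Qed.

Lemma int_elt (g : pt -> R) : (forall x K, osimplex (cpos z K) x -> inner x -> g x = 1) ->
  (forall x, ~ inner x -> g x = 0) -> \int[leb d]_x g x = fine (leb d inner).
Proof.
move=> g1 g0; have mi : measurable inner by apply: open_measurable_row; exact: inner_open I.
have [N [mN N0 hN]] := ae_elt.
rewrite /Rintegral (integral_null (g := fun x => (\1_inner x)%:E) mN N0).
  by rewrite integral_indic// setIT.
move=> x Nx; rewrite indicE; have [xi|xi] := pselect (inner x); last by rewrite g0// memNset.
have [K Kx] : exists K, osimplex (cpos z K) x.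
  apply: contrapT => h; apply: Nx; apply: hN => /= h2; apply: h; apply: h2.
  exact: (inner_inside I).
by rewrite (g1 _ _ Kx xi) mem_set.
Qed.

Lemma volume_coord j : fine (leb d inner) =
  \sum_s nu s ord0 j * int_simplex (cpos q s) (fun x => x ord0 j).
Proof.
have [C uC] := @complete_delta R n j.
have f1 : {within closure Om, continuous (fun x : pt => x ord0 j)}.
  by apply: continuous_subspaceT; exact: coord_continuous.
have f2 (K : cell Th) (x : pt) : is_derive x (delta_mx ord0 j) (fun x : pt => x ord0 j) (1 : R).
  by have := is_derive_coord x (delta_mx ord0 j) j; rewrite mxE !eqxx.
have f3 (K : cell Th) : continuous (fun x : pt => x ord0 j) by exact: coord_continuous.
have f4 (K : cell Th) : continuous (fun x : pt => 1 : R).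
  exact: cst_continuous.
have := divergence_direction I cz cov bOm uC f1 (fun _ _ _ => erefl) f2 f3 f4.
rewrite int_elt => [->|x K Kx ix|x ix].
- by apply: eq_bigr => s _; rewrite dot_delta.
- rewrite /pw_deriv indicE mem_set// mul1r.
  by under eq_bigr do rewrite mulr1; exact: sum_elt Kx.
- by rewrite /pw_deriv indicE memNset// mul0r.
Qed.

Definition orientation s : R := Num.sg (nframe (nu := nu) (q := q) s).

Lemma orientationE s v : `|nframe (nu := nu) (q := q) s| * dot v (nu s) = orientation s * \det (frame v q s).
Proof.
rewrite (det_frame I) /orientation [dot _ _ * _]mulrC mulrA; congr (_ * _).
by rewrite normrEsg mulrC.
Qed.

(** Adding [volume_coord] over the [d] directions produces [dot x (nu s)], which takes the same
    value at all [d] vertices of [s]. One vertex therefore represents them all, and one factor [d]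
    stays in the denominator. *)
Lemma volume_frame : fine (leb d inner) =
  @ref_volume R n / d%:R * \sum_s orientation s * \det (frame (cpos q s ord0) q s).
Proof.
have d0 : d%:R != 0 :> R by rewrite pnatr_eq0.
have := volume_coord; move: (fine (leb d inner)) => V VE.
apply: (mulIf d0); rewrite mulrAC divfK// mulr_natr -[in LHS](card_ord d) -sumr_const.
rewrite (eq_bigr (fun j => \sum_s `|nframe (nu := nu) (q := q) s| * (@ref_volume R n / d%:R) *
   \sum_i nu s ord0 j * cpos q s i ord0 j)); last first.
  move=> j _; rewrite (VE j); apply: eq_bigr => s _.
  by rewrite int_simplex_coord -mulr_sumr mulrCA !mulrA.
rewrite exchange_big mulr_sumr /=; apply: eq_bigr => s _.
rewrite -mulr_sumr exchange_big /=.
rewrite (eq_bigr (fun=> dot (cpos q s ord0) (nu s))); last first.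
  move=> i _; transitivity (dot (cpos q s i) (nu s)).
    by apply: eq_bigr => j _; rewrite mulrC.
  apply/eqP; rewrite -subr_eq0 -dotBl; apply/eqP.
  by apply: (hull_plane I (s := s)); apply: vertex_hull;
    exact: (conforming_vert_inj (interface_conforming I) (s := s)).
rewrite sumr_const card_ord mulrAC -orientationE -mulr_natr.
by field; rewrite addrC natr1.
Qed.

Lemma divergence_coord (j : 'I_d) (f : pt -> R) (P dP : cell Th -> pt -> R) :
  {within closure Om, continuous f} ->
  (forall K x, osimplex (cpos z K) x -> f x = P K x) ->
  (forall K x, is_derive x (delta_mx ord0 j : pt) (P K) (dP K x)) ->
  (forall K, continuous (P K)) -> (forall K, continuous (dP K)) ->
  \int[leb d]_x pw_deriv (inner := inner) (z := z) dP x =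
  \sum_s nu s ord0 j * int_simplex (cpos q s) f.
Proof.
move=> f1 f2 f3 f4 f5; have [C uC] := @complete_delta R n j.
rewrite (divergence_direction I cz cov bOm uC f1 f2 f3 f4 f5).
by apply: eq_bigr => s _; rewrite dot_delta.
Qed.

End volume.

(** * Polynomials as C^1 functions along a direction *)

Section polynomial_derivative.
Context {R : realType} {k : nat}.
Notation pt := 'rV[R]_k.+1.
Variable e : pt.

(** Required on the whole space: the polynomial of an element is continued beyond it, so that the
    fundamental theorem of calculus reaches the ends of a segment. *)
Definition C1_along (P : pt -> R) := exists dP : pt -> R,
  [/\ forall x, is_derive x e P (dP x), continuous dP & continuous P].

Lemma C1_cst c : C1_along (fun=> c).
Proof.
exists (fun=> 0); split; [|exact: cst_continuous|exact: cst_continuous].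
by move=> x; exact: is_derive_cst.
Qed.

Lemma C1_coord i : C1_along (fun x => x ord0 i).
Proof.
exists (fun=> e ord0 i); split; [|exact: cst_continuous|exact: coord_continuous].
by move=> x; exact: is_derive_coord.
Qed.

Lemma C1_add P Q : C1_along P -> C1_along Q -> C1_along (fun x => P x + Q x).
Proof.
move=> [dP [dP1 dP2 dP3]] [dQ [dQ1 dQ2 dQ3]]; exists (fun x => dP x + dQ x); split.
- by move=> x; exact: is_deriveD.
- by move=> x; exact: (cvgD (dP2 x) (dQ2 x)).
- by move=> x; exact: (cvgD (dP3 x) (dQ3 x)).
Qed.

Lemma C1_mul P Q : C1_along P -> C1_along Q -> C1_along (fun x => P x * Q x).
Proof.
move=> [dP [dP1 dP2 dP3]] [dQ [dQ1 dQ2 dQ3]].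
exists (fun x => P x * dQ x + Q x * dP x); split.
- by move=> x; exact: is_deriveM.
- by move=> x; exact: (cvgD (cvgM (dP3 x) (dQ2 x)) (cvgM (dQ3 x) (dP2 x))).
- by move=> x; exact: (cvgM (dP3 x) (dQ3 x)).
Qed.

Lemma C1_sum (I : Type) (r : seq I) (p : pred I) (F : I -> pt -> R) :
  (forall i, C1_along (F i)) -> C1_along (fun x => \sum_(i <- r | p i) F i x).
Proof.
move=> cF; elim: r => [|i r IH].
  by under eq_fun do rewrite big_nil; exact: C1_cst.
under eq_fun do rewrite big_cons.
by case: (p i) => //; apply: C1_add.
Qed.

Lemma C1_prod (I : Type) (r : seq I) (p : pred I) (F : I -> pt -> R) :
  (forall i, C1_along (F i)) -> C1_along (fun x => \prod_(i <- r | p i) F i x).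
Proof.
move=> cF; elim: r => [|i r IH].
  by under eq_fun do rewrite big_nil; exact: C1_cst.
under eq_fun do rewrite big_cons.
by case: (p i) => //; apply: C1_mul.
Qed.

Lemma C1_exp P m : C1_along P -> C1_along (fun x => P x ^+ m).
Proof.
move=> cP; elim: m => [|m IH]; first by under eq_fun do rewrite expr0; exact: C1_cst.
by under eq_fun do rewrite exprS; exact: C1_mul.
Qed.

Lemma polynomial_on_C1 m (A : set pt) f : polynomial_on m A f ->
  exists2 P, C1_along P & forall x, A x -> f x = P x.
Proof.
move=> [c cE]; eexists; last exact: cE.
apply: C1_sum => a; apply: C1_mul; first exact: C1_cst.
by apply: C1_prod => i; apply: C1_exp; exact: C1_coord.
Qed.

End polynomial_derivative.

(** * Flux of a continuous piecewise polynomial field *)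

Section flux.
Context {R : realType} {n : nat}.
Notation d := n.+1.
Notation pt := 'rV[R]_d.
Context {Om inner : set pt} {Ga : mesh n} {q : node Ga -> pt} {nu : cell Ga -> pt}.
Hypothesis I : interface Om inner q nu.
Context {Th : mesh d} {z : node Th -> pt}.
Hypotheses (cz : conforming z) (cov : Om `<=` carrier z) (bOm : bounded_set Om).

(** [divergence_coord] is applied to each component. On the skeleton [w] may fail to be
    differentiable, and [r] is known only almost everywhere, so the integrand is first replaced off
    a null set. *)
Lemma flux_divergence (w : pt -> pt) (r : pt -> R) : pw_polynomial Om z w ->
  {ae leb d, forall x, Om x -> r x = \1_inner x} ->
  intOm Om (fun x => divergence w x * r x) =
  intGa q (fun s x => dot (w x) (nu s) * 1).
Proof.
move=> [m hw] hr.
have wc i : {within closure Om, continuous (fun x => w x ord0 i)} by have [] := hw i.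
have /choice[P hP] (iK : 'I_d * cell Th) : exists P : pt -> R,
    C1_along (delta_mx ord0 iK.1 : pt) P /\ forall x, osimplex (cpos z iK.2) x -> w x ord0 iK.1 = P x.
  by have [_ /(_ iK.2)/polynomial_on_C1 H] := hw iK.1; have [P ? ?] := H (delta_mx ord0 iK.1); exists P.
have /choice[dP hdP] (iK : 'I_d * cell Th) : exists dP : pt -> R,
  [/\ forall x, is_derive x (delta_mx ord0 iK.1 : pt) (P iK) (dP x), continuous dP & continuous (P iK)].
  by have [[dP H] _] := hP iK; exists dP.
have dc i K : continuous (dP (i, K)) by have [_ + _] := hdP (i, K).
have Pc i K : continuous (P (i, K)) by have [_ _ +] := hdP (i, K).
have Pd i K x : is_derive x (delta_mx ord0 i : pt) (P (i, K)) (dP (i, K) x) by have [+ _ _] := hdP (i, K).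
have wP i K x : osimplex (cpos z K) x -> w x ord0 i = P (i, K) x by have [_ +] := hP (i, K); exact.
pose g i := pw_deriv (inner := inner) (z := z) (fun K => dP (i, K)).
have divE x K : osimplex (cpos z K) x -> divergence w x = \sum_i dP (i, K) x.
  move=> Kx; rewrite /divergence /mxtrace; apply: eq_bigr => i _; rewrite mxE /partial.
  have nE : \forall y \near x, w y ord0 i = P (i, K) y.
    have : nbhs x (osimplex (cpos z K)) by apply: open_nbhs_nbhs; split => //; exact: open_osimplex.
    by apply: filterS => y /wP ->.
  rewrite (near_eq_derive (delta_mx ord0 i : pt) nE).
  by have [_ ->] := Pd i K x.
have gi i : (leb d).-integrable setT (EFin \o g i).
  by apply: (integrable_pw_deriv I cz bOm).
have [N [mN N0 hN]] := filterI (ae_elt cz cov) hr.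
transitivity (\sum_i \int[leb d]_x g i x).
  rewrite /intOm /Rintegral integral_mkcond.
  rewrite (integral_null (g := fun x => \sum_i (g i x)%:E)%E mN N0).
    rewrite integral_sum//; rewrite sum_fine// => i _.
    exact: (integrable_fin_num measurableT (gi i)).
  move=> x Nx; rewrite sumEFin patchE; case: ifPn => xO; last first.
    congr EFin; apply/esym/big1 => i _; rewrite /g /pw_deriv indicE memNset ?mul0r//.
    by move=> /(inner_inside I) Ox; move: xO; rewrite mem_set.
  have [] : (Om x -> exists K, osimplex (cpos z K) x) /\ (Om x -> r x = \1_inner x).
    by apply: contrapT => h; apply: Nx; apply: hN => -[h1 h2]; exact: h.
  rewrite inE in xO; move=> /(_ xO)[K Kx] /(_ xO) rx.
  rewrite rx (divE _ _ Kx) mulr_suml; congr EFin; apply: eq_bigr => i _.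
  rewrite /g /pw_deriv mulrC; congr (_ * _).
  rewrite (bigD1 K)//= indicE mem_set// mul1r big1 ?addr0// => K' KK'.
  rewrite indicE memNset ?mul0r// => K'x; move/eqP : KK'; apply.
  apply: (osimplex_unique cz Kx); apply: osimplex_hull => //.
  exact: (conforming_vert_inj cz (s := K')).
transitivity (\sum_i \sum_s nu s ord0 i * int_simplex (cpos q s) (fun x => w x ord0 i)).
  by apply: eq_bigr => i _; exact: (divergence_coord I cz cov bOm (wc i) (wP i)).
rewrite exchange_big /intGa /=; apply: eq_bigr => s _.
have [mr _ _] := @refsimplex_facts R n.
rewrite (int_simplexE I) (eq_bigr (fun i => `|nframe (nu := nu) (q := q) s| *
  \int[leb n]_(x in @refsimplex R n) (nu s ord0 i * w (cpos q s ord0 + x *m edges (cpos q s)) ord0 i))); last first.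
  move=> i _; rewrite (int_simplexE I) mulrCA RintegralZl//.
  exact: (integrable_psi I bOm (wc i) s).
rewrite -mulr_sumr; congr (_ * _); rewrite /Rintegral.
have ii i : (leb n).-integrable (@refsimplex R n)
    (fun x => (nu s ord0 i * w (cpos q s ord0 + x *m edges (cpos q s)) ord0 i)%:E).
  under eq_fun do rewrite EFinM; apply: integrableZl => //.
  exact: (integrable_psi I bOm (wc i) s).
rewrite sum_fine; last by move=> i _; exact: (integrable_fin_num mr (ii i)).
rewrite -integral_sum//; congr fine; apply: eq_integral => x _.
rewrite sumEFin mulr1; congr EFin; apply: eq_bigr => i _; exact: mulrC.
Qed.
End flux.

(** * Derivatives in time *)

Section time_derivatives.
Context {R : realType} (T t : R).
Hypothesis tT : 0 < t <= T.
Notation F := (tfilter T t).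

#[local] Instance tfilter_filter : Filter F.
Proof. exact: within_filter. Qed.

Lemma tfilter_neq0 : \forall h \near F, h != 0.
Proof.
rewrite /tfilter /within /=; apply: filterS (nbhs_dnbhs_neq (0 : R)) => h h0 _.
exact: h0.
Qed.

Lemma tfilter_time : \forall h \near F, 0 < t + h <= T.
Proof. by rewrite /tfilter; exact: withinT. Qed.

Lemma tfilter_cvg0 : h @[h --> F] --> (0 : R).
Proof.
move=> B B0; rewrite /= /fmap /tfilter /within /=.
by apply: filterS (nbhs_dnbhs B0) => h.
Qed.

#[local] Instance tfilter_proper : ProperFilter F.
Proof.
apply: Build_ProperFilter_ex => B; rewrite /tfilter /within /= => hB.
move: hB => /nbhs_ballP[e /= e0 eB].
have /andP[t0 tT'] := tT.
(* A backward step is admissible at every time, including [T]; the bound [t / 2] keeps [t + h]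
   positive. *)
pose h : R := - (Num.min (e / 2) (t / 2)).
have m0 : 0 < Num.min (e / 2) (t / 2) by rewrite lt_min !divr_gt0.
exists h; apply: eB.
- rewrite -ball_normE /= sub0r normrN /h normrN gtr0_norm// gt_min.
  by apply/orP; left; rewrite ltr_pdivrMr// ltr_pMr// ltr1n.
- by rewrite /h oppr_eq0 gt_eqF.
- have m1 : Num.min (e / 2) (t / 2) <= t / 2 by rewrite ge_min lexx orbT.
  rewrite /h; apply/andP; split; lra.
Qed.

Implicit Types f g : R -> R.

Lemma is_tder_cvg f (l : R) : is_tder T f t l -> f (t + h) @[h --> F] --> f t.
Proof.
move=> fl.
have H : f t + h * tquot f t h @[h --> F] --> f t.
  rewrite -[X in _ --> X]addr0 -(mul0r l).
  by apply: cvgD; [exact: cvg_cst|apply: cvgM => //; exact: tfilter_cvg0].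
apply: cvg_trans H; apply: near_eq_cvg; apply: filterS tfilter_neq0 => h h0.
by rewrite /tquot /GRing.scale /= mulrA mulfV// mul1r subrKC.
Qed.

Lemma is_tder_cst (c : R) : is_tder T (fun=> c) t 0.
Proof.
rewrite /is_tder (_ : tquot _ t = fun=> 0); first exact: cvg_cst.
by apply/funext => h; rewrite /tquot subrr scaler0.
Qed.

Lemma is_tder_id : is_tder T (fun s : R => s) t 1.
Proof.
rewrite /is_tder; have Hc : (fun _ : R => (1 : R)) h @[h --> F] --> (1 : R) by exact: cvg_cst.
apply: cvg_trans Hc; apply: near_eq_cvg; apply: filterS tfilter_neq0 => h h0.
by rewrite /tquot addrAC subrr add0r /GRing.scale /= mulVf.
Qed.

Lemma is_tderD f g a b : is_tder T f t a -> is_tder T g t b ->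
  is_tder T (fun s => f s + g s) t (a + b).
Proof.
move=> fa gb; rewrite /is_tder.
rewrite (_ : tquot _ t = fun h => tquot f t h + tquot g t h); first exact: cvgD.
by apply/funext => h; rewrite /tquot -scalerDr opprD addrACA.
Qed.

Lemma is_tderM f g a b : is_tder T f t a -> is_tder T g t b ->
  is_tder T (fun s => f s * g s) t (a * g t + f t * b).
Proof.
move=> fa gb; rewrite /is_tder.
rewrite (_ : tquot _ t = fun h => tquot f t h * g (t + h) + f t * tquot g t h).
  apply: cvgD; first by apply: cvgM => //; exact: is_tder_cvg gb.
  by apply: cvgM => //; exact: cvg_cst.
by apply/funext => h; rewrite /tquot /GRing.scale /=; ring.
Qed.

Lemma is_tder_sum (I : Type) (r : seq I) (P : pred I) (f : I -> R -> R) (a : I -> R) :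
  (forall i, is_tder T (f i) t (a i)) ->
  is_tder T (fun s => \sum_(i <- r | P i) f i s) t (\sum_(i <- r | P i) a i).
Proof.
move=> fa; elim: r => [|i r IH].
  by rewrite big_nil; under eq_fun do rewrite big_nil; exact: is_tder_cst.
rewrite big_cons; under eq_fun do rewrite big_cons.
by case: (P i) => //; exact: is_tderD.
Qed.

Lemma is_tder_prod m (f : 'I_m -> R -> R) (a : 'I_m -> R) :
  (forall i, is_tder T (f i) t (a i)) ->
  is_tder T (fun s => \prod_i f i s) t (\sum_k \prod_i (if i == k then a i else f i t)).
Proof.
elim: m f a => [|m IH] f a fa.
  by rewrite big_ord0; under eq_fun do rewrite big_ord0; exact: is_tder_cst.
under eq_fun do rewrite big_ord_recl.
have := is_tderM (fa ord0) (IH (fun i => f (lift ord0 i)) (fun i => a (lift ord0 i)) (fun i => fa _)).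
congr (is_tder T _ t _); rewrite big_ord_recl; congr (_ + _).
  by rewrite big_ord_recl eqxx; congr (_ * _); apply: eq_bigr => i _.
rewrite mulr_sumr; apply: eq_bigr => k _; rewrite big_ord_recl (negbTE (neq_lift _ _)).
by congr (_ * _); apply: eq_bigr => i _; rewrite (inj_eq lift_inj).
Qed.

Definition setrow m l (A : 'M[R]_(m, l)) k (B : 'M[R]_(m, l)) : 'M[R]_(m, l) :=
  \matrix_(i, j) (if i == k then B i j else A i j).

(** Product rule in each term of the permutation expansion, regrouped by the differentiated row. *)
Lemma is_tder_det m (M : R -> 'M[R]_m) (M' : 'M[R]_m) :
  (forall i j, is_tder T (fun s => M s i j) t (M' i j)) ->
  is_tder T (fun s => \det (M s)) t (\sum_k \det (setrow (M t) k M')).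
Proof.
move=> MM'.
have -> : \sum_k \det (setrow (M t) k M') =
   \sum_(s : 'S_m) (-1) ^+ s * \sum_k \prod_i (if i == k then M' i (s i) else M t i (s i)).
  rewrite /determinant exchange_big /=; apply: eq_bigr => s _; rewrite mulr_sumr.
  by apply: eq_bigr => k _; congr (_ * _); apply: eq_bigr => i _; rewrite mxE.
apply: is_tder_sum => s.
have := is_tderM (is_tder_cst ((-1) ^+ s)) (@is_tder_prod m (fun i u => M u i (s i)) (fun i => M' i (s i)) (fun i => MM' _ _)).
by rewrite mul0r add0r.
Qed.

Lemma is_tder_unique f (a b : R) : is_tder T f t a -> is_tder T f t b -> a = b.
Proof. by apply: cvg_unique; exact: norm_hausdorff. Qed.

End time_derivatives.

(** * Determinants of the nodes of a simplex *)

Section frame_rows.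
Context {R : realType} {n : nat}.
Notation pt := 'rV[R]_n.+1.

Definition vmx (p : 'I_n.+1 -> pt) : 'M[R]_n.+1 := \matrix_i p i.

(** [frame] for a bare tuple of points, so that single vertices can be moved without a mesh. *)
Definition pframe (v : pt) (p : 'I_n.+1 -> pt) : 'M[R]_(1 + n) := col_mx v (edges p).

(** The matrix [L], of determinant one, adds the first row to all others and turns edges back into
    vertices. *)
Lemma det_vmx p : \det (vmx p) = \det (pframe (p ord0) p).
Proof.
pose L : 'M[R]_(1 + n) := block_mx 1%:M 0 (const_mx 1) 1%:M.
have -> : vmx p = L *m pframe (p ord0) p.
  rewrite /L /pframe /block_mx mul_col_mx !mul_row_col mul1mx mul0mx addr0 mul1mx.
  apply/matrixP => i k; rewrite mxE.
  case: (@splitP 1 n i) => j ij.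
    have -> : i = lshift n j by apply/val_inj.
    rewrite (@col_mxEu R 1 n n.+1 (p ord0) (const_mx 1 *m p ord0 + edges p) j k) ord1.
    by congr (p _ _ _); apply/val_inj.
  have -> : i = rshift 1 j by apply/val_inj.
  rewrite (@col_mxEd R 1 n n.+1 (p ord0) (const_mx 1 *m p ord0 + edges p) j k).
  rewrite !mxE big_ord1 !mxE mul1r addrC.
  have -> : rshift 1 j = lift ord0 j by apply/val_inj.
  by rewrite subrK.
have dL : \det L = 1 by rewrite /L (@det_lblock R 1 n) !det1 mul1r.
exact: etrans (@det_mulmx R (1 + n) L (pframe (p ord0) p)) (etrans (congr1 (fun x => x * _) dL) (mul1r _)).
Qed.

Lemma det_pframe_lin (v w : pt) (a b : R) p :
  \det (pframe (a *: v + b *: w) p) = a * \det (pframe v p) + b * \det (pframe w p).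
Proof.
apply: (determinant_multilinear (i0 := lshift n ord0)).
- by rewrite !rowKu linearP /= linearZ.
- by rewrite /pframe !row'Ku; apply: (congr2 (@col_mx R 0 n n.+1)) => //; apply/matrixP => -[].
- by rewrite /pframe !row'Ku; apply: (congr2 (@col_mx R 0 n n.+1)) => //; apply/matrixP => -[].
Qed.

(* Both sides are the derivative at s = 1 of det (p i + (s - 1) v)_i. *)
Lemma det_pframe_rows (v : pt) p :
  \det (pframe v p) = \sum_k \det (setrow (vmx p) k (vmx (fun=> v))).
Proof.
have t1 : (0 : R) < (1 : R) <= (1 : R) by rewrite ltr01 lexx.
pose f (s : R) := \det (vmx (fun i => p i + (s - 1) *: v)).
apply: (is_tder_unique t1 (f := f)).
  have -> : f = fun s => \det (pframe (p ord0) p) + (s + - 1) * \det (pframe v p).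
    apply/funext => s; rewrite /f det_vmx.
    have -> : pframe (p ord0 + (s - 1) *: v) (fun i => p i + (s - 1) *: v) =
              pframe (1 *: p ord0 + (s - 1) *: v) p.
      rewrite /pframe scale1r; congr col_mx; apply/row_matrixP => i; rewrite !rowK.
      by rewrite opprD addrACA subrr addr0.
    by rewrite det_pframe_lin mul1r.
  have id1 := @is_tder_id R 1 1.
  have := is_tderD (is_tder_cst 1 1 (\det (pframe (p ord0) p)))
    (is_tderM (is_tderD id1 (is_tder_cst 1 1 (-1))) (is_tder_cst 1 1 (\det (pframe v p)))).
  by rewrite subrr mul0r !add0r !addr0 mul1r.
have := @is_tder_det R 1 1 n.+1 (fun s => vmx (fun i => p i + (s - 1) *: v)) (vmx (fun=> v)).
have -> : vmx (fun i => p i + (1 - 1) *: v) = vmx p.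
  by congr vmx; apply/funext => i; rewrite subrr scale0r addr0.
apply => i j.
have id1 := @is_tder_id R 1 1.
have := is_tderD (is_tder_cst 1 1 (p i ord0 j))
    (is_tderM (is_tderD id1 (is_tder_cst 1 1 (-1))) (is_tder_cst 1 1 (v ord0 j))).
rewrite subrr mul0r !add0r !addr0 mul1r mxE.
by congr is_tder; apply/funext => s; rewrite !mxE.
Qed.

End frame_rows.

(** * Orientations are locally constant in time *)

Section matrix_limits.
Context {R : realType} (F : set_system R) {FF : Filter F}.

Definition mcvg m l (A : R -> 'M[R]_(m, l)) (L : 'M[R]_(m, l)) :=
  forall i j, A h i j @[h --> F] --> L i j.

Lemma mcvg_mul m l k (A : R -> 'M[R]_(m, l)) (B : R -> 'M[R]_(l, k)) LA LB :
  mcvg A LA -> mcvg B LB -> mcvg (fun h => A h *m B h) (LA *m LB).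
Proof.
move=> cA cB i j; rewrite mxE; under eq_fun do rewrite mxE.
by apply: (@cvg_sumr R R^o _ _ FF) => a _; apply: cvgM; [exact: cA|exact: cB].
Qed.

Lemma mcvg_det m (A : R -> 'M[R]_m) L : mcvg A L -> \det (A h) @[h --> F] --> \det L.
Proof.
move=> cA; rewrite /determinant.
apply: (@cvg_sumr R R^o _ _ FF) => s _; apply: cvgM; first exact: cvg_cst.
by apply: (@cvg_prodr R _ _ FF) => i _; exact: cA.
Qed.

Lemma mcvg_inv m (A : R -> 'M[R]_m) L : L \in unitmx -> mcvg A L ->
  mcvg (fun h => invmx (A h)) (invmx L).
Proof.
move=> uL cA i j; have dA := mcvg_det cA.
have L0 : \det L != 0 by rewrite -unitfE -unitmxE.
have cadj : (\det (A h))^-1 * (\adj (A h)) i j @[h --> F] --> (\det L)^-1 * (\adj L) i j.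
  apply: cvgM; first exact: cvgV.
  rewrite mxE /cofactor; under eq_fun do rewrite mxE /cofactor.
  apply: cvgM; first exact: cvg_cst.
  by apply: mcvg_det => a b; rewrite !mxE; under eq_fun do rewrite !mxE; exact: cA.
rewrite /invmx uL mxE; apply: cvg_trans cadj; apply: near_eq_cvg.
have H : \forall h \near F, \det (A h) != 0 by exact: (@cvgr_neq0 R R^o R F FF _ _ dA L0).
apply: filterS H => h h0.
by rewrite unitmxE unitfE h0 [in RHS]mxE.
Qed.

Lemma near_sg (f : R -> R) l : l != 0 -> f h @[h --> F] --> l ->
  \forall h \near F, Num.sg (f h) = Num.sg l.
Proof.
move=> l0 fl; move: l0; rewrite neq_lt => /orP[l0|l0].
  have H : \forall h \near F, f h < 0 by exact: (cvgr_lt _ fl).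
  by apply: filterS H => h h0; rewrite !ltr0_sg.
have H : \forall h \near F, 0 < f h by exact: (cvgr_gt _ fl).
by apply: filterS H => h h0; rewrite !gtr0_sg.
Qed.

End matrix_limits.

(** Induction on the list: where [g i] vanishes, a small step towards a point where it does not
    vanish makes it nonzero, and openness of [U] absorbs the step. *)
Lemma avoid_zeros (R : realType) k (I : eqType) (l : seq I) (g : I -> 'rV[R]_k -> R) (U : set 'rV[R]_k) :
  (forall i, continuous (g i)) ->
  (forall i x y t, g i (x + t *: (y - x)) = g i x + t * (g i y - g i x)) ->
  (forall i, exists x, g i x != 0) -> open U -> U !=set0 ->
  exists2 x, U x & forall i, i \in l -> g i x != 0.
Proof.
move=> cg ag g0; elim: l U => [|i l IH] U oU [x0 Ux0]; first by exists x0.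
have oU' : open (U `&` [set x | g i x != 0]).
  apply: openI => //.
  apply: (@open_comp _ _ (g i) [set y | y != 0]); last exact: open_neq.
  by move=> x _; exact: cg.
have [|x [Ux gx] hx] := IH _ oU'; last first.
  by exists x => // j; rewrite inE => /orP[/eqP -> //|]; exact: hx.
have [gx0|gx0] := eqVneq (g i x0) 0; last by exists x0.
have [y gy] := g0 i.
have cv : x0 + t *: (y - x0) @[t --> (0 : R)] --> x0.
  rewrite -[X in _ --> X]addr0 -(scale0r (y - x0)).
  by apply: cvgD; [exact: cvg_cst|apply: cvgZ; [exact: cvg_id|exact: cvg_cst]].
have H1 : \forall t \near (0 : R)^', U (x0 + t *: (y - x0)).
  by apply: nbhs_dnbhs; exact: (cv _ (open_nbhs_nbhs (conj oU Ux0))).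
have H2 : \forall t \near (0 : R)^', t != 0 by exact: nbhs_dnbhs_neq.
have H : \forall t \near (0 : R)^', U (x0 + t *: (y - x0)) /\ t != 0.
  by apply: filterI; [exact: H1|exact: H2].
have [t [Ut t0]] := @filter_ex _ _ (Proper_dnbhs_numFieldType (0 : R)) _ H.
exists (x0 + t *: (y - x0)); split => //=.
by rewrite ag gx0 add0r subr0 mulf_neq0.
Qed.

Lemma dnbhs_left_near (R : realType) (r0 : R) (P : R -> Prop) :
  (\forall r \near r0^', P r) -> \forall r \near r0^'-, P r.
Proof.
move=> H; apply: (@filterS _ (nbhs r0) _ (fun r => r != r0 -> P r) _ _ H) => r h rr; apply: h.
by rewrite lt_eqF.
Qed.

Section sign_of_crossing.
Context {R : realType} {n : nat}.
Notation d := n.+1.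
Notation pt := 'rV[R]_d.
Context {Om inner : set pt} {Ga : mesh n} {q : node Ga -> pt} {nu : cell Ga -> pt}.
Hypothesis I : interface Om inner q nu.
Hypothesis bOm : bounded_set Om.
Variables (e : pt) (C : 'M[R]_(n, d)).
Hypothesis e0 : e != 0.

(** Just before the crossing, [inner_below] equates the indicator of the phase with minus the
    accumulated signs. There the phase is inner exactly when the line is about to leave, that is
    when the sign is 1; so the sign is twice the indicator minus one. *)
Lemma sg_crossing y s : generic (q := q) e C y -> crosses e C q s y ->
  Num.sg (dot e (nu s)) = - 1 - 2 * below e C (q := q) y (fun s => Num.sg (dot e (nu s))) (height e C q s y).
Proof.
move=> gy cs; set w := fun s => _; set r0 := height e C q s y.
have [B hB] := line_bounded bOm C e0 y.
have nin r : r < - B -> ~ inner (line e C y r).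
  move=> rB /(inner_inside I)/hB; apply/negP; rewrite -leNgt.
  by rewrite -normrN (le_trans _ (ler_norm _))// lerNr ltW.
have H1 := below_near (q := q) e C y w r0.
have H2 := nbhs_dnbhs (line_inner_cross I cs).
have H3 : \forall r \near r0^', forall s', r != height e C q s' y.
  apply: (@filter_forall _ _ (fun s' r => r != height e C q s' y) (r0^')) => s'.
  have [<-|] := eqVneq r0 (height e C q s' y); first exact: nbhs_dnbhs_neq.
  rewrite neq_lt => /orP[h|h]; apply: nbhs_dnbhs.
    by apply: filterS (lt_nbhsl h) => r; rewrite neq_lt => ->.
  by apply: filterS (lt_nbhsr h) => r; rewrite neq_lt orbC => ->.
have L1 := dnbhs_left_near H1; have L2 := dnbhs_left_near H2; have L3 := dnbhs_left_near H3.
have L4 : \forall r \near r0^'-, r < r0 by exact: withinT.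
have H : \forall r \near r0^'-, [/\ r < r0, below e C (q := q) y w r = below e C (q := q) y w r0,
    inner (line e C y r) <-> 0 < dot e (nu s) & forall s', r != height e C q s' y].
  near=> r; have rr : r < r0 by near: r.
  split => //.
  - suff -> : below e C (q := q) y w r = below e C (q := q) y w r0 +
        (if r0 < r then \sum_(s0 | crosses e C q s0 y && (height e C q s0 y == r0)) w s0 else 0).
      by rewrite ltNge (ltW rr) /= addr0.
    by near: r.
  - suff : (r < height e C q s y -> (inner (line e C y r) <-> 0 < dot e (nu s))) /\
      (height e C q s y < r -> (inner (line e C y r) <-> dot e (nu s) < 0)) by move=> [/(_ rr)].
    by near: r.
  - by near: r.
have [r [rr br ir nr]] := @filter_ex _ _ (at_left_proper_filter r0) _ H.
have free s' : ~ hull q (verts s') (line e C y r).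
  by move=> /(hull_line I gy)[_ rh]; move: (nr s'); rewrite rh eqxx.
have := inner_below I gy nin free; rewrite br -/w => ib.
have uK : dot e (nu s) != 0 by move: cs => /andP[]; rewrite (frame_normal I).
have [ev|ev|ev] := ltrgtP (dot e (nu s)) 0; last by rewrite ev eqxx in uK.
  rewrite ltr0_sg//; move: ib; rewrite indicE memNset; last by move=> /ir; rewrite ltNge (ltW ev).
  by move=> /eqP; rewrite eq_sym oppr_eq0 => /eqP ->; rewrite mulr0 subr0.
rewrite gtr0_sg//; move: ib; rewrite indicE mem_set; last exact/ir.
by move=> ib1; rewrite -[X in 2 * X]opprK -ib1 /=; ring.
Unshelve. all: by end_near. Qed.
End sign_of_crossing.

Section persistence.
Context {R : realType} {n : nat}.
Notation d := n.+1.
Notation pt := 'rV[R]_d.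
Context {Om inner : set pt} {Ga : mesh n} {q : node Ga -> pt} {nu : cell Ga -> pt}.
Hypothesis I : interface Om inner q nu.
Hypothesis bOm : bounded_set Om.

Lemma bary_affine (c c' : 'rV[R]_n) t i :
  bary (c + t *: (c' - c)) i = bary c i + t * (bary c' i - bary c i).
Proof.
case: (unliftP ord0 i) => [j|] ->; first by rewrite !baryS !mxE.
rewrite !bary0; under eq_bigr do rewrite !mxE.
by rewrite big_split/= -mulr_sumr sumrB; ring.
Qed.

Lemma foot_affine e C s (y y' : 'rV[R]_n) t :
  foot e C q s (y + t *: (y' - y)) = foot e C q s y + t *: (foot e C q s y' - foot e C q s y).
Proof. by rewrite !footE mulmxDl -scalemxAl mulmxBl opprD addrACA subrr addr0 addrAC. Qed.

Lemma continuous_bary_foot e C s i : continuous (fun y => bary (foot e C q s y) i).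
Proof.
have cf j : continuous (fun y => foot e C q s y ord0 j).
  have -> : (fun y => foot e C q s y ord0 j) = fun y =>
      \sum_i y ord0 i * footmx (q := q) e C s i j + footv (q := q) e s ord0 j.
    by apply/funext => y; rewrite footE 2!mxE.
  move=> y; apply: (@cvgD R R^o _ (nbhs y)); last exact: cvg_cst.
  apply: (@cvg_sumr R R^o _ _ (nbhs_filter y)) => l _.
  by apply: (@cvgM R _ (nbhs y)); [exact: coord_continuous|exact: cvg_cst].
case: (unliftP ord0 i) => [j|] ->; first by under eq_fun do rewrite baryS; exact: cf.
have -> : (fun y => bary (foot e C q s y) ord0) = fun y => 1 - \sum_j foot e C q s y ord0 j.
  by apply/funext => y; rewrite bary0.
move=> y; apply: (@cvgB R R^o _ (nbhs y)); first exact: cvg_cst.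
apply: (@cvg_sumr R R^o _ _ (nbhs_filter y)) => j _; exact: cf.
Qed.

(** A direction parallel to no simplex is chosen, then a line through the point of [s0] with all
    barycentric coordinates [d%:R^-1], perturbed within the interior of [s0]. With the edges of [s0]
    as [C], every [foot] map is surjective, so none of the conditions fails identically. *)
Lemma generic_line (s0 : cell Ga) : exists e C y,
  [/\ e != 0, forall s, frame e q s \in unitmx,
      forall s i, bary (foot e C q s y) i != 0
    & forall i, 0 < bary (foot e C q s0 y) i].
Proof.
have [|||||e _ he] := @avoid_zeros R d (cell Ga) (enum (cell Ga)) (fun s x => dot x (nu s)) setT.
- by move=> s; exact: continuous_dot.
- by move=> s x y t; rewrite dotDl dotZl dotBl.
- by move=> s; exists (nu s); rewrite (normal_unit I) oner_eq0.
- exact: openT.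
- by exists 0.
have uK s : frame e q s \in unitmx by rewrite (frame_normal I) he// mem_enum.
pose C := edges (cpos q s0).
have surj s c : exists y, foot e C q s y = c.
  have uF : footmx (q := q) e C s \in unitmx.
    have : \det (col_mx e C : 'M[R]_(1 + n)) != 0 by rewrite -unitfE -unitmxE (uK s0).
    by rewrite (det_footmx _ (uK s)) mulf_eq0 negb_or unitmxE unitfE => /andP[].
  by exists ((c - footv (q := q) e s) *m invmx (footmx (q := q) e C s)); rewrite footE mulmxKV// subrK.
have [y0 hy0] := surj s0 (const_mx d%:R^-1).
have b0 i : bary (const_mx d%:R^-1 : 'rV[R]_n) i = d%:R^-1.
  case: (unliftP ord0 i) => [j|] ->; first by rewrite baryS mxE.
  rewrite bary0; under eq_bigr do rewrite mxE.
  rewrite sumr_const card_ord -[_ *+ n]mulr_natl -natr1; field.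
  by rewrite natr1 pnatr_eq0.
have d0 : d%:R^-1 != 0 :> R by rewrite invr_eq0 pnatr_eq0.
have [|||||y Uy hy] := @avoid_zeros R n (cell Ga * 'I_d)%type (enum {: cell Ga * 'I_d})
    (fun si y => bary (foot e C q si.1 y) si.2) [set y | forall i, 0 < bary (foot e C q s0 y) i].
- by move=> [s i]; exact: continuous_bary_foot.
- by move=> [s i] x y t; rewrite foot_affine bary_affine.
- by move=> [s i]; have [y hy] := surj s (const_mx d%:R^-1); exists y; rewrite hy b0.
- rewrite openE => y Uy.
  apply: (@filter_forall _ _ (fun i y => 0 < bary (foot e C q s0 y) i) (nbhs y)) => i.
  have c := @continuous_bary_foot e C s0 i y.
  exact: (cvgr_gt _ c _ (Uy i)).
- by exists y0 => i; rewrite /= hy0 b0 invr_gt0 ltr0n.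
exists e, C, y; split => //.
- apply/eqP => e0; have := uK s0; rewrite (frame_normal I) e0.
  by rewrite dot0l eqxx.
- by move=> s i; apply: (hy (s, i)); rewrite mem_enum.
Qed.

Context (F : set_system R) {FF : Filter F}.
Context (innerh : R -> set pt) (qh : R -> node Ga -> pt) (nuh : R -> cell Ga -> pt).
Hypothesis Ih : \forall h \near F, interface Om (innerh h) (qh h) (nuh h).
Hypothesis cq : forall v j, qh h v ord0 j @[h --> F] --> q v ord0 j.

Lemma mcvg_edges s : mcvg F (fun h => edges (cpos (qh h) s)) (edges (cpos q s)).
Proof.
move=> i j; rewrite !mxE; under eq_fun do rewrite !mxE.
by apply: cvgB; exact: cq.
Qed.

Lemma mcvg_frame e s : mcvg F (fun h => frame e (qh h) s) (frame e q s).
Proof.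
move=> i j; rewrite /frame mxE; under eq_fun do rewrite mxE.
case: (fintype.split i) => k; first exact: cvg_cst.
exact: mcvg_edges.
Qed.

Lemma mcvg_lcoord e C s y : frame e q s \in unitmx ->
  mcvg F (fun h => lcoord e C (qh h) s y) (lcoord e C q s y).
Proof.
move=> uK; apply: mcvg_mul; last by apply: mcvg_inv => //; exact: mcvg_frame.
move=> i j; rewrite !mxE ord1; under eq_fun do rewrite !mxE.
by apply: cvgB; [exact: cvg_cst|exact: cq].
Qed.

Lemma cvg_bary_foot e C s y i : frame e q s \in unitmx ->
  bary (foot e C (qh h) s y) i @[h --> F] --> bary (foot e C q s y) i.
Proof.
move=> uK; have cf j : foot e C (qh h) s y ord0 j @[h --> F] --> foot e C q s y ord0 j.
  by rewrite mxE; under eq_fun do rewrite mxE; exact: mcvg_lcoord.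
case: (unliftP ord0 i) => [j|] ->; first by rewrite baryS; under eq_fun do rewrite baryS; exact: cf.
rewrite bary0; under eq_fun do rewrite bary0.
apply: cvgB; first exact: cvg_cst.
by apply: (@cvg_sumr R R^o _ _ FF) => j _; exact: cf.
Qed.

(** A line generic for [q] remains generic for nearby nodes, with the same crossings in the same
    order: these are finitely many strict inequalities between continuous functions of the nodes.
    The phases and normals enter only through [sg_crossing]. *)
Lemma orientation_persists : \forall h \near F, forall s,
  orientation (nu := nuh h) (q := qh h) s = orientation (nu := nu) (q := q) s.
Proof.
apply: (@filter_forall _ _ (fun s h => orientation (nu := nuh h) (q := qh h) s =
  orientation (nu := nu) (q := q) s) F) => s0.
have [e [C [y [e0 uK by0 bs0]]]] := generic_line s0.
have H1 : \forall h \near F, forall s, Num.sg (\det (frame e (qh h) s)) = Num.sg (\det (frame e q s)).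
  apply: (@filter_forall _ _ (fun s h => Num.sg (\det (frame e (qh h) s)) = Num.sg (\det (frame e q s))) F) => s.
  apply: near_sg; first by rewrite -unitfE -unitmxE.
  by apply: mcvg_det; exact: mcvg_frame.
have H2 : \forall h \near F, forall s i, Num.sg (bary (foot e C (qh h) s y) i) = Num.sg (bary (foot e C q s y) i).
  apply: (@filter_forall _ _ (fun s h => forall i, Num.sg (bary (foot e C (qh h) s y) i) = Num.sg (bary (foot e C q s y) i)) F) => s.
  apply: (@filter_forall _ _ (fun i h => Num.sg (bary (foot e C (qh h) s y) i) = Num.sg (bary (foot e C q s y) i)) F) => i.
  by apply: near_sg; [exact: by0|exact: cvg_bary_foot].
have H3 : \forall h \near F, forall s s', height e C q s y < height e C q s' y ->
    height e C (qh h) s y < height e C (qh h) s' y.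
  apply: (@filter_forall _ _ (fun s h => forall s', height e C q s y < height e C q s' y ->
    height e C (qh h) s y < height e C (qh h) s' y) F) => s.
  apply: (@filter_forall _ _ (fun s' h => height e C q s y < height e C q s' y ->
    height e C (qh h) s y < height e C (qh h) s' y) F) => s'.
  have [ss'|ss'] := ltP (height e C q s y) (height e C q s' y); last by apply: nearW => h.
  have cB : height e C (qh h) s' y - height e C (qh h) s y @[h --> F] --> height e C q s' y - height e C q s y.
    by apply: cvgB; apply: cvgN; exact: mcvg_lcoord.
  have H : \forall h \near F, 0 < height e C (qh h) s' y - height e C (qh h) s y.
    by apply: (cvgr_gt _ cB); rewrite subr_gt0.
  by apply: filterS H => h; rewrite subr_gt0.
near=> h.
have Hh : interface Om (innerh h) (qh h) (nuh h) by near: h.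
have K1 : forall s, Num.sg (\det (frame e (qh h) s)) = Num.sg (\det (frame e q s)) by near: h.
have K2 : forall s i, Num.sg (bary (foot e C (qh h) s y) i) = Num.sg (bary (foot e C q s y) i) by near: h.
have K3 : forall s s', height e C q s y < height e C q s' y ->
    height e C (qh h) s y < height e C (qh h) s' y by near: h.
have uKh s : frame e (qh h) s \in unitmx.
  by rewrite unitmxE unitfE -sgr_eq0 K1 sgr_eq0 -unitfE -unitmxE.
have cE s : crosses e C (qh h) s y = crosses e C q s y.
  rewrite /crosses uK uKh /=; apply: eq_forallb => i.
  by rewrite -sgr_gt0 K2 sgr_gt0.
have g : generic (q := q) e C y by move=> s; rewrite uK => i; exact: by0.
have gh : generic (q := qh h) e C y.
  by move=> s; rewrite uKh => i; rewrite -sgr_eq0 K2 sgr_eq0 by0.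
have hE s s' : crosses e C q s y -> crosses e C q s' y ->
    (height e C (qh h) s y < height e C (qh h) s' y) = (height e C q s y < height e C q s' y).
  move=> cs cs'; have [ss'|ss'|ss'] := ltgtP (height e C q s y) (height e C q s' y).
  - exact: K3.
  - by apply/negbTE; rewrite -leNgt ltW// K3.
  - by rewrite (cross_inj I cs cs' ss') ltxx.
(* Induction on the number of crossings below [s], on whose signs alone both instances of
   [sg_crossing] depend. *)
have sgE N s : (#|[pred s' | crosses e C q s' y && (height e C q s' y < height e C q s y)%R]| < N)%N ->
    crosses e C q s y -> Num.sg (dot e (nuh h s)) = Num.sg (dot e (nu s)).
  elim: N s => // N IH s cN cs.
  rewrite (sg_crossing I bOm e0 g cs) (sg_crossing Hh bOm e0 gh) ?cE//.
  congr (_ - 2 * _); rewrite /below; apply: eq_big => s'.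
    by rewrite cE; case cs' : (crosses e C q s' y) => //=; exact: hE.
  rewrite cE => /andP[cs']; rewrite hE// => ss'; apply: IH => //.
  rewrite ltnS in cN; apply: leq_trans cN; apply: proper_card; apply/properP; split.
    apply/fintype.subsetP => a; rewrite !inE => /andP[-> /=] /lt_trans; exact.
  by exists s'; rewrite !inE ?cs' ?ss'// ltxx.
have cs0 : crosses e C q s0 y by rewrite /crosses uK; apply/forallP.
(* The persistent sign of the frame determinant is the crossing sign times the orientation; the
   crossing sign cancels. *)
have := K1 s0; rewrite (det_frame I) (det_frame Hh) !sgrM (sgE _ _ (leqnn _) cs0).
apply: mulfI; rewrite sgr_eq0; by rewrite -(frame_normal I).
Unshelve. all: by end_near. Qed.

End persistence.

(** * Neighbouring simplices induce opposite orientations on their common face *)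

Section frame_algebra.
Context {R : realType} {n : nat}.
Notation pt := 'rV[R]_n.+1.
Implicit Types p : 'I_n.+1 -> pt.

Definition upd p j (x : pt) : 'I_n.+1 -> pt := fun i => if i == j then x else p i.

Lemma upd_id p j : upd p j (p j) = p.
Proof. by apply/funext => i; rewrite /upd; case: eqP => [->|]. Qed.

(** Reduces frames to node determinants, for which the effect of moving or permuting nodes is
    immediate. *)
Lemma det_pframe_diff v p :
  \det (pframe v p) = \det (vmx (fun i => p i + v)) - \det (vmx p).
Proof.
rewrite !det_vmx.
have -> : pframe (p ord0 + v) (fun i => p i + v) = pframe (1 *: p ord0 + 1 *: v) p.
  rewrite /pframe !scale1r; congr col_mx; apply/row_matrixP => i; rewrite !rowK.
  by rewrite opprD addrACA subrr addr0.
by rewrite det_pframe_lin !mul1r addrAC subrr add0r.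
Qed.

Lemma det_vmx_upd p j a b x y : \det (vmx (upd p j (a *: x + b *: y))) =
  a * \det (vmx (upd p j x)) + b * \det (vmx (upd p j y)).
Proof.
have off w w' : row' j (vmx (upd p j w)) = row' j (vmx (upd p j w')).
  by apply/row_matrixP => i; rewrite !row'Esub /= !row_rowsub !rowK /upd eq_sym (negbTE (neq_lift _ _)).
apply: (determinant_multilinear (i0 := j)); [|exact: off|exact: off].
by rewrite !rowK /upd !eqxx.
Qed.

Lemma det_pframe_upd v p j x y z t :
  \det (pframe v (upd p j (x + t *: (y - z)))) =
  \det (pframe v (upd p j x)) + t * (\det (pframe v (upd p j y)) - \det (pframe v (upd p j z))).
Proof.
have shift w : (fun i => upd p j w i + v) = upd (fun i => p i + v) j (w + v).
  by apply/funext => i; rewrite /upd; case: eqP.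
have lin3 (p' : 'I_n.+1 -> pt) (a b c : pt) : \det (vmx (upd p' j (a + t *: (b - c)))) =
    \det (vmx (upd p' j a)) + t * (\det (vmx (upd p' j b)) - \det (vmx (upd p' j c))).
  have -> : a + t *: (b - c) = 1 *: a + t *: (1 *: b + (-1) *: c) by rewrite !scale1r scaleN1r.
  by rewrite !det_vmx_upd; ring.
rewrite !det_pframe_diff !shift.
have -> : x + t *: (y - z) + v = (x + v) + t *: ((y + v) - (z + v)).
  by rewrite opprD addrACA subrr addr0 addrAC.
by rewrite !lin3; ring.
Qed.

Lemma det_vmx_perm p (g : {perm 'I_n.+1}) :
  \det (vmx (fun i => p (g i))) = (-1) ^+ g * \det (vmx p).
Proof.
rewrite -det_perm -det_mulmx -row_permE; congr determinant.
by apply/matrixP => i k; rewrite !mxE.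
Qed.

Lemma det_pframe_perm v p (g : {perm 'I_n.+1}) :
  \det (pframe v (fun i => p (g i))) = (-1) ^+ g * \det (pframe v p).
Proof. by rewrite !det_pframe_diff (det_vmx_perm (fun i => p i + v)) det_vmx_perm mulrBr. Qed.

Lemma det_pframe0 v p t (b : 'I_n.+1 -> R) : (exists i, b i != 0) ->
  \sum_i b i = 0 -> t *: v + \sum_i b i *: p i = 0 -> \det (pframe v p) = 0.
Proof.
move=> [i bi] b0 E; apply/eqP/det0P.
exists (row_mx t%:M (\row_k b (lift ord0 k)) : 'rV_(1 + n)).
  apply: contraNneq bi => u0.
  have bS k : b (lift ord0 k) = 0.
    by have := congr1 (fun u : 'rV_(1 + n) => rsubmx u ord0 k) u0; rewrite row_mxKr !mxE.
  case: (unliftP ord0 i) => [k|] ->; first by rewrite bS.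
  by move: b0; rewrite big_ord_recl big1 ?addr0// => ->.
rewrite /pframe mul_row_col mul_scalar_mx mulmx_edges; apply: etrans E; congr (_ + _).
rewrite [RHS]big_ord_recl; under eq_bigr do rewrite mxE scalerBr.
rewrite sumrB -scaler_suml addrC; congr (_ + _); rewrite -scaleNr; congr (_ *: _).
by move: b0; rewrite big_ord_recl => /eqP; rewrite addr_eq0 => /eqP.
Qed.

End frame_algebra.

Lemma near_ray (R : realType) k (x w : 'rV[R]_k) (P : 'rV[R]_k -> Prop) :
  (\forall z \near x, P z) -> \forall h \near (0 : R)^'+, P (x + h *: w).
Proof.
move=> H.
have cv : x + h *: w @[h --> (0 : R)^'+] --> x.
  rewrite -[X in _ --> X]addr0 -(scale0r w).
  apply: cvgD; first exact: cvg_cst.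
  by apply: cvgZ; [apply: cvg_at_right_filter; exact: cvg_id|exact: cvg_cst].
exact: (cv _ H).
Qed.

Section faces.
Context {R : realType} {n : nat}.
Notation d := n.+1.
Notation pt := 'rV[R]_d.
Context {Ga : mesh n} {q : node Ga -> pt}.
Hypothesis cq : conforming q.
Hypothesis n0 : (0 < n)%N.
Let vi := conforming_vert_inj cq.

Definition face (s : cell Ga) j : {set node Ga} := verts s :\ vert s j.

Lemma sum_face (W : zmodType) (f : node Ga -> W) s j :
  \sum_(v in face s j) f v = \sum_(i | i != j) f (vert s i).
Proof.
have -> : face s j = [set vert s i | i in [set~ j]]%SET.
  apply/setP => v; rewrite !inE; apply/andP/imsetP => [[vj /imsetP[i _ vE]]|[i]].
    exists i => //; rewrite !inE; apply: contra vj => /eqP <-; exact/eqP.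
  by rewrite !inE => ij ->; rewrite (inj_eq (@vi s)) ij mem_verts.
rewrite big_imset /=; last by move=> a b _ _; exact: vi.
by apply: eq_bigl => i; rewrite !inE.
Qed.

(** Barycentre of the face, computed from its set of nodes so that both neighbours give the same
    point. *)
Definition mid s j : pt := n%:R^-1 *: \sum_(v in face s j) q v.

Definition mcoef (j : 'I_d) (h : R) (i : 'I_d) : R := if i == j then h else (1 - h) / n%:R.

Let nR : n%:R != 0 :> R. Proof. by rewrite pnatr_eq0 -lt0n. Qed.

Lemma sum_off (j : 'I_d) (c : R) : \sum_(i | i != j) c = c * n%:R.
Proof.
rewrite sumr_const mulr_natr; congr (_ *+ _).
by have := cardC1 j; rewrite card_ord.
Qed.

Lemma sum_mcoef j h : \sum_i mcoef j h i = 1.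
Proof.
rewrite (bigD1 j)//= {1}/mcoef eqxx.
rewrite (eq_bigr (fun=> (1 - h) / n%:R)); last by move=> i /negbTE ij; rewrite /mcoef ij.
by rewrite sum_off divfK// addrC subrK.
Qed.

Lemma mid_coord s j h :
  mid s j + h *: (cpos q s j - mid s j) = \sum_i mcoef j h i *: cpos q s i.
Proof.
rewrite (bigD1 j)//= {1}/mcoef eqxx.
rewrite (eq_bigr (fun i => ((1 - h) / n%:R) *: cpos q s i)); last by move=> i /negbTE ij; rewrite /mcoef ij.
rewrite -scaler_sumr -scalerA -(sum_face q) -/(mid s j).
by apply/rowP => i; rewrite !mxE; ring.
Qed.

Lemma mid_hull s j h : 0 <= h <= 1 -> hull q (verts s) (mid s j + h *: (cpos q s j - mid s j)).
Proof.
move=> /andP[h0 h1]; rewrite mid_coord; apply: vert_hull; [exact: vi| |exact: sum_mcoef].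
by move=> i; rewrite /mcoef; case: ifP => // _; rewrite divr_ge0 ?subr_ge0.
Qed.

Lemma mid_osimplex s j h : 0 < h < 1 -> osimplex (cpos q s) (mid s j + h *: (cpos q s j - mid s j)).
Proof.
move=> /andP[h0 h1]; rewrite mid_coord; exists (mcoef j h); split => //; last exact: sum_mcoef.
by move=> i; rewrite /mcoef; case: ifP => // _; rewrite divr_gt0 ?subr_gt0 ?ltr0n.
Qed.

(** Vertices are matched through the shared nodes, and the two opposite vertices with each other;
    the sign of [g] compares the two numberings. *)
Lemma face_perm s j s' j' : face s j = face s' j' -> exists2 g : {perm 'I_d}, g j' = j &
  cpos q s' = fun i => upd (cpos q s) j (cpos q s' j') (g i).
Proof.
move=> fE.
have H i : i != j' -> exists2 k, k != j & vert s k = vert s' i.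
  move=> ij; have : vert s' i \in face s j by rewrite fE !inE (inj_eq (@vi s')) ij mem_verts.
  rewrite !inE => /andP[kj /imsetP[k _ kE]]; exists k => //.
  by apply: contra kj => /eqP <-; exact/eqP.
(* Off [j'] the search always succeeds, so the default [j] is not taken there. *)
pose f i := if i == j' then j else odflt j [pick k | vert s k == vert s' i].
have fP i : i != j' -> f i != j /\ vert s (f i) = vert s' i.
  move=> ij; have [k kj kE] := H i ij; rewrite /f (negbTE ij).
  case: pickP => [l /eqP lE /=|/(_ k)]; last by rewrite kE eqxx.
  by split => //; apply: contra kj => /eqP lj; apply/eqP/(@vi s); rewrite kE -lE lj.
have f_inj : injective f.
  move=> a b; have [aj|aj] := eqVneq a j'; have [bj|bj] := eqVneq b j'.
  - by rewrite aj bj.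
  - by rewrite {1}/f aj eqxx => e; have [] := fP b bj; rewrite -e eqxx.
  - by rewrite [RHS]/f bj eqxx => e; have [] := fP a aj; rewrite e eqxx.
  - by move=> e; apply: (@vi s'); have [_ <-] := fP a aj; have [_ <-] := fP b bj; rewrite e.
exists (perm f_inj); first by rewrite permE /f eqxx.
apply/funext => i; rewrite permE /upd.
have [->|ij] := eqVneq i j'; first by rewrite /f eqxx eqxx.
by have [/negbTE -> vE] := fP i ij; rewrite /cpos vE.
Qed.

Lemma card_face s j : #|face s j| = n.
Proof.
have := cardsD1 (vert s j) (verts s); rewrite mem_verts (card_verts cq).
by rewrite add1n => -[].
Qed.

Lemma face_opposite s j s' j' : face s j = face s' j' -> s != s' -> vert s' j' \notin verts s.
Proof.
move=> fE; apply: contra => vs; have [_ verts_inj _ _] := cq.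
apply/eqP/esym/verts_inj/eqP; rewrite eqEcard !(card_verts cq) leqnn andbT.
by rewrite -(finset.setD1K (mem_verts s' j')) -/(face s' j') -fE finset.subUset finset.sub1set vs subD1set.
Qed.

Lemma det_upd_span (p : 'I_d -> pt) j v h (b : 'I_d -> R) : \sum_(i | i != j) b i = 1 ->
  \det (pframe v (upd p j (h *: v + \sum_(i | i != j) b i *: p i))) = 0.
Proof.
move=> b1; apply: (@det_pframe0 _ _ _ _ h (fun i => if i == j then -1 else b i)).
- by exists j; rewrite eqxx oppr_eq0 oner_eq0.
- rewrite (bigD1 j)//= eqxx (eq_bigr b) ?b1 ?addNr// => i /negbTE ->//.
- rewrite (bigD1 j)//= eqxx scaleN1r [upd _ _ _ j]/upd eqxx.
  rewrite [X in _ + (_ + X)](eq_bigr (fun i => b i *: p i)); last by move=> i /negbTE ij; rewrite /upd ij.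
  by rewrite opprD addrA addrA subrr add0r addNr.
Qed.

Lemma midE s j : mid s j = \sum_(i | i != j) n%:R^-1 *: cpos q s i.
Proof. by rewrite /mid sum_face scaler_sumr. Qed.

End faces.

Section adjacent.
Context {R : realType} {n : nat}.
Notation d := n.+1.
Notation pt := 'rV[R]_d.
Context {Om inner : set pt} {Ga : mesh n} {q : node Ga -> pt} {nu : cell Ga -> pt}.
Hypothesis I : interface Om inner q nu.
Hypothesis n0 : (0 < n)%N.
Let cq := interface_conforming I.
Let vi := conforming_vert_inj cq.
Notation mid := (mid (q := q)).

(** A ray from an interior point of a simplex starts in the inner phase exactly when its pairing
    with the normal is negative; segments that avoid the carrier join the two rays, so their phases
    agree. *)
Lemma same_side s s' x x' w w' r : osimplex (cpos q s) x -> osimplex (cpos q s') x' -> 0 < r ->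
  (forall a b t, 0 < a < r -> 0 < b < r -> 0 <= t <= 1 ->
     ~ carrier q (x + a *: w + t *: (x' + b *: w' - (x + a *: w)))) ->
  dot w (nu s) != 0 -> dot w' (nu s') != 0 ->
  Num.sg (dot w (nu s)) = Num.sg (dot w' (nu s')).
Proof.
move=> sx sx' r0 off w0 w0'.
have side s1 x1 w1 : osimplex (cpos q s1) x1 -> dot w1 (nu s1) != 0 ->
    exists2 a, 0 < a < r & (inner (x1 + a *: w1) <-> dot w1 (nu s1) < 0).
  move=> sx1 w10.
  have H1 := near_ray w1 (near_normal I sx1).
  have H : \forall h \near (0 : R)^'+, [/\ 0 < h < r,
      0 < dot (x1 + h *: w1 - x1) (nu s1) -> ~ inner (x1 + h *: w1)
      & dot (x1 + h *: w1 - x1) (nu s1) < 0 -> inner (x1 + h *: w1)].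
    near=> h; have [h1 h2] : (0 < dot (x1 + h *: w1 - x1) (nu s1) -> ~ inner (x1 + h *: w1)) /\
      (dot (x1 + h *: w1 - x1) (nu s1) < 0 -> inner (x1 + h *: w1)) by near: h; exact: H1.
    split => //; apply/andP; split; near: h; first exact: nbhs_right_gt.
    exact: nbhs_right_lt.
  have [a [/andP[a0 ar]]] := @filter_ex _ _ (at_right_proper_filter (0 : R)) _ H.
  rewrite addrAC subrr add0r dotZl => pos neg; exists a; first by rewrite a0.
  have [ev|ev|ev] := ltrgtP (dot w1 (nu s1)) 0; last by rewrite ev eqxx in w10.
    by split => // _; apply: neg; rewrite pmulr_rlt0.
  by split => // i; case: pos => //; rewrite pmulr_rgt0.
have [a a0 ia] := side _ _ _ sx w0; have [b b0 ib] := side _ _ _ sx' w0'.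
have iab := inner_seg I (fun t => off a b t a0 b0).
have e : (dot w (nu s) < 0) = (dot w' (nu s') < 0).
  by apply/idP/idP => h; [apply/ib/iab/ia|apply/ia/iab/ib].
by rewrite !sgr_def w0 w0' e.
Unshelve. all: by end_near. Qed.

(** [closed_surface] counts a classical set; this is the finite set with the same members. *)
Lemma card_star s j : #|[set x : cell Ga | face s j \subset verts x]%SET| = 2%N.
Proof.
have [/(_ s j) c2 _] := interface_closed I; rewrite -/(face s j) in c2.
rewrite -c2; apply: eq_card => y; rewrite finset.in_set.
by apply/idP/idP => [h|/set_mem//]; exact/mem_set.
Qed.

Variables (s s' : cell Ga) (j j' : 'I_d).
Hypothesis fE : face s j = face s' j'.
Hypothesis ss' : s != s'.

Let a := cpos q s j.
Let a' := cpos q s' j'.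
Let m := mid s j.

Let mE : mid s' j' = m. Proof. by rewrite /m /mid fE. Qed.

Lemma starE : [set x : cell Ga | face s j \subset verts x]%SET = [set s; s']%SET.
Proof.
have sub : [set s; s']%SET \subset [set x | face s j \subset verts x]%SET.
  apply/fintype.subsetP => y; rewrite !inE => /orP[/eqP ->|/eqP ->]; first exact: subD1set.
  by rewrite fE subD1set.
by apply/esym/eqP; rewrite eqEcard sub cards2 ss' card_star.
Qed.

(** By [hull_support], a simplex containing the barycentre of the face contains all its vertices,
    and only [s] and [s'] do. *)
Lemma near_two : \forall z \near m, carrier q z -> hull q (verts s) z \/ hull q (verts s') z.
Proof.
apply: filterS (near_hull I m) => z hz /carrierP[x xz]; have := hz _ xz.
have -> : m = m + 0 *: (cpos q s j - m) by rewrite scale0r addr0.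
rewrite mid_coord// => xm.
have fx : face s j \subset verts x.
  apply/fintype.subsetP => v; rewrite !inE => /andP[vj /imsetP[i _ vE]].
  have ij : i != j by apply: contra vj => /eqP <-; exact/eqP.
  rewrite vE; apply: (hull_support cq _ _ xm) => [k||]; last 1 first.
  - by rewrite /mcoef (negbTE ij) subr0 div1r invr_eq0 pnatr_eq0 -lt0n.
  - by rewrite /mcoef; case: ifP => // _; rewrite subr0 divr_ge0.
  - exact: sum_mcoef.
have /setP/(_ x) := starE; rewrite !inE fx => /esym/orP[/eqP <-|/eqP <-]; by [left|right].
Qed.

Lemma hull_mid : hull q (verts s) m.
Proof.
by have := mid_hull cq n0 s j (h := 0); rewrite scale0r addr0 lexx ler01; apply.
Qed.

Lemma dot_mid : dot (a - m) (nu s) = 0.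
Proof.
apply: (hull_plane I hull_mid).
by have := mid_hull cq n0 s j (h := 1); rewrite scale1r addrC subrK lexx ler01; apply.
Qed.

Lemma hull_mid' : hull q (verts s') m.
Proof.
by have := mid_hull cq n0 s' j' (h := 0); rewrite scale0r addr0 lexx ler01 mE; apply.
Qed.

Lemma hull_vert' : hull q (verts s') a'.
Proof.
by have := mid_hull cq n0 s' j' (h := 1); rewrite scale1r addrC subrK lexx ler01; apply.
Qed.

Lemma dot_mid' : dot (a' - m) (nu s') = 0.
Proof. exact: (hull_plane I hull_mid' hull_vert'). Qed.

Lemma near_points : exists x x' h r, [/\ 0 < h, 0 < r, x = m + h *: (a - m), x' = m + h *: (a' - m) &
  [/\ osimplex (cpos q s) x, osimplex (cpos q s') x',
   ball m r x, ball m r x' & forall z, ball m r z -> carrier q z -> hull q (verts s) z \/ hull q (verts s') z]].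
Proof.
have /nbhs_ballP[r /= r0 rh] := near_two.
have mr : \forall z \near m, ball m r z by exact: nbhsx_ballx.
have H1 := near_ray (a - m) mr; have H2 := near_ray (a' - m) mr.
have H : \forall h \near (0 : R)^'+, [/\ 0 < h < 1, ball m r (m + h *: (a - m)) & ball m r (m + h *: (a' - m))].
  near=> h; split; [|by near: h; exact: H1|by near: h; exact: H2].
  by apply/andP; split; near: h; [exact: nbhs_right_gt|exact: nbhs_right_lt].
have [h [h01 xr xr']] := @filter_ex _ _ (at_right_proper_filter (0 : R)) _ H.
exists (m + h *: (a - m)), (m + h *: (a' - m)), h, r; split => //.
  by move: h01 => /andP[].
split => //; first exact: mid_osimplex.
by rewrite -mE; exact: mid_osimplex.
Unshelve. all: by end_near. Qed.

(* The segment from x to x' leaves s and reaches s' without meeting the carrier in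
   between, so it starts and ends in the same phase. *)
Lemma same_side_transverse : dot (a' - m) (nu s) != 0 -> dot (a - m) (nu s') != 0 ->
  Num.sg (dot (a' - m) (nu s)) = Num.sg (dot (a - m) (nu s')).
Proof.
move=> w0 w0'.
have [x [x' [h [r [h0 r0 xE xE' [sx sx' xr xr' two]]]]]] := near_points.
have E : dot (x' - x) (nu s) = h * dot (a' - m) (nu s).
  rewrite xE xE' opprD addrACA subrr add0r -scalerBr dotZl.
  by rewrite (dotBl (a' - m)) dot_mid subr0.
have E' : dot (x - x') (nu s') = h * dot (a - m) (nu s').
  rewrite xE xE' opprD addrACA subrr add0r -scalerBr dotZl.
  by rewrite (dotBl (a - m)) dot_mid' subr0.
suff : Num.sg (dot (x' - x) (nu s)) = Num.sg (dot (x - x') (nu s')).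
  by rewrite E E' !sgrM gtr0_sg// !mul1r.
apply: (same_side (r := 2^-1) sx sx'); rewrite ?E ?E' ?mulf_neq0// ?gt_eqF ?invr_gt0//.
move=> d1 d2 t /andP[d10 d11] /andP[d20 d21] /andP[t0 t1].
(* Position on the segment from [x] to [x']: a convex combination of [d1] and [1 - d2]. *)
set l := d1 + t * (1 - d2 - d1).
have l0 : 0 < l by rewrite /l; nra.
have l1 : l < 1 by rewrite /l; nra.
have -> : x + d1 *: (x' - x) + t *: (x' + d2 *: (x - x') - (x + d1 *: (x' - x))) = x + l *: (x' - x).
  by apply/rowP => i; rewrite !mxE /l; ring.
move=> /(two _ (ball_segment xr xr' _)); rewrite !ltW// => /(_ isT)[hz|hz].
  have := hull_plane I (osimplex_hull (@vi s) sx) hz.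
  rewrite addrAC subrr add0r dotZl E => /eqP.
  by rewrite !mulf_eq0 (negbTE w0) !gt_eqF.
have := hull_plane I (osimplex_hull (@vi s') sx') hz.
have -> : x + l *: (x' - x) - x' = (1 - l) *: (x - x').
  by apply/rowP => i; rewrite !mxE; ring.
rewrite dotZl E' => /eqP.
by rewrite !mulf_eq0 (negbTE w0') !gt_eqF// subr_gt0.
Qed.

(* As before, but along a segment parallel to the common plane of s and s'. *)
Lemma same_side_coplanar : dot (a' - m) (nu s) = 0 -> dot (nu s) (nu s') != 0 ->
  Num.sg (dot (nu s) (nu s')) = 1.
Proof.
move=> flat w0.
have [x [x' [h [r [h0 r0 xE xE' [sx sx' xr xr' two]]]]]] := near_points.
have flat_mid z : hull q (verts s') z -> dot (z - m) (nu s) = 0.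
  move=> /(hull_vertsP _ _ (@vi s'))[c [_ c1 ->]].
  rewrite -[X in _ - X]scale1r -c1 scaler_suml -sumrB dot_suml big1// => i _.
  rewrite -scalerBr dotZl.
  have [->|ij] := eqVneq i j'; first by rewrite -/a' flat mulr0.
  rewrite (hull_plane I hull_mid) ?mulr0//.
  have : vert s' i \in verts s.
    have : vert s' i \in face s j by rewrite fE !inE (inj_eq (@vi s')) ij mem_verts.
    by rewrite !inE => /andP[].
  move=> /imsetP[k _ kE]; rewrite /cpos kE; exact: vertex_hull.
have ex : \forall  c \near (0 : R)^'+, ball m r (x + c *: nu s).
  by apply: (@near_ray _ _ x (nu s) (ball m r)); apply: open_nbhs_nbhs; split => //; exact: ball_open.
have ex' : \forall  c \near (0 : R)^'+, ball m r (x' + c *: nu s).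
  by apply: (@near_ray _ _ x' (nu s) (ball m r)); apply: open_nbhs_nbhs; split => //; exact: ball_open.
have [r1 r10 hr1] : exists2 r1, 0 < r1 & forall c, 0 < c < r1 -> ball m r (x + c *: nu s).
  move: ex; rewrite /at_right /within /= => /nbhs_ballP[r1 /= r10 hr]; exists r1 => // c /andP[c0 c1].
  by apply: hr => //=; rewrite -ball_normE /= sub0r normrN gtr0_norm.
have [r2 r20 hr2] : exists2 r1, 0 < r1 & forall c, 0 < c < r1 -> ball m r (x' + c *: nu s).
  move: ex'; rewrite /at_right /within /= => /nbhs_ballP[r2 /= r20 hr]; exists r2 => // c /andP[c0 c1].
  by apply: hr => //=; rewrite -ball_normE /= sub0r normrN gtr0_norm.
rewrite -[RHS](sgr1 R) -(normal_unit I s); apply/esym.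
have v0 : dot (nu s) (nu s) != 0 by rewrite (normal_unit I) oner_eq0.
have r12 : 0 < Num.min r1 r2 by rewrite lt_min r10.
apply: (same_side (r := Num.min r1 r2) sx sx' r12 _ v0 w0).
move=> d1 d2 t /andP[d10]; rewrite lt_min => /andP[d11 _] /andP[d20]; rewrite lt_min => /andP[_ d21] t01.
move: (t01) => /andP[t0 t1].
have zr := ball_segment (hr1 d1 _) (hr2 d2 _) t01; rewrite d10 d11 d20 d21 in zr.
move=> /(two _ (zr isT isT)) hz.
have : dot (x + d1 *: nu s + t *: (x' + d2 *: nu s - (x + d1 *: nu s)) - m) (nu s) = 0.
  by case: hz => [hz|hz]; [exact: (hull_plane I hull_mid hz)|exact: flat_mid].
(* The component along [nu s] is a convex combination of two positive offsets, whereas nearby points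
   of the carrier lie in the plane. *)
have -> : x + d1 *: nu s + t *: (x' + d2 *: nu s - (x + d1 *: nu s)) - m =
   (h * (1 - t)) *: (a - m) + (h * t) *: (a' - m) + ((1 - t) * d1 + t * d2) *: nu s.
  by rewrite xE xE'; apply/rowP => i; rewrite !mxE; ring.
rewrite !dotDl !dotZl dot_mid flat (normal_unit I) !mulr0 !add0r mulr1 => /eqP.
by rewrite gt_eqF//; nra.
Qed.

End adjacent.

Section orientation_flip.
Context {R : realType} {n : nat}.
Notation d := n.+1.
Notation pt := 'rV[R]_d.
Context {Om inner : set pt} {Ga : mesh n} {q : node Ga -> pt} {nu : cell Ga -> pt}.
Hypothesis I : interface Om inner q nu.
Hypothesis n0 : (0 < n)%N.
Let cq := interface_conforming I.
Let vi := conforming_vert_inj cq.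
Notation mid := (mid (q := q)).
Notation nframe := (nframe (nu := nu) (q := q)).
Notation orientation := (orientation (nu := nu) (q := q)).

Lemma plane_coord s x : dot (x - cpos q s ord0) (nu s) = 0 ->
  exists2 c : 'I_d -> R, \sum_i c i = 1 & x = \sum_i c i *: cpos q s i.
Proof.
move=> x0; have uK : frame (nu s) q s \in unitmx by rewrite unitmxE unitfE (nframe_neq0 I).
pose u : 'rV[R]_(1 + n) := (x - cpos q s ord0) *m invmx (frame (nu s) q s).
have xE : x - cpos q s ord0 = lsubmx u ord0 ord0 *: nu s + rsubmx u *m edges (cpos q s).
  rewrite -mul_scalar_mx -mx11_scalar -mul_row_col hsubmxK.
  by rewrite /u -/(frame (nu s) q s) mulmxKV.
have l0 : lsubmx u ord0 ord0 = 0.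
  by move: x0; rewrite xE dotDl dotZl (normal_unit I) (dot_normal I) mulr1 addr0.
exists (bary (rsubmx u)); first exact: sum_bary.
by rewrite -bary_comb -[RHS]addr0 -(addrNK (cpos q s ord0) x) xE l0 scale0r add0r addr0 addrC.
Qed.

Variables (s s' : cell Ga) (j j' : 'I_d) (g : {perm 'I_d}).
Hypothesis fE : face s j = face s' j'.
Hypothesis ss' : s != s'.
Hypothesis gE : cpos q s' = fun i => upd (cpos q s) j (cpos q s' j') (g i).

Let p := cpos q s.
Let a := cpos q s j.
Let a' := cpos q s' j'.
Let m := mid s j.
Let D v x := \det (pframe v (upd p j x)).

Let frame' v : \det (frame v q s') = (-1) ^+ g * D v a'.
Proof. by rewrite /D -det_pframe_perm /frame /pframe -gE. Qed.

Let frameD v : \det (frame v q s) = D v a.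
Proof. by rewrite /D upd_id. Qed.

Let nR : n%:R != 0 :> R. Proof. by rewrite pnatr_eq0 -lt0n. Qed.

Let D_mid v h : D v (h *: v + m) = 0.
Proof.
rewrite /D /m (midE cq) det_upd_span// sum_off// mulVf//.
Qed.

(** Otherwise points just beyond [m] towards [a'] would have nonnegative coordinates in [s]. They
    also have positive weight at [a'] in [s'], so conformity would make [a'] a vertex of [s]. *)
Lemma opposite_negative c : \sum_i c i = 1 -> a' = \sum_i c i *: p i -> c j < 0.
Proof.
move=> c1 aE; rewrite ltNge; apply/negP => cj.
have H1 : \forall h \near (0 : R)^'+, forall i, i != j -> 0 < (1 - h) / n%:R + h * c i.
  apply: (@filter_forall _ _ (fun i h => i != j -> 0 < (1 - h) / n%:R + h * c i) (0 : R)^'+) => i.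
  have cv : (1 - h) / n%:R + h * c i @[h --> (0 : R)^'+] --> (1 - 0) / n%:R + 0 * c i.
    apply: cvg_at_right_filter; apply: cvgD; last by apply: cvgM; [exact: cvg_id|exact: cvg_cst].
    by apply: cvgM; [apply: cvgB; [exact: cvg_cst|exact: cvg_id]|exact: cvg_cst].
  have H : \forall h \near (0 : R)^'+, 0 < (1 - h) / n%:R + h * c i.
    by apply: (cvgr_gt _ cv); rewrite mul0r addr0 subr0 divr_gt0 ?ltr0n.
  by apply: filterS H => h + _.
have H : \forall h \near (0 : R)^'+, 0 < h < 1 /\ forall i, i != j -> 0 < (1 - h) / n%:R + h * c i.
  near=> h; split; last by near: h; exact: H1.
  by apply/andP; split; near: h; [exact: nbhs_right_gt|exact: nbhs_right_lt].
have [h [/andP[h0 h1] hc]] := @filter_ex _ _ (at_right_proper_filter (0 : R)) _ H.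
pose b i := if i == j then h * c j else (1 - h) / n%:R + h * c i.
have hz : hull q (verts s) (m + h *: (a' - m)).
  have -> : m + h *: (a' - m) = \sum_i b i *: cpos q s i.
    rewrite aE /m (midE cq)// [\sum_i c i *: _](bigD1 j)//= [\sum_i b i *: _](bigD1 j)//= {1}/b eqxx.
    rewrite [X in _ = _ + X](eq_bigr (fun i => (1 - h) *: (n%:R^-1 *: cpos q s i) + h *: (c i *: p i))); last first.
      by move=> i /negbTE ij; rewrite /b ij [LHS]scalerDl !scalerA.
    rewrite big_split/= -!scaler_sumr -scalerA -/p.
    by apply/rowP => i; rewrite !mxE; ring.
  apply: vert_hull; first exact: vi.
    by move=> i; rewrite /b; case: eqP => [_|/eqP ij]; [rewrite mulr_ge0// ltW|apply/ltW/hc].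
  rewrite [\sum_i b i](bigD1 j)//= {1}/b eqxx (eq_bigr (fun i => (1 - h) / n%:R + h * c i)); last first.
    by move=> i /negbTE ij; rewrite /b ij.
  rewrite big_split/= sum_off divfK// -mulr_sumr addrCA -mulrDr.
  by move: c1; rewrite (bigD1 j)//= => ->; rewrite mulr1 subrK.
move: hz; have -> : m = mid s' j' by rewrite /m /mid fE.
rewrite mid_coord// => hz.
have := hull_support cq _ _ hz; move/(_ _ _ j').
have := face_opposite cq fE ss' => /negP nv H'.
apply: nv; apply: H'.
- by move=> i; rewrite /mcoef; case: eqP => _; rewrite ?divr_ge0 ?subr_ge0// ltW.
- exact: sum_mcoef.
- by rewrite /mcoef eqxx gt_eqF.
Unshelve. all: by end_near. Qed.

(* Evaluate [det (frame v q s')] at v = (a - m) + (a' - m) when a' lies off the plane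
   of s, and at v = nu s otherwise. *)
Lemma orientation_flip : orientation s' * (-1) ^+ g = - orientation s.
Proof.
have sg1 : Num.sg ((-1) ^+ g : R) = (-1) ^+ g.
  by case: (odd_perm g); rewrite ?expr1 ?expr0 ?sgrN sgr1.
have sg2 : (-1) ^+ g * (-1) ^+ g = 1 :> R by rewrite -expr2 sqrr_sign.
suff : Num.sg (nframe s') = - (-1) ^+ g * Num.sg (nframe s).
  by rewrite /orientation => ->; rewrite mulrAC mulNr sg2 mulN1r.
have am : dot (a - m) (nu s) = 0 := dot_mid I n0 s j.
have am' : dot (a' - m) (nu s') = 0 := dot_mid' I n0 fE.
have E : dot (a - m) (nu s') * nframe s' = - ((-1) ^+ g * (dot (a' - m) (nu s) * nframe s)).
  pose v := (a - m) + (a' - m).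
  have <- : dot v (nu s) = dot (a' - m) (nu s) by rewrite /v (dotDl (a - m)) am add0r.
  have <- : dot v (nu s') = dot (a - m) (nu s').
    by rewrite /v (dotDl (a - m)) am' addr0.
  rewrite -!(det_frame I) frame' frameD.
  (* [D v] is affine and vanishes at [v + m] and at [m], while [a'] is [v + m] minus [a - m]. *)
  have -> : D v a' = - D v a; last by rewrite mulrN.
  have {1}-> : a' = (1 *: v + m) + (-1) *: (a - m).
    by rewrite /v; apply/rowP => i; rewrite !mxE; ring.
  rewrite /D det_pframe_upd -/(D v _) -/(D v a) -/(D v m) D_mid.
  by have := D_mid v 0; rewrite scale0r add0r => ->; rewrite subr0 add0r mulN1r.
have N0 := nframe_neq0 I.
have [u0|u0] := eqVneq (dot (a' - m) (nu s)) 0; last first.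
  have w0 : dot (a - m) (nu s') != 0.
    apply: contraNneq u0 => w0; move: E; rewrite w0 mul0r => /esym/eqP.
    by rewrite oppr_eq0 !mulf_eq0 signr_eq0 (negbTE (N0 s)) orbF.
  move: E => /(congr1 Num.sg); rewrite sgrN !sgrM (same_side_transverse I n0 fE ss' u0 w0) sg1.
  by rewrite mulrCA -mulrN -mulNr; apply: mulfI; rewrite sgr_eq0.
have [|c c1 cE] := @plane_coord s a'.
  rewrite -(subrK m a') -addrA dotDl u0 add0r -opprB dotNl.
  rewrite (hull_plane I (hull_mid I n0 s j)) ?oppr0//.
  exact: (vertex_hull _ _ (@vi s)).
have cj := opposite_negative c1 cE.
(* [a'] is an affine combination [m'] of the vertices of the face plus [c j] times [a - m];
   [D (nu s)] vanishes at [m'] and at [m]. *)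
have Dv : D (nu s) a' = c j * D (nu s) a.
  pose m' := \sum_(i | i != j) (c i + c j / n%:R) *: p i.
  have {1}-> : a' = (0 *: nu s + m') + c j *: (a - m).
    rewrite /m' scale0r add0r cE [\sum_i c i *: _](bigD1 j)//= scalerBr /m (midE cq)// scaler_sumr.
    under [X in _ = X + _]eq_bigr do rewrite scalerDl.
    rewrite big_split/= [X in _ = _ + X + _](eq_bigr (fun i => c j *: (n%:R^-1 *: cpos q s i))); last first.
      by move=> i _; rewrite scalerA.
    by rewrite -[RHS]addrA [X in _ = _ + X]addrCA subrr addr0 addrC.
  rewrite /D det_pframe_upd det_upd_span; last first.
    rewrite big_split/= sum_off divfK// -c1 [in RHS](bigD1 j)//= addrC//.
  have := D_mid (nu s) 0; rewrite /D scale0r add0r => ->.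
  by rewrite subr0 add0r.
have : dot (nu s) (nu s') * nframe s' = (-1) ^+ g * (c j * nframe s).
  by rewrite -(det_frame I) frame' Dv -frameD (det_frame I) (normal_unit I) mul1r.
move=> E2; have w0 : dot (nu s) (nu s') != 0.
  apply/eqP => w0; move: E2; rewrite w0 mul0r => /esym/eqP.
  by rewrite !mulf_eq0 signr_eq0 (negbTE (N0 s)) orbF lt_eqF.
move: E2 => /(congr1 Num.sg); rewrite !sgrM (same_side_coplanar I n0 fE ss' u0 w0) sg1.
by rewrite (ltr0_sg cj) mul1r mulN1r mulrN mulNr.
Qed.

End orientation_flip.

(** * Cancellation over the faces of the closed surface *)

Section closed_flux.
Context {R : realType} {n : nat}.
Notation d := n.+1.
Notation pt := 'rV[R]_d.
Context {Om inner : set pt} {Ga : mesh n} {q : node Ga -> pt} {nu : cell Ga -> pt}.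
Hypothesis I : interface Om inner q nu.
Hypothesis n0 : (0 < n)%N.
Let cq := interface_conforming I.
Let vi := conforming_vert_inj cq.
Notation orientation := (orientation (nu := nu) (q := q)).

Lemma det_vmx_upd_sum (p : 'I_d -> pt) j (J : finType) (P : pred J) (f : J -> pt) :
  \sum_(i | P i) \det (vmx (upd p j (f i))) = \det (vmx (upd p j (\sum_(i | P i) f i))).
Proof.
pose F w := \det (vmx (upd p j w)).
rewrite -/(F _); apply/esym; apply: (big_morph F).
  by move=> x y; rewrite /F -[x in LHS]scale1r -[y in LHS]scale1r det_vmx_upd !mul1r.
by rewrite /F -(scale0r (0 : pt)) -[0 *: _]addr0 -{2}(scale0r (0 : pt)) det_vmx_upd !mul0r addr0.
Qed.

(** Replacing the vertex opposite to the face by the sum of [W] over the face leaves a term that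
    depends on the face and on the induced orientation only. *)
Definition face_flux (W : node Ga -> pt) (e : cell Ga * 'I_d) : R :=
  orientation e.1 * \det (vmx (upd (cpos q e.1) e.2 (\sum_(v in face e.1 e.2) W v))).

Lemma face_flux_opposite W (s s' : cell Ga) j j' : face s j = face s' j' -> s != s' ->
  face_flux W (s, j) + face_flux W (s', j') = 0.
Proof.
move=> fE ss'; have [g gj gE] := face_perm cq fE.
rewrite /face_flux /= -fE; set w := \sum_(v in _) _.
have -> : upd (cpos q s') j' w = fun i => upd (cpos q s) j w (g i).
  apply/funext => i; rewrite gE /upd -gj (inj_eq perm_inj).
  by case: (i =P j').
by rewrite det_vmx_perm mulrA (orientation_flip I n0 fE ss' gE) mulNr subrr.
Qed.

Lemma face_twin (s : cell Ga) j : exists (s' : cell Ga) j', face s j = face s' j' /\ s != s'.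
Proof.
have c2 := card_star I s j.
have sS : s \in [set x : cell Ga | face s j \subset verts x]%SET by rewrite inE subD1set.
have /card_gt0P[s'] : (0 < #|[set x : cell Ga | face s j \subset verts x]%SET :\ s|)%N.
  by move: c2; rewrite (cardsD1 s) sS add1n => -[->].
rewrite !inE => /andP[s's sub].
have /card_gt0P[v] : (0 < #|verts s' :\: face s j|)%N.
  rewrite cardsD (card_verts cq) (finset.setIidPr sub) (card_face cq).
  by rewrite subSnn.
rewrite !inE => /andP[vn /imsetP[j' _ vE]].
exists s', j'; split; last by rewrite eq_sym.
apply/eqP; rewrite eqEcard !(card_face cq) leqnn andbT.
apply/fintype.subsetP => x xf; rewrite !inE (fintype.subsetP sub _ xf) andbT.
apply/eqP => xE; move: vn; rewrite vE -xE.
by move: xf; rewrite !inE => ->.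
Qed.

(** Grouped by faces, the pairs come in twos with opposite terms. *)
Lemma sum_face_flux W : \sum_e face_flux W e = 0.
Proof.
rewrite (partition_big (fun e : cell Ga * 'I_d => face e.1 e.2) predT)//=.
apply: big1 => t _.
have [[s j]/= /eqP tE|none] := pickP (fun e : cell Ga * 'I_d => face e.1 e.2 == t); last by rewrite big_pred0.
have [s' [j' [fE ss']]] := face_twin s j.
have pairE (e : cell Ga * 'I_d) : (face e.1 e.2 == t) = ((e == (s, j)) || (e == (s', j'))).
  have same (x : cell Ga) k k' : face x k = face x k' -> k = k'.
    move=> f; apply: (@vi x); apply/eqP; apply: contraT => kk'.
    have : vert x k \in face x k' by rewrite !inE kk' mem_verts.
    by rewrite -f !inE eqxx.
  apply/eqP/orP => [|[/eqP ->|/eqP ->]] //=; last by rewrite -fE.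
  case: e => x k /= xt.
  have : x \in [set s; s']%SET.
    by rewrite -(starE I fE ss') finset.in_set tE -xt subD1set.
  rewrite !inE => /orP[/eqP xs|/eqP xs]; [left|right]; apply/eqP; congr pair => //.
    by apply: (@same s); rewrite tE -xt xs.
  by apply: (@same s'); rewrite -fE tE -xt xs.
rewrite (bigD1 (s, j)) /= ?tE// (bigD1 (s', j')) /= ?big1 ?addr0.
- exact: face_flux_opposite.
- by move=> e; rewrite pairE => /andP[/andP[/orP[->|->]]]//; rewrite andbF.
- by rewrite -fE tE eqxx /= xpair_eqE eq_sym (negbTE ss').
Qed.

(** On the left the row-by-row derivative of the volume, on the right the lumped flux, up to a
    constant. Expanding each frame by [det_pframe_rows], the surplus terms, with [W] of vertex [i]
    in row [j] and [i != j], collect into [face_flux]. *)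
Lemma sum_det_off (W : node Ga -> pt) :
  \sum_s orientation s * \sum_j \det (vmx (upd (cpos q s) j (W (vert s j)))) =
  \sum_s orientation s * \sum_i \det (frame (W (vert s i)) q s).
Proof.
apply/eqP; rewrite eq_sym -subr_eq0 -sumrB; apply/eqP; rewrite -[RHS](sum_face_flux W).
rewrite [RHS](eq_bigr (fun e => face_flux W (e.1, e.2))); last by case.
rewrite -(pair_bigA _ (fun s j => face_flux W (s, j)))/=; apply: eq_bigr => s _.
rewrite -mulrBr; under [RHS]eq_bigr do rewrite /face_flux /=.
rewrite -mulr_sumr; congr (_ * _).
have E i : \det (frame (W (vert s i)) q s) = \sum_j \det (vmx (upd (cpos q s) j (W (vert s i)))).
  have := det_pframe_rows (W (vert s i)) (cpos q s); rewrite /frame /pframe => ->.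
  apply: eq_bigr => j _; congr determinant; apply/matrixP => a b.
  by rewrite !mxE /upd; case: eqP.
rewrite (eq_bigr _ (fun i _ => E i)) exchange_big -sumrB; apply: eq_bigr => j _ /=.
rewrite (bigD1 j)//= addrAC subrr add0r (sum_face cq).
exact: det_vmx_upd_sum.
Qed.

End closed_flux.

(** * Conservation of the volume *)

Section moving_interface.
Context {R : realType} {n : nat}.
Notation d := n.+1.
Notation pt := 'rV[R]_d.

Lemma tderivable_cst (W : normedModType R) (T t : R) (c : W) : 0 < t <= T -> tderivable T (fun=> c) t.
Proof.
move=> tT; apply/cvg_ex; exists 0.
have -> : tquot (fun=> c) t = fun=> 0 by apply/funext => h; rewrite /tquot subrr scaler0.
exact: cvg_cst.
Qed.

Lemma is_tder_coord (T t : R) (f : R -> pt) j : tderivable T f t ->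
  is_tder T (fun s => f s ord0 j) t (tder T f t ord0 j).
Proof.
move=> fl.
have H : (fun M : pt => M ord0 j) \o tquot f t @ tfilter T t --> tder T f t ord0 j.
  apply: (@cvg_comp _ _ _ (tquot f t) (fun M : pt => M ord0 j) _ _ _ fl).
  exact: coord_continuous.
rewrite /is_tder (_ : tquot _ t = (fun M : pt => M ord0 j) \o tquot f t) //.
by apply/funext => h; rewrite /tquot /= !mxE.
Qed.

Lemma vertex_lim_value (Ga : mesh n) (q : node Ga -> pt) (f : pt -> R) s i :
  conforming q -> (0 < n)%N -> {within carrier q, continuous f} ->
  vertex_lim (cpos q s) f i = f (cpos q s i).
Proof.
move=> cq n0 /subspace_continuousP cf.
have vi := conforming_vert_inj cq.
have sub : osimplex (cpos q s) `<=` carrier q.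
  by move=> x /(osimplex_hull (@vi s)) xs; exists s.
have cl : closure (osimplex (cpos q s)) (cpos q s i).
  move=> U Ui.
  have H1 := near_ray (mid (q := q) s i - cpos q s i) Ui.
  have H : \forall h \near (0 : R)^'+, 0 < h < 1 /\ U (cpos q s i + h *: (mid (q := q) s i - cpos q s i)).
    near=> h; split; last by near: h; exact: H1.
    by apply/andP; split; near: h; [exact: nbhs_right_gt|exact: nbhs_right_lt].
  have [h [/andP[h0 h1] Uh]] := @filter_ex _ _ (at_right_proper_filter (0 : R)) _ H.
  exists (cpos q s i + h *: (mid (q := q) s i - cpos q s i)); split => //.
  have -> : cpos q s i + h *: (mid (q := q) s i - cpos q s i) =
    mid (q := q) s i + (1 - h) *: (cpos q s i - mid (q := q) s i).
    by apply/rowP => k; rewrite !mxE; ring.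
  by apply: mid_osimplex => //; apply/andP; split; lra.
have PF : ProperFilter (within (osimplex (cpos q s)) (nbhs (cpos q s i))).
  exact: within_nbhs_proper.
apply: cvg_lim; first exact: norm_hausdorff.
have ci : carrier q (cpos q s i) by exists s => //; exact: vertex_hull (@vi s).
move=> U /(cf _ ci) H.
apply: (@filterS _ (nbhs (cpos q s i)) _ (fun x => carrier q x -> U (f x)) _ _ H) => x Ux /sub.
exact: Ux.
Unshelve. all: by end_near. Qed.

End moving_interface.

Section volume_derivative.
Context {R : realType} {n : nat}.
Notation d := n.+1.
Notation pt := 'rV[R]_d.
Context {Om : set pt} (bOm : bounded_set Om) (n0 : (0 < n)%N).
Context {Th : mesh d} {z : node Th -> pt} (cz : conforming z) (cov : Om `<=` carrier z).
Context {Ga : mesh n} {q : R -> node Ga -> pt} {inner : R -> set pt} {nu : R -> cell Ga -> pt}.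
Context (T t : R) (tT : 0 < t <= T).
Hypothesis I : forall s, 0 < s <= T -> interface Om (inner s) (q s) (nu s).
Hypothesis qt : forall v, tderivable T (fun s => q s v) t.

Let W v := tder T (fun s => q s v) t.

Lemma vertex_flux s i (V : pt -> pt) : VhV (q t) V -> (forall v, V (q t v) = W v) ->
  vertex_lim (cpos (q t) s) (fun x => dot (V x) (nu t s) * 1) i = dot (W (vert s i)) (nu t s).
Proof.
move=> hV VW; have -> : (fun x => dot (V x) (nu t s) * 1) = fun x => \sum_j V x ord0 j * nu t s ord0 j.
  by apply/funext => x; rewrite mulr1.
rewrite vertex_lim_value; [by rewrite /cpos VW|exact: interface_conforming (I tT)|exact: n0|].
move=> x; apply: (@cvg_sumr R R^o _ _ (nbhs_filter x)) => j _.
apply: (@cvgM R _ (nbhs x)); last exact: cvg_cst.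
by have [+ _] := hV j; apply.
Qed.

Lemma is_tder_volume (V : pt -> pt) : VhV (q t) V -> (forall v, V (q t v) = W v) ->
  is_tder T (fun s => fine (leb d (inner s))) t
    (lumpedGa (q t) (fun s x => dot (V x) (nu t s) * 1)).
Proof.
move=> hV VW; have It := I tT; have FF := tfilter_filter T t.
have dq v j : is_tder T (fun s => q s v ord0 j) t (W v ord0 j) := is_tder_coord (j := j) (@qt v).
have cq v j : q (t + h) v ord0 j @[h --> tfilter T t] --> q t v ord0 j := is_tder_cvg (dq v j).
have Ih : \forall h \near tfilter T t, interface Om (inner (t + h)) (q (t + h)) (nu (t + h)).
  by apply: filterS (tfilter_time T t) => h; exact: I.
have keep := orientation_persists It bOm Ih cq.
pose o s := orientation (nu := nu t) (q := q t) s.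
(* With orientations frozen at time [t], [g] is a polynomial in the node coordinates that equals the
   volume at all admissible times near [t]. *)
pose g r := @ref_volume R n / d%:R * \sum_s o s * \det (vmx (cpos (q r) s)).
have gt : fine (leb d (inner t)) = g t.
  by rewrite (volume_frame It cz cov bOm) /g; under [in RHS]eq_bigr do rewrite det_vmx.
have gE : \forall h \near tfilter T t, fine (leb d (inner (t + h))) = g (t + h).
  near=> h.
  have Ih' : interface Om (inner (t + h)) (q (t + h)) (nu (t + h)) by near: h.
  have ko : forall s, orientation (nu := nu (t + h)) (q := q (t + h)) s = o s by near: h; exact: keep.
  rewrite (volume_frame Ih' cz cov bOm) /g; congr (_ * _); apply: eq_bigr => s _.
  by rewrite ko det_vmx.
have dg : is_tder T g t (@ref_volume R n / d%:R * \sum_s o s *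
    \sum_k \det (setrow (vmx (cpos (q t) s)) k (vmx (fun i => W (vert s i))))).
  have d1 s : is_tder T (fun r => \det (vmx (cpos (q r) s))) t
      (\sum_k \det (setrow (vmx (cpos (q t) s)) k (vmx (fun i => W (vert s i))))).
    by apply: is_tder_det => i j; rewrite !mxE; under eq_fun do rewrite mxE; exact: dq.
  have d2 s : is_tder T (fun r => o s * \det (vmx (cpos (q r) s))) t
      (o s * \sum_k \det (setrow (vmx (cpos (q t) s)) k (vmx (fun i => W (vert s i))))).
    by have := is_tderM (is_tder_cst T t (o s)) (d1 s); rewrite mul0r add0r.
  have := is_tderM (is_tder_cst T t (@ref_volume R n / d%:R))
    (@is_tder_sum R T t _ (index_enum (cell Ga)) xpredT _ _ d2).
  by rewrite mul0r add0r.
have -> : lumpedGa (q t) (fun s x => dot (V x) (nu t s) * 1) = @ref_volume R n / d%:R * \sum_s o s *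
    \sum_k \det (setrow (vmx (cpos (q t) s)) k (vmx (fun i => W (vert s i)))).
  have -> : \sum_s o s * \sum_k \det (setrow (vmx (cpos (q t) s)) k (vmx (fun i => W (vert s i)))) =
      \sum_s o s * \sum_k \det (vmx (upd (cpos (q t) s) k (W (vert s k)))).
    apply: eq_bigr => s _; congr (_ * _); apply: eq_bigr => k _; congr determinant.
    by apply/matrixP => a b; rewrite !mxE /upd; case: eqP => [->|].
  rewrite (sum_det_off It n0) /lumpedGa [_ / d%:R]mulrC -mulrA; congr (_ * _).
  rewrite mulr_sumr; apply: eq_bigr => s _.
  rewrite (eq_bigr _ (fun i _ => vertex_flux s i hV VW)) (int_simplexE It).
  rewrite [`|_| * _]mulrC -mulrA; congr (_ * _).
  by rewrite !mulr_sumr; apply: eq_bigr => i _; exact: (orientationE It).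
apply: cvg_trans dg; apply: near_eq_cvg; apply: filterS gE => h gh.
by rewrite /tquot gh gt.
Unshelve. all: by end_near. Qed.

End volume_derivative.

Theorem lemma3p11 (R : realType) (n : nat)
    (hd : n.+1 = 2%N \/ n.+1 = 3%N) (* the dimension is d = n.+1 *)
    (T : R) (hT : 0 < T)
    (Om dD : set 'rV[R]_n.+1) (hOm : polyhedral_domain Om dD)
    (c : physics R n) (hc : physics_ok T Om c)
    (Th : mesh n.+1) (z : node Th -> 'rV[R]_n.+1)
    (hTh : triangulation Om dD z)
    (Uh : set ('rV[R]_n.+1 -> 'rV[R]_n.+1)) (hUspan : finite_span Uh)
    (hUh : forall w, Uh w -> H1D_cont Om dD w /\ pw_polynomial Om z w)
    (Ph : R -> set ('rV[R]_n.+1 -> R))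
    (hPh : forall t, 0 < t <= T ->
       finite_span (Ph t : set ('rV[R]_n.+1 -> R^o)) /\ Ph t `<=` L2 Om)
    (Ga : mesh n) (q : R -> node Ga -> 'rV[R]_n.+1)
    (inner : R -> set 'rV[R]_n.+1) (nu : R -> cell Ga -> 'rV[R]_n.+1)
    (hGa : forall t, 0 <= t <= T -> interface Om (inner t) (q t) (nu t))
    (u : R -> 'rV[R]_n.+1 -> 'rV[R]_n.+1) (p : R -> 'rV[R]_n.+1 -> R)
    (B : R -> 'rV[R]_n.+1 -> 'M[R]_n.+1)
    (X dX : R -> 'rV[R]_n.+1 -> 'rV[R]_n.+1) (kappa : R -> 'rV[R]_n.+1 -> R)
    (hsol : solution T Om c z Uh Ph q inner nu u p B X dX kappa)
    (t : R) (ht : 0 < t <= T)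
    (hchi : exists2 r, Ph t r &
       {ae leb n.+1, forall x, Om x -> r x = \1_(inner t) x}) :
  is_tder T (fun s => fine (leb n.+1 (inner s))) t 0.
Proof.
have n0 : (0 < n)%N by case: hd => -[->].
have cov : Om `<=` carrier z by rewrite -(triangulation_cover hTh); exact: subset_closure.
have cz := triangulation_conforming hTh.
have bOm := domain_bounded hOm.
have hI s : 0 < s <= T -> interface Om (inner s) (q s) (nu s).
  by move=> /andP[s0 sT]; apply: hGa; rewrite ltW.
have t0 : 0 <= t <= T by move: ht => /andP[/ltW -> ->].
have [r Pr rE] := hchi.
have [hV VW] := sol_dX hsol ht.
have := is_tder_volume bOm n0 cz cov ht hI (sol_nodes hsol ht) hV VW.
suff -> : lumpedGa (q t) (fun s x => dot (dX t x) (nu t s) * 1) = 0 by [].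
(* The fields at time [t], frozen in time, are admissible for [w] and [H]. Since [Ph] varies, the
   pressure test function is [r] at [t] and the pressure [p] at other times. *)
have [_ inc _ _ kin] : [/\ tderivable T
      (fun s => 2^-1 * intOm Om (fun x => rhoh Om c z q inner s x * dot (u s x) (u t x))) t
      /\ momentum_equation T Om c z q inner nu u p B kappa (fun=> u t) t,
    incompressibility_equation Om u (fun s => if s == t then r else p s) t,
    tderivable T (fun s => lumped z (fun x => frob (B s x) (B t x))) t
      /\ stress_equation T Om c z q inner u B (fun=> B t) t,
    curvature_equation q nu X kappa (fun _ _ => 0) t
    & kinematic_equation q nu u dX (fun _ _ => 1) t].
  apply: (sol_system hsol (w := fun=> u t) (H := fun=> B t) (zeta := fun _ _ => 0) (chi := fun _ _ => 1)) => //.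
  - by move=> s _; exact: sol_u hsol t t0.
  - by move=> s s0 x _; exact: tderivable_cst.
  - by move=> s s0; case: eqP => [->|_] //; exact: sol_p hsol s s0.
  - by move=> s _; have [] := sol_B hsol t0.
  - by move=> s s0 x _; exact: tderivable_cst.
  - move=> s _ i; split; first exact: cst_continuous.
    by move=> s' a _ a1 /=; rewrite -mulr_suml a1 mul1r.
  - move=> s _; split; first exact: cst_continuous.
    by move=> s' a _ a1 /=; rewrite -mulr_suml a1 mul1r.
move: kin; rewrite /kinematic_equation => /esym/eqP; rewrite subr_eq0 => /eqP ->.
have [_ pu] := hUh (u t) (sol_u hsol t0).
rewrite -(flux_divergence (hI t ht) cz cov bOm pu rE).
by move: inc; rewrite /incompressibility_equation eqxx => <-.
Qed.
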